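(* Let $(F,f)\colon(L'\rightrightarrows L'_N;H\rightrightarrows N)\to(L\rightrightarrows L_M;G\rightrightarrows M)$ be a VB Morita map of line bundle groupoids. Then the assignment $\theta\mapsto F^*\theta$ establishes a bijection between $0$-shifted contact structures on $L$ and $0$-shifted contact structures on $L'$.
   Context: A line bundle groupoid (LBG) $(L\rightrightarrows L_M;G\rightrightarrows M)$ consists of (Hausdorff) Lie groupoids $L\rightrightarrows L_M$, $G\rightrightarrows M$ and line bundles $L\to G$, $L_M\to M$ such that all structure maps of $L$ are vector bundle (VB) morphisms covering those of $G$ (structure maps of both denoted $s,t,m,i,u$). All structure maps are then isomorphisms on fibers, and $G$ acts on $L_M$ by $g.v=t(s_g^{-1}(v))$, $s_g=s|_{L_g}$. A VB Morita map $(F,f)$ between LBGs is a VB morphism $F$ covering $f$, with $F,f$ Lie groupoid morphisms, such that $F$ is a Morita map of Lie groupoids; it is then an isomorphism on fibers. Line bundle valued forms are pulled back along fiberwise invertible $(F,f)$ by $F^*\theta=F^{-1}\circ\theta\circ df$; here $F^*\theta$, for $\theta\in\Omega^1(M,L_M)$, is the pull-back along $F\colon L'_N\to L_M$. For $\theta\in\Omega^\bullet(M,L_M)$ put $\partial\theta=s^*\theta-t^*\theta\in\Omega^\bullet(G,L)$. Let $A=\ker(ds)|_M$ be the Lie algebroid of $G$, $\rho=dt|_A$ its anchor. Write $E^\dagger=\operatorname{Hom}(E,L_M)$ for a vector bundle $E\to M$ and $\phi^\dagger(\psi)=\psi\circ\phi$ for the transpose; $L_M^\dagger=\mathbb R_M=M\times\mathbb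 R$, $T^\dagger M=(TM)^\dagger$. $DL_M$ is the Atiyah algebroid ($D_xL_M$: $\mathbb R$-linear $\delta\colon\Gamma(L_M)\to L_{M,x}$ with $\delta(f\lambda)=\sigma(\delta)(f)\lambda_x+f(x)\delta(\lambda)$, $\sigma(\delta)\in T_xM$). $\mathcal D\colon A\to DL_M$ is the infinitesimal action: $\mathcal D_a\lambda=\frac{d}{d\varepsilon}|_0\,g(\varepsilon)^{-1}.\lambda_{t(g(\varepsilon))}$ for $a=\frac d{d\varepsilon}|_0g(\varepsilon)$, $g(\varepsilon)$ a curve in $s^{-1}(x)$ with $g(0)=x$. For a connection $\nabla$ on $L_M$, $F_\nabla\colon A\to\mathbb R_M$ is $F_\nabla(a)=\mathcal D_a-\nabla_{\rho(a)}\in\operatorname{End}L_M=\mathbb R_M$. For $\theta\in\Omega^1(M,L_M)$ with $\partial\theta=0$, the Morita curvature of $\theta$ at $x\in M$ is the cochain map from $0\to A_x\xrightarrow{\rho}T_xM\xrightarrow{\theta}L_{M,x}\to0$ to $0\to\mathbb R\xrightarrow{\theta^\dagger}T^\dagger_xM\xrightarrow{\rho^\dagger}A^\dagger_x\to0$ with components $-F_\nabla$, $d^\nabla\theta$ (as $v\mapsto d^\nabla\theta(v,-)$), $F_\nabla^\dagger$; its homotopy class does not depend on $\nabla$. A $0$-shifted contact structure on $L$ is $\theta\in\Omega^1(M,L_M)$ with $\partial\theta=0$ whose Morita curvature at $x$ is a quasi-isomorphism for all $x\in M$. *)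

(* Defs.v *)
From HB Require Import structures.
From mathcomp Require Import all_boot all_order all_algebra.
From mathcomp Require Import all_classical all_reals all_analysis.
From mathcomp Require Import ring.

Set Implicit Arguments.
Unset Strict Implicit.
Unset Printing Implicit Defensive.
Import Order.TTheory GRing.Theory Num.Theory numFieldNormedType.Exports.
Local Open Scope classical_set_scope.
Local Open Scope ring_scope.

(* A smooth manifold is represented by its set together with its algebra of   *)
(* smooth functions: a differential space (in the sense of Sikorski) that is  *)
(* Hausdorff, second countable and locally diffeomorphic to open subsets of   *)
(* R^n. Products and subsets (in particular the fibred products occurring in  *)
(* the definition of a Lie groupoid and of a Morita map) are again            *)
(* differential spaces; on a product of manifolds, on an open subset and on   *)
(* an embedded submanifold, this gives the usual manifold structure.          *)

Section SubModule.
Variable R : realType.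

Record submodule (V : lmodType R) := Submodule {
  subm_set :> V -> Prop;
  subm0 : subm_set 0;
  subm_lin : forall (a : R) u v,
    subm_set u -> subm_set v -> subm_set (a *: u + v) }.

Definition subm_pred (V : lmodType R) (S : submodule V) : {pred V} :=
  fun u => `[< S u >].

Lemma subm_closed (V : lmodType R) (S : submodule V) :
  submod_closed (subm_pred S).
Proof.
split; first exact/asboolP/subm0.
by move=> a u v /asboolP Su /asboolP Sv; apply/asboolP/subm_lin.
Qed.

HB.instance Definition _ (V : lmodType R) (S : submodule V) :=
  GRing.isSubmodClosed.Build R V (subm_pred S) (subm_closed S).

Definition subm_of (V : lmodType R) (S : submodule V) :=
  {u : V | subm_pred S u}.

HB.instance Definition _ (V : lmodType R) (S : submodule V) :=
  [isSub of subm_of S for @proj1_sig _ _].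
HB.instance Definition _ (V : lmodType R) (S : submodule V) :=
  [Choice of subm_of S by <:].
HB.instance Definition _ (V : lmodType R) (S : submodule V) :=
  [SubChoice_isSubLmodule of subm_of S by <:].

Lemma hom0 (V W : lmodType R) : linear (0 : V -> W).
Proof. by move=> a u v; change (0 = a *: 0 + 0 :> W); rewrite scaler0 addr0. Qed.

Lemma hom_lin (V W : lmodType R) (a : R) (f g : V -> W) :
  linear f -> linear g -> linear (a *: f + g).
Proof.
move=> lf lg b u v.
change (a *: f (b *: u + v) + g (b *: u + v) =
        b *: (a *: f u + g u) + (a *: f v + g v)).
by rewrite lf lg /= !scalerDr !scalerA (mulrC b) addrACA.
Qed.

Definition hom_subm (V W : lmodType R) : submodule (V -> W) :=
  @Submodule (V -> W) (fun f => linear f) (@hom0 V W) (@hom_lin V W).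

Definition homspace (V W : lmodType R) := subm_of (hom_subm V W).

(* [mkHom f] is [f] whenever [f] is linear. *)
Definition mkHom (V W : lmodType R) (f : V -> W) : homspace V W :=
  insubd (0 : homspace V W) f.

(* The inverse of [f] whenever [f] is bijective. *)
Definition linv (V W : lmodType R) (f : V -> W) (w : W) : V :=
  xget 0 [set v | f v = w].

(* [w] is the derivative of [c] at 0, for [V] finite dimensional: as [V]      *)
(* carries no topology, this is tested on linear functionals.                 *)
Definition curve_deriv (V : lmodType R) (c : R -> V) (w : V) : Prop :=
  forall phi : {linear V -> R^o},
    is_derive (0 : R) (1 : R) ((phi : V -> R) \o c) (phi w).

(* The map induced by [phi] from ker d1 / im d0 to ker e1 / im e0 is          *)
(* injective and surjective.                                                  *)
Definition cohom_iso (A0 A1 A2 B0 B1 B2 : lmodType R)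
    (d0 : A0 -> A1) (d1 : A1 -> A2) (e0 : B0 -> B1) (e1 : B1 -> B2)
    (phi : A1 -> B1) : Prop :=
  (forall v, d1 v = 0 -> (exists u, phi v = e0 u) -> exists u, v = d0 u) /\
  (forall w, e1 w = 0 -> exists2 v, d1 v = 0 & exists u, phi v - w = e0 u).

(* For 0 -> A0 -> A1 -> A2 -> 0 and 0 -> B0 -> B1 -> B2 -> 0. *)
Definition quasi_iso (A0 A1 A2 B0 B1 B2 : lmodType R)
    (d0 : A0 -> A1) (d1 : A1 -> A2) (e0 : B0 -> B1) (e1 : B1 -> B2)
    (phi0 : A0 -> B0) (phi1 : A1 -> B1) (phi2 : A2 -> B2) : Prop :=
  let inj0 (V : lmodType R) : 'rV[R]_0 -> V := fun=> 0 in
  let out0 (V : lmodType R) : V -> 'rV[R]_0 := fun=> 0 in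
  [/\ cohom_iso (inj0 A0) d0 (inj0 B0) e0 phi0,
      cohom_iso d0 d1 e0 e1 phi1 &
      cohom_iso d1 (out0 A2) e1 (out0 B2) phi2].

End SubModule.

Section SmoothFunctions.
Variable R : realType.

Fixpoint Ck (n k : nat) (F : 'rV[R]_n -> R) : Prop :=
  continuous F /\
  if k is k'.+1 then
    (forall v x, derivable F x v) /\ (forall v, Ck k' (fun x => 'D_v F x))
  else True.

Definition Cinfty (n : nat) (F : 'rV[R]_n -> R) : Prop := forall k, Ck k F.

Lemma Ck_cst n k (a : R) : Ck k (fun _ : 'rV[R]_n => a).
Proof.
elim: k a => [|k IH] a; split=> //; try by move=> x; exact: cst_continuous.
split=> [v x|v]; first exact: derivable_cst.
rewrite (_ : 'D_v _ = (fun=> 0)); first exact: IH.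
by apply/funext => x; exact: derive_cst.
Qed.

Lemma is_derive_coord n (i : 'I_n) (x v : 'rV[R]_n) :
  is_derive x v (fun z : 'rV[R]_n => z 0 i : R) (v 0 i).
Proof.
have E : (fun h : R => h^-1 *: (((fun z : 'rV[R]_n => z 0 i : R) \o shift x)
            (h *: v) - x 0 i)) @ 0^' --> (v 0 i : R).
  apply: (@cvg_trans _ ((fun=> v 0 i) @ (0 : R)^')); last exact: cvg_cst.
  apply: near_eq_cvg; near=> h.
  have h0 : h != 0 by near: h; exact: nbhs_dnbhs_neq.
  by rewrite /= !mxE addrK /GRing.scale /= mulKf.
split; first by apply/cvg_ex; exists (v 0 i).
exact: (cvg_lim (@Rhausdorff R) E).
Unshelve. all: by end_near. Qed.

Lemma Ck_coord n k (i : 'I_n) : Ck k (fun z : 'rV[R]_n => z 0 i).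
Proof.
case: k => [|k]; split=> //; try by move=> x; exact: coord_continuous.
split=> [v x|v]; first by have [] := is_derive_coord i x v.
rewrite (_ : 'D_v _ = (fun=> v 0 i)); first exact: Ck_cst.
by apply/funext => x; have [] := is_derive_coord i x v.
Qed.

Lemma Ck_continuous n k (F : 'rV[R]_n -> R) : Ck k F -> continuous F.
Proof. by case: k => [|k] []. Qed.

Lemma CkW n k (F : 'rV[R]_n -> R) : Ck k.+1 F -> Ck k F.
Proof.
elim: k F => [|k IH] F [cF [dF DF]]; first by split.
by split=> //; split=> // v; exact/IH/DF.
Qed.

Lemma CkD n k (F G : 'rV[R]_n -> R) :
  Ck k F -> Ck k G -> Ck k (fun z => F z + G z).
Proof.
elim: k F G => [|k IH] F G kF kG; split=> //;
  try by move=> x; apply: continuousD; apply: Ck_continuous; eauto.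
case: kF kG => [cF [dF DF]] [cG [dG DG]].
split=> [v x|v]; first exact: derivableD.
rewrite (_ : 'D_v _ = (fun x => 'D_v F x + 'D_v G x)).
  exact: IH (DF v) (DG v).
by apply/funext => x; rewrite deriveD.
Qed.

Lemma CkM n k (F G : 'rV[R]_n -> R) :
  Ck k F -> Ck k G -> Ck k (fun z => F z * G z).
Proof.
elim: k F G => [|k IH] F G kF kG; split=> //;
  try by move=> x; apply: continuousM; apply: Ck_continuous; eauto.
have kF' := CkW kF; have kG' := CkW kG.
case: kF kG => [cF [dF DF]] [cG [dG DG]].
split=> [v x|v]; first exact: derivableM.
rewrite (_ : 'D_v _ = (fun x => F x * 'D_v G x + G x * 'D_v F x)).
  exact: CkD (IH _ _ kF' (DG v)) (IH _ _ kG' (DF v)).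
by apply/funext => x; rewrite deriveM.
Qed.

End SmoothFunctions.

Section DifferentialSpaces.
Variable R : realType.

(* The open sets of the initial topology of the functions in [C]; for [C] a   *)
(* differential structure, the sets [{y | 0 < phi y}] form a basis of it.     *)
Definition dopen (X : Type) (C : set (X -> R)) (U : set X) : Prop :=
  forall x, U x ->
    exists phi, [/\ C phi, 0 < phi x & forall y, 0 < phi y -> U y].

Record is_dstr (X : Type) (C : set (X -> R)) : Prop := IsDstr {
  dstr_comp : forall n (F : 'rV[R]_n -> R) (phi : 'I_n -> X -> R),
    Cinfty F -> (forall i, C (phi i)) -> C (fun x => F (\row_i phi i x));
  dstr_loc : forall f : X -> R,
    (forall x, exists U, [/\ dopen C U, U x &
       exists2 g, C g & forall y, U y -> f y = g y]) -> C f }.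

(* The smallest differential structure containing [Phi]. *)
Definition gen_dstruct (X : Type) (Phi : set (X -> R)) : set (X -> R) :=
  [set f | forall C, is_dstr C -> Phi `<=` C -> C f].

Lemma gen_sub (X : Type) (Phi : set (X -> R)) : Phi `<=` gen_dstruct Phi.
Proof. by move=> f Pf C _; apply. Qed.

Lemma gen_dstr (X : Type) (Phi : set (X -> R)) : is_dstr (gen_dstruct Phi).
Proof.
split=> [n F phi sF gphi C dC PC|f lf C dC PC].
  by apply: (dstr_comp dC) => // i; exact: gphi.
apply: (dstr_loc dC) => x; have [U [oU Ux [g gg fg]]] := lf x.
exists U; split=> //; last by exists g => //; exact: gg.
move=> y /oU[phi [gphi phiy phiU]]; exists phi; split=> //; exact: gphi.
Qed.

Record diffspace := DiffSpace {
  dcarrier :> Type;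
  sm : set (dcarrier -> R);
  sm_dstr : is_dstr sm }.

Definition dspace_open (X : diffspace) (U : set X) : Prop := dopen (@sm X) U.

(* By [dstr_comp], the coordinates generate exactly the functions in [Cinfty] *)
(* (and the identity of R generates the smooth functions on R).               *)
Definition euclid (n : nat) : diffspace :=
  DiffSpace (gen_dstr
    [set f : 'rV[R]_n -> R | exists i : 'I_n, f = fun z => z 0 i]).

Definition realline : diffspace := DiffSpace (gen_dstr [set @id R]).

Definition dprod (X Y : diffspace) : diffspace :=
  @DiffSpace (X * Y)%type _ (gen_dstr
    ([set f | exists2 g, @sm X g & f = g \o fst] `|`
     [set f | exists2 g, @sm Y g & f = g \o snd])).

Definition dsub (X : diffspace) (A : set X) : diffspace :=
  @DiffSpace {x : X | A x} _ (gen_dstr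
    [set f | exists2 g, @sm X g & f = g \o (@proj1_sig _ _)]).

Definition smooth (X Y : diffspace) (f : X -> Y) : Prop :=
  forall g, @sm Y g -> @sm X (g \o f).

Record smap (X Y : diffspace) := Smap {
  smap_fun :> X -> Y;
  smap_smooth : smooth smap_fun }.

Definition is_diffeo (X Y : diffspace) (f : X -> Y) : Prop :=
  smooth f /\ exists g : Y -> X, [/\ smooth g, cancel f g & cancel g f].

Definition hausdorff_dspace (X : diffspace) : Prop :=
  forall x y : X, x <> y ->
    exists U V : set X, [/\ dspace_open U, dspace_open V, U x, V y &
                            U `&` V = set0].

Definition second_countable_dspace (X : diffspace) : Prop :=
  exists B : nat -> set X, (forall k, dspace_open (B k)) /\
    forall (U : set X) x, dspace_open U -> U x ->
      exists k, B k x /\ B k `<=` U.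

Definition is_manifold (X : diffspace) : Prop :=
  exists n : nat,
    [/\ hausdorff_dspace X, second_countable_dspace X &
     forall x : X, exists (U : set X) (V : set (euclid n)),
       [/\ dspace_open U, U x, dspace_open V &
           exists phi : dsub U -> dsub V, is_diffeo phi]].

Lemma smooth_comp (X Y Z : diffspace) (g : smap Y Z) (f : smap X Y) :
  smooth (g \o f).
Proof. by move=> h /(smap_smooth g) /(smap_smooth f). Qed.

Definition smap_comp (X Y Z : diffspace) (g : smap Y Z) (f : smap X Y) :
  smap X Z := Smap (smooth_comp g f).

Lemma smooth_fst (X Y : diffspace) : @smooth (dprod X Y) X fst.
Proof. by move=> g Xg; apply: gen_sub; left; exists g. Qed.

Lemma smooth_val (X : diffspace) (A : set X) :
  @smooth (dsub A) X (@proj1_sig _ _).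
Proof. by move=> g Xg; apply: gen_sub; exists g. Qed.

Definition fibprod (X Y Z : diffspace) (f : smap X Z) (g : smap Y Z) :
  diffspace := @dsub (dprod X Y) [set p | f p.1 = g p.2].

Definition fibprod_fst (X Y Z : diffspace) (f : smap X Z) (g : smap Y Z) :
  smap (fibprod f g) X :=
  smap_comp (Smap (@smooth_fst X Y))
    (Smap (@smooth_val (dprod X Y) [set p | f p.1 = g p.2])).

Definition sm_pred (X : diffspace) : {pred X -> R^o} := fun f => `[< @sm X f >].

Lemma sm_cst (X : diffspace) (a : R) : @sm X (fun=> a).
Proof.
have := @dstr_comp _ _ (sm_dstr X) 0 (fun=> a) (fun _ _ => 0).
by apply=> [k|[]//]; exact: Ck_cst.
Qed.

Lemma sm_add (X : diffspace) (f g : X -> R) :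
  sm f -> sm g -> sm (fun x => f x + g x).
Proof.
move=> sf sg.
have := @dstr_comp _ _ (sm_dstr X) 2 (fun z => z 0 0 + z 0 1) (fun i => if i == 0 then f else g).
rewrite (_ : (fun x => _) = (fun x => f x + g x)); last first.
  by apply/funext => x; rewrite !mxE.
apply=> [k|i]; first by apply: CkD; apply: Ck_coord.
by case: ifP.
Qed.

Lemma sm_mul (X : diffspace) (f g : X -> R) :
  sm f -> sm g -> sm (fun x => f x * g x).
Proof.
move=> sf sg.
have := @dstr_comp _ _ (sm_dstr X) 2 (fun z => z 0 0 * z 0 1) (fun i => if i == 0 then f else g).
rewrite (_ : (fun x => _) = (fun x => f x * g x)); last first.
  by apply/funext => x; rewrite !mxE.
apply=> [k|i]; first by apply: CkM; apply: Ck_coord.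
by case: ifP.
Qed.

Lemma sm_submod (X : diffspace) : submod_closed (@sm_pred X).
Proof.
split; first exact/asboolP/sm_cst.
move=> a f g /asboolP sf /asboolP sg; apply/asboolP.
exact: sm_add (sm_mul (sm_cst X a) sf) sg.
Qed.

Lemma sm_subring (X : diffspace) : subring_closed (@sm_pred X).
Proof.
have [s0 sL] := sm_submod X.
split; first exact/asboolP/sm_cst.
  move=> f g sf sg; rewrite -[f - g]addrC -scaleN1r; exact: sL.
by move=> f g /asboolP sf /asboolP sg; apply/asboolP; exact: sm_mul.
Qed.

HB.instance Definition _ (X : diffspace) :=
  GRing.isSubmodClosed.Build R (X -> R^o) (@sm_pred X) (@sm_submod X).

Definition Cinf (X : diffspace) := {f : X -> R^o | @sm_pred X f}.

HB.instance Definition _ (X : diffspace) :=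
  [isSub of Cinf X for @proj1_sig _ _].
HB.instance Definition _ (X : diffspace) := [Choice of Cinf X by <:].
HB.instance Definition _ (X : diffspace) :=
  [SubChoice_isSubLmodule of Cinf X by <:].
HB.instance Definition _ (X : diffspace) :=
  GRing.SubZmodule_isSubPzRing.Build (X -> R^o) (@sm_pred X) (Cinf X)
    (@sm_subring X).

Lemma Cinf_sm (X : diffspace) (f : Cinf X) : sm (val f : X -> R).
Proof. by case: f => f /= /asboolP. Qed.

Definition mkCinf (X : diffspace) (f : X -> R) (sf : sm f) : Cinf X :=
  exist _ (f : X -> R^o) (asboolT sf).

Definition pull (X Y : diffspace) (f : smap X Y) (h : Cinf Y) : Cinf X :=
  mkCinf (smap_smooth f (Cinf_sm h)).

Record derivation_at (X : diffspace) (x : X) (v : Cinf X -> R^o) : Prop :=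
  DerivationAt {
  der_lin : forall (a : R) f g, v (a *: f + g) = a * v f + v g;
  der_mul : forall f g, v (f * g) = (val f x : R) * v g + (val g x : R) * v f }.

Lemma derivation0 (X : diffspace) (x : X) : derivation_at x 0.
Proof.
split=> [a f g|f g]; first by change (0 = a * 0 + 0 :> R); ring.
by change (0 = val f x * 0 + val g x * 0 :> R); ring.
Qed.

Lemma derivation_lin (X : diffspace) (x : X) (a : R) (v w : Cinf X -> R^o) :
  derivation_at x v -> derivation_at x w -> derivation_at x (a *: v + w).
Proof.
case=> lv mv [lw mw]; split=> [b f g|f g].
  change (a * v (b *: f + g) + w (b *: f + g) =
          b * (a * v f + w f) + (a * v g + w g) :> R).
  by rewrite lv lw; ring.
change (a * v (f * g) + w (f * g) =
        (val f x : R) * (a * v g + w g) + (val g x : R) * (a * v f + w f) :> R).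
by rewrite mv mw; ring.
Qed.

Definition tangent_subm (X : diffspace) (x : X) :
  submodule (Cinf X -> R^o) :=
  @Submodule R (Cinf X -> R^o) (derivation_at x)
    (derivation0 x) (@derivation_lin X x).

Definition tangent (X : diffspace) (x : X) := subm_of (tangent_subm x).

HB.instance Definition _ (X : diffspace) (x : X) := GRing.Lmodule.on (tangent x).

Definition tan_fun (X : diffspace) (x : X) (v : tangent x) : Cinf X -> R :=
  val v.

Lemma tangentP (X : diffspace) (x : X) (v : tangent x) :
  derivation_at x (tan_fun v).
Proof. exact: (asboolW (valP v)). Qed.

Definition mkTangent (X : diffspace) (x : X) (v : Cinf X -> R)
  (dv : derivation_at x v) : tangent x :=
  exist _ (v : Cinf X -> R^o) (asboolT dv).

Lemma dmap_subproof (X Y : diffspace) (f : smap X Y) (x : X) (v : tangent x) :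
  derivation_at (f x) (fun h => tan_fun v (pull f h)).
Proof.
have [lv mv] := tangentP v; split=> [a g h|g h].
  by rewrite -lv; congr (tan_fun v _); apply/val_inj.
by rewrite (_ : pull f (g * h) = pull f g * pull f h) ?mv//; apply/val_inj.
Qed.

Definition dmap (X Y : diffspace) (f : smap X Y) (x : X) (v : tangent x) :
  tangent (f x) := mkTangent (dmap_subproof f v).

Definition surj_submersion (X Y : diffspace) (f : smap X Y) : Prop :=
  (forall y, exists x, f x = y) /\
  (forall x (w : tangent (f x)), exists v : tangent x, dmap f v = w).

Record vfield (X : diffspace) := VField {
  vf :> forall x : X, tangent x;
  vf_smooth : forall h : Cinf X, sm (fun x => tan_fun (vf x) h) }.

Definition vf_app (X : diffspace) (V : vfield X) (h : Cinf X) : Cinf X :=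
  mkCinf (vf_smooth V h).

Lemma lie_bracket_subproof (X : diffspace) (V W : vfield X) (x : X) :
  derivation_at x (fun h =>
    tan_fun (V x) (vf_app W h) - tan_fun (W x) (vf_app V h)).
Proof.
have appL (U : vfield X) a g h :
    vf_app U (a *: g + h) = a *: vf_app U g + vf_app U h.
  by apply/val_inj/funext => y /=; rewrite (der_lin (tangentP (U y))).
have appM (U : vfield X) g h :
    vf_app U (g * h) = 1 *: (g * vf_app U h) + h * vf_app U g.
  apply/val_inj/funext => y /=; rewrite (der_mul (tangentP (U y))).
  by rewrite scale1r.
split=> [a g h|g h].
  by rewrite !appL !(der_lin (tangentP _)); ring.
rewrite !appM !(der_lin (tangentP _)) !(der_mul (tangentP _)) /=.
by ring.
Qed.

Definition lie_bracket (X : diffspace) (V W : vfield X) (x : X) : tangent x :=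
  mkTangent (lie_bracket_subproof V W x).

End DifferentialSpaces.

Section LineBundles.
Variable R : realType.

Definition frame_map (X : Type) (E : X -> lmodType R) (U : set X)
    (lam : forall x, E x) (p : {x : X | U x} * R) :
    {e : {x : X & E x} | U (projT1 e)} :=
  exist (fun e : {x : X & E x} => U (projT1 e))
    (existT E (sval p.1) (p.2 *: lam (sval p.1))) (svalP p.1).

(* A linear isomorphism from R to a fibre has the form r |-> r lam, so that a *)
(* local trivialization of a line bundle over U is a frame lam over U such    *)
(* that (x, r) |-> r lam(x) is a diffeomorphism from U x R to E|_U.           *)
Record line_bundle (X : diffspace R) := LineBundle {
  lb_fib :> X -> lmodType R;
  lb_sm : set ({x : X & lb_fib x} -> R);
  lb_dstr : is_dstr lb_sm;
  lb_proj_smooth :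
    @smooth R (DiffSpace lb_dstr) X (fun e => projT1 e);
  lb_trivial : forall x : X, exists (U : set X) (lam : forall y, lb_fib y),
    [/\ dspace_open U, U x &
        @is_diffeo R (dprod (dsub U) (realline R))
          (@dsub R (DiffSpace lb_dstr) [set e | U (projT1 e)])
          (@frame_map X lb_fib U lam)] }.

Definition total_space (X : diffspace R) (E : line_bundle X) : diffspace R :=
  DiffSpace (lb_dstr E).

Definition in_total (X : diffspace R) (E : line_bundle X) (x : X) (e : E x) :
  total_space E := existT (lb_fib E) x e.

Definition vb_total_fun (X Y : diffspace R) (E : line_bundle X)
    (E' : line_bundle Y) (f : X -> Y) (F : forall x, E x -> E' (f x))
    (e : total_space E) : total_space E' := in_total (F (projT1 e) (projT2 e)).

Record vbmap (X Y : diffspace R) (E : line_bundle X) (E' : line_bundle Y)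
    (f : smap X Y) := VBMap {
  vb_fib :> forall x, {linear E x -> E' (f x)};
  vb_smooth : smooth (vb_total_fun vb_fib) }.

Definition vb_total (X Y : diffspace R) (E : line_bundle X)
    (E' : line_bundle Y) (f : smap X Y) (F : vbmap E E' f) :
  smap (total_space E) (total_space E') := Smap (vb_smooth F).

Definition smooth_section (X : diffspace R) (E : line_bundle X)
    (lam : forall x, E x) : Prop :=
  @smooth R X (total_space E) (fun x => in_total (lam x)).

Definition form1 (X : diffspace R) (E : line_bundle X) :=
  forall x : X, tangent x -> E x.

Definition is_form1 (X : diffspace R) (E : line_bundle X) (theta : form1 E) :
    Prop :=
  (forall x, linear (theta x)) /\
  (forall V : vfield X, smooth_section (fun x => theta x (V x))).

(* F^* theta = F^-1 o theta o df, for F fibrewise invertible. *)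
Definition form_pull (X Y : diffspace R) (E : line_bundle X)
    (E' : line_bundle Y) (f : smap X Y) (F : vbmap E E' f)
    (theta : form1 E') : form1 E :=
  fun x v => linv (F x) (theta (f x) (dmap f v)).

Record is_connection (X : diffspace R) (E : line_bundle X)
    (nabla : forall x : X, tangent x -> (forall y, E y) -> E x) : Prop :=
  IsConnection {
  conn_lin : forall x (a : R) (v w : tangent x) lam, smooth_section lam ->
    nabla x (a *: v + w) lam = a *: nabla x v lam + nabla x w lam;
  conn_add : forall x (v : tangent x) lam mu,
    smooth_section lam -> smooth_section mu ->
    nabla x v (fun y => lam y + mu y) = nabla x v lam + nabla x v mu;
  conn_leibniz : forall x (v : tangent x) (f : Cinf X) lam,
    smooth_section lam ->
    nabla x v (fun y => (val f y : R) *: lam y) =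
      tan_fun v f *: lam x + (val f x : R) *: nabla x v lam;
  conn_smooth : forall (V : vfield X) lam, smooth_section lam ->
    smooth_section (fun x => nabla x (V x) lam) }.

(* (d^nabla theta)(v, w) = nabla_v (theta W) - nabla_w (theta V)              *)
(* - theta [V, W], for vector fields V, W extending v, w.                     *)
Definition d_nabla (X : diffspace R) (E : line_bundle X)
    (nabla : forall x : X, tangent x -> (forall y, E y) -> E x)
    (theta : form1 E) (x : X) (v w : tangent x) : E x :=
  xget 0 [set z | exists V W : vfield X, [/\ V x = v, W x = w &
    z = nabla x v (fun y => theta y (W y)) - nabla x w (fun y => theta y (V y))
        - theta x (lie_bracket V W x)]].

End LineBundles.

Section LieGroupoids.
Variable R : realType.

(* [gmul (exist _ (g, h) c)] is the product gh, defined if s(g) = t(h). *)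
Record lie_groupoid (G M : diffspace R) := LieGroupoid {
  gsrc : smap G M;
  gtgt : smap G M;
  gunit : smap M G;
  ginv : smap G G;
  gmul : smap (fibprod gsrc gtgt) G;
  arr_manifold : is_manifold G;
  ob_manifold : is_manifold M;
  src_submersion : surj_submersion gsrc;
  tgt_submersion : surj_submersion gtgt;
  src_unit : forall x, gsrc (gunit x) = x;
  tgt_unit : forall x, gtgt (gunit x) = x;
  src_inv : forall g, gsrc (ginv g) = gtgt g;
  tgt_inv : forall g, gtgt (ginv g) = gsrc g;
  src_mul : forall g h (c : gsrc g = gtgt h), gsrc (gmul (exist _ (g, h) c)) = gsrc h;
  tgt_mul : forall g h (c : gsrc g = gtgt h), gtgt (gmul (exist _ (g, h) c)) = gtgt g;
  mul_assoc : forall g h k (c : gsrc g = gtgt h) (c' : gsrc h = gtgt k)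
    (d : gsrc (gmul (exist _ (g, h) c)) = gtgt k)
    (d' : gsrc g = gtgt (gmul (exist _ (h, k) c'))),
    gmul (exist _ (gmul (exist _ (g, h) c), k) d) =
    gmul (exist _ (g, gmul (exist _ (h, k) c')) d');
  mul_unitl : forall g (c : gsrc (gunit (gtgt g)) = gtgt g),
    gmul (exist _ (gunit (gtgt g), g) c) = g;
  mul_unitr : forall g (c : gsrc g = gtgt (gunit (gsrc g))),
    gmul (exist _ (g, gunit (gsrc g)) c) = g;
  mul_invl : forall g (c : gsrc (ginv g) = gtgt g),
    gmul (exist _ (ginv g, g) c) = gunit (gsrc g);
  mul_invr : forall g (c : gsrc g = gtgt (ginv g)),
    gmul (exist _ (g, ginv g) c) = gunit (gtgt g) }.

Record groupoid_morphism (H N G M : diffspace R) (HH : lie_groupoid H N)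
    (GG : lie_groupoid G M) (f : smap H G) (f0 : smap N M) : Prop :=
  GroupoidMorphism {
  mor_src : forall h, gsrc GG (f h) = f0 (gsrc HH h);
  mor_tgt : forall h, gtgt GG (f h) = f0 (gtgt HH h);
  mor_unit : forall y, f (gunit HH y) = gunit GG (f0 y);
  mor_mul : forall h k (c : gsrc HH h = gtgt HH k)
    (d : gsrc GG (f h) = gtgt GG (f k)),
    f (gmul HH (exist _ (h, k) c)) = gmul GG (exist _ (f h, f k) d) }.

(* G x_M N -> M, (g, y) |-> t(g), where s(g) = f0(y). *)
Definition ess_map (N G M : diffspace R) (GG : lie_groupoid G M)
    (f0 : smap N M) : smap (fibprod (gsrc GG) f0) M :=
  smap_comp (gtgt GG) (fibprod_fst (gsrc GG) f0).

(* (N x N) x_(M x M) G *)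
Definition pullback_arrows (N G M : diffspace R) (GG : lie_groupoid G M)
    (f0 : smap N M) : diffspace R :=
  @dsub R (dprod (dprod N N) G)
    [set p | gtgt GG p.2 = f0 p.1.1 /\ gsrc GG p.2 = f0 p.1.2].

Definition ff_map (H N G M : diffspace R) (HH : lie_groupoid H N)
    (GG : lie_groupoid G M) (f : smap H G) (f0 : smap N M)
    (m : groupoid_morphism HH GG f f0) (h : H) : pullback_arrows GG f0 :=
  exist (fun p : dprod (dprod N N) G =>
           gtgt GG p.2 = f0 p.1.1 /\ gsrc GG p.2 = f0 p.1.2)
    ((gtgt HH h, gsrc HH h), f h) (conj (mor_tgt m h) (mor_src m h)).

(* Fully faithful (the arrows of the source are the pull-back) and            *)
(* essentially surjective.                                                    *)
Definition is_morita (H N G M : diffspace R) (HH : lie_groupoid H N)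
    (GG : lie_groupoid G M) (f : smap H G) (f0 : smap N M)
    (m : groupoid_morphism HH GG f f0) : Prop :=
  is_diffeo (ff_map m) /\ surj_submersion (ess_map GG f0).

Lemma dmap0 (X Y : diffspace R) (f : smap X Y) (x : X) :
  dmap f (0 : tangent x) = 0.
Proof. by apply/val_inj. Qed.

Lemma dmapL (X Y : diffspace R) (f : smap X Y) (x : X) (a : R)
  (v w : tangent x) : dmap f (a *: v + w) = a *: dmap f v + dmap f w.
Proof. by apply/val_inj. Qed.

Lemma ker_dmap_lin (X Y : diffspace R) (f : smap X Y) (x : X) (a : R)
    (v w : tangent x) :
  dmap f v = 0 -> dmap f w = 0 -> dmap f (a *: v + w) = 0.
Proof. by move=> v0 w0; rewrite dmapL v0 w0 scaler0 addr0. Qed.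

Definition ker_dmap (X Y : diffspace R) (f : smap X Y) (x : X) :
  submodule (tangent x) :=
  @Submodule R (tangent x) (fun v => dmap f v = 0)
    (dmap0 f x) (@ker_dmap_lin X Y f x).

Definition algebroid (G M : diffspace R) (GG : lie_groupoid G M) (x : M) :=
  subm_of (ker_dmap (gsrc GG) (gunit GG x)).

HB.instance Definition _ (G M : diffspace R) (GG : lie_groupoid G M) (x : M) :=
  GRing.Lmodule.on (algebroid GG x).

Definition anchor (G M : diffspace R) (GG : lie_groupoid G M) (x : M)
    (a : algebroid GG x) : tangent x :=
  ecast y (tangent y) (tgt_unit GG x)
    (dmap (gtgt GG) (val a : tangent (gunit GG x))).

End LieGroupoids.

Section LineBundleGroupoids.
Variable R : realType.

Record lbg := LBG {
  lbg_arr : diffspace R;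
  lbg_ob : diffspace R;
  lbg_base : lie_groupoid lbg_arr lbg_ob;
  lbg_bun : line_bundle lbg_arr;
  lbg_bun0 : line_bundle lbg_ob;
  lbg_tot : lie_groupoid (total_space lbg_bun) (total_space lbg_bun0);
  lsrc : vbmap lbg_bun lbg_bun0 (gsrc lbg_base);
  ltgt : vbmap lbg_bun lbg_bun0 (gtgt lbg_base);
  lunit : vbmap lbg_bun0 lbg_bun (gunit lbg_base);
  linver : vbmap lbg_bun lbg_bun (ginv lbg_base);
  tot_src : gsrc lbg_tot =1 vb_total lsrc;
  tot_tgt : gtgt lbg_tot =1 vb_total ltgt;
  tot_unit : gunit lbg_tot =1 vb_total lunit;
  tot_inv : ginv lbg_tot =1 vb_total linver;
  (* The multiplication is a VB morphism covering that of [lbg_base]: the     *)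
  (* fibre of its domain over (g, h) consists of the composable (a, b) with a *)
  (* over g and b over h.                                                     *)
  tot_mul : forall g h (c : gsrc lbg_base g = gtgt lbg_base h) (r : R)
    (a a' : lbg_bun g) (b b' : lbg_bun h)
    (d : gsrc lbg_tot (in_total a) = gtgt lbg_tot (in_total b))
    (d' : gsrc lbg_tot (in_total a') = gtgt lbg_tot (in_total b'))
    (d'' : gsrc lbg_tot (in_total (r *: a + a')) = gtgt lbg_tot (in_total (r *: b + b'))),
    exists e e' : lbg_bun (gmul lbg_base (exist _ (g, h) c)),
      [/\ gmul lbg_tot (exist _ (in_total a, in_total b) d) = in_total e,
          gmul lbg_tot (exist _ (in_total a', in_total b') d') = in_total e' &
          gmul lbg_tot (exist _ (in_total (r *: a + a'), in_total (r *: b + b')) d'')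
            = in_total (r *: e + e')] }.

Record vb_morita (L' L : lbg) := VBMorita {
  vm_arr : smap (lbg_arr L') (lbg_arr L);
  vm_ob : smap (lbg_ob L') (lbg_ob L);
  vm_bun : vbmap (lbg_bun L') (lbg_bun L) vm_arr;
  vm_bun0 : vbmap (lbg_bun0 L') (lbg_bun0 L) vm_ob;
  vm_base_mor : groupoid_morphism (lbg_base L') (lbg_base L) vm_arr vm_ob;
  vm_tot_mor : groupoid_morphism (lbg_tot L') (lbg_tot L)
                 (vb_total vm_bun) (vb_total vm_bun0);
  vm_morita : is_morita vm_tot_mor }.

Variable L : lbg.
Local Notation G := (lbg_arr L).
Local Notation M := (lbg_ob L).
Local Notation LM := (lbg_bun0 L).
Local Notation A := (algebroid (lbg_base L)).

Definition lbg_act (g : G) (v : LM (gsrc (lbg_base L) g)) : LM (gtgt (lbg_base L) g) :=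
  ltgt L g (linv (lsrc L g) v).

Definition partial_form (theta : form1 LM) : form1 (lbg_bun L) :=
  fun g v => form_pull (lsrc L) theta v - form_pull (ltgt L) theta v.

(* [g] is a curve in s^-1(x) through the unit at x with velocity a, and [c]   *)
(* is the curve e |-> g(e)^-1 . lam_(t(g(e))) in the fibre of L_M over x      *)
(* (recall that s(g^-1) = t(g) and t(g^-1) = s(g) = x).                       *)
Definition inf_action (x : M) (a : A x) (lam : forall y, LM y) : LM x :=
  xget 0 [set w | exists (g : smap (realline R) G) (c : R -> LM x),
    [/\ g 0 = gunit (lbg_base L) x,
        forall e, gsrc (lbg_base L) (g e) = x,
        forall h : Cinf G,
          is_derive (0 : R) (1 : R) ((val h : G -> R) \o g)
            (tan_fun (val a : tangent (gunit (lbg_base L) x)) h),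
        forall e, in_total (lbg_act (lam (gsrc (lbg_base L) (ginv (lbg_base L) (g e)))))
                  = in_total (c e) &
        curve_deriv c w]].

(* D_a - nabla_(rho(a)) in End(L_(M, x)) = R. *)
Definition F_nabla (nabla : forall x : M, tangent x -> (forall y, LM y) -> LM x)
    (x : M) (a : A x) : R :=
  xget 0 [set c | forall lam, smooth_section lam ->
    inf_action a lam - nabla x (anchor a) lam = c *: lam x].

(* From 0 -> A_x -> T_x M -> L_x -> 0 to 0 -> R -> T^dagger -> A^dagger -> 0, *)
(* where L_x^dagger = R. When [theta] is a 1-form and [nabla] a connection,   *)
(* the maps wrapped in [mkHom] are linear, so that [mkHom] leaves them        *)
(* unchanged.                                                                 *)
Definition morita_curvature_qis (theta : form1 LM)
    (nabla : forall x : M, tangent x -> (forall y, LM y) -> LM x) (x : M) :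
    Prop :=
  @quasi_iso R (A x) (tangent x) (LM x)
    R^o (homspace (tangent x) (LM x)) (homspace (A x) (LM x))
    (@anchor R G M (lbg_base L) x)
    (theta x)
    (fun r => mkHom (fun v => (r : R) *: theta x v))
    (fun psi => mkHom (fun a => val psi (anchor a)))
    (fun a => - F_nabla nabla a)
    (fun v => mkHom (fun w => d_nabla nabla theta v w))
    (fun l => mkHom (fun a => F_nabla nabla a *: l)).

(* The homotopy class of the Morita curvature, hence its being a              *)
(* quasi-isomorphism, does not depend on the choice of the connection.        *)
Definition contact0 : set (form1 LM) :=
  [set theta | [/\ is_form1 theta,
    forall g (v : tangent g), partial_form theta v = 0 &
    forall x, exists2 nabla, @is_connection R M LM nabla &
      morita_curvature_qis theta nabla x]].

End LineBundleGroupoids.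

(* Main.v *)
(* Write theta = (sum f_i dg_i) lam near x and let c be the cocycle defined by
   g.lam = c(g) lam for g near the unit at x. If nabla lam = eta lam, then
   F_nabla(a) = - a(c) - eta(rho a), and by finite-dimensional duality for the
   skew form dtheta(v, w) + r theta(w) - s theta(v) on pairs (v, r), (w, s), the
   Morita curvature at x is a quasi-isomorphism iff a |-> (rho a, - a(c)) is a
   bijection from A_x onto the null vectors of this form. Such a condition makes
   sense for any submersion q, with a function k in place of c and the fibres of
   a second submersion in place of those of the source. On the bibundle
   P = G x_M N, the pull-backs of theta and F^*theta along the two legs agree up
   to a factor k, so that the conditions at x and at y, for (x, y) in the image
   of P, are both equivalent to a single one on P. For surjectivity, theta'
   descends along P -> M: two lifts to P of a curve in M are joined by a curve of
   arrows of H, under which theta' is invariant. *)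

Require Import Defs.
From HB Require Import structures.
From mathcomp Require Import all_boot all_order all_algebra.
From mathcomp Require Import all_classical all_reals all_analysis.
From mathcomp Require Import ring lra.

Set Implicit Arguments.
Unset Strict Implicit.
Unset Printing Implicit Defensive.
Import Order.TTheory GRing.Theory Num.Theory numFieldNormedType.Exports.
Local Open Scope classical_set_scope.
Local Open Scope ring_scope.

(** * Calculus on R^n *)

(** The skew form on pairs is that of the symplectization: d(e^tau theta) at tau = 0, where r and s
    are the components along tau. Its null vectors do not see the connection, whose form eta only
    shifts r; hence the condition can be compared across frames and groupoids. The obstacle is that
    spaces are known only through their smooth functions: the bibundle and the fibres are subspaces
    of products, and a map between fibres comes without a differential. The bibundle is therefore
    shown to be, near each point, a smooth retract of R^k, which suffices for coordinates, vector
    fields and curves, and vectors tangent to fibres are moved as velocities of curves. Both devices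
    rest on one analytic fact: near a point of a submersion s there is a smooth rho(x, z) that moves
    x into the fibre over z and fixes x if it is already there. It comes from a contraction
    depending on parameters, made global by cut-offs because smooth maps are total here. The Morita
    hypothesis concerns the total spaces; statements about the bases are extracted from it through
    zero sections. *)

Section Calc.
Variable R : realType.

Lemma line_quot n (F : 'rV[R]_n -> R) (x v : 'rV[R]_n) (t : R) :
  (fun h : R => h^-1 *: (((fun s => F (x + s *: v)) \o shift t) (h *: 1) - F (x + t *: v))) =
  (fun h : R => h^-1 *: ((F \o shift (x + t *: v)) (h *: v) - F (x + t *: v))).
Proof.
apply/funext => h /=; congr (_ *: (F _ - _)).
by rewrite -[h *: 1]/(h * 1) mulr1 scalerDl addrCA.
Qed.

Lemma is_derive_line n (F : 'rV[R]_n -> R) (x v : 'rV[R]_n) (t : R) :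
  derivable F (x + t *: v) v ->
  is_derive t (1 : R) (fun s => F (x + s *: v)) ('D_v F (x + t *: v)).
Proof.
move=> dF; split; first by rewrite /derivable line_quot.
by rewrite /derive line_quot.
Qed.

Lemma MVT_line n (F : 'rV[R]_n -> R) (x v : 'rV[R]_n) (h : R) :
  (forall y, derivable F y v) ->
  exists2 s, `|s| <= `|h| & F (x + h *: v) - F x = h * 'D_v F (x + s *: v).
Proof.
move=> dF.
have D t := is_derive_line (dF (x + t *: v)).
have cF : continuous (fun s : R => F (x + s *: v)).
  by move=> t; apply/differentiable_continuous/derivable1_diffP; have [] := D t.
have [h0|/ltW h0] := leP 0 h.
  have [c /itvP ch E] := MVT_segment h0 (fun t _ => D t) (continuous_subspaceT cF).
  exists c; last by move: E; rewrite scale0r addr0 subr0 mulrC.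
  by rewrite !ger0_norm ?ch//.
have [c /itvP ch E] := MVT_segment h0 (fun t _ => D t) (continuous_subspaceT cF).
exists c; first by rewrite !ler0_norm ?ch// lerN2 ch.
by apply/oppr_inj; move: E; rewrite scale0r addr0 sub0r opprB mulrN mulrC.
Qed.

(** [Ck] records directional derivatives only, so additivity in the direction needs an argument. The
    increment along [v], taken from the displaced point [x + h *: w], is evaluated by the mean value
    theorem; it converges because ['D_v F] is continuous at [x]. *)
Lemma deriveD_dir n (F : 'rV[R]_n -> R) (x v w : 'rV[R]_n) :
  (forall y, derivable F y v) -> derivable F x w ->
  {for x, continuous (fun y => 'D_v F y)} ->
  is_derive x (v + w) F ('D_v F x + 'D_w F x).
Proof.
move=> dv dw cv.
have E : (fun h : R => h^-1 *: ((F \o shift x) (h *: (v + w)) - F x)) @ 0^' -->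
    'D_v F x + 'D_w F x.
  have /choice[s sP] (h : R) : exists s : R, (`|s| <= `|h|)%R /\
      F (x + h *: w + h *: v) - F (x + h *: w) =
      h * 'D_v F (x + h *: w + s *: v).
    by have [s sh Fs] := MVT_line (x + h *: w) h dv; exists s.
  have s0 : s h @[h --> (0 : R)^'] --> (0 : R).
    apply/cvgr0Pnorm_le => e e0.
    by apply: filterS (dnbhs0_le e0) => h he; exact: le_trans (sP h).1 he.
  have p0 : (x + h *: w + s h *: v) @[h --> (0 : R)^'] --> x.
    have id0 : h @[h --> (0 : R)^'] --> (0 : R).
      by apply: cvg_within_filter; exact: cvg_id.
    rewrite -[X in _ --> X](_ : x + 0 *: w + 0 *: v = x); last first.
      by rewrite !scale0r !addr0.
    by apply: cvgD; [apply: cvgD; [exact: cvg_cst|]|]; exact: cvgZr_tmp.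
  have A : 'D_v F (x + h *: w + s h *: v) @[h --> (0 : R)^'] --> 'D_v F x.
    exact: cvg_comp p0 cv.
  apply: cvg_trans (cvgD A dw); apply: near_eq_cvg.
  apply: filterS (nbhs_dnbhs_neq (0 : R)) => h h0.
  change ('D_v F (x + h *: w + s h *: v) + h^-1 * (F (h *: w + x) - F x) =
          h^-1 * (F (h *: (v + w) + x) - F x)).
  apply: (mulfI h0); rewrite mulrDr !mulVKf// -(sP h).2 scalerDr.
  rewrite [h *: w + x]addrC addrA subrK; congr (F _ - F x).
  by rewrite [in RHS]addrC [h *: v + _]addrC addrA.
split; first by apply/cvg_ex; exists ('D_v F x + 'D_w F x).
exact: (cvg_lim (@Rhausdorff R) E).
Qed.

Lemma is_derive_lineP n (F : 'rV[R]_n -> R) (x v : 'rV[R]_n) (d : R) :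
  is_derive (0 : R) (1 : R) (fun s => F (x + s *: v)) d <-> is_derive x v F d.
Proof.
have E := @line_quot n F x v 0; rewrite scale0r addr0 in E.
have E' : (fun h : R => h^-1 *: (((fun s => F (x + s *: v)) \o shift 0) (h *: 1)
    - F (x + 0 *: v))) = (fun h => h^-1 *: ((F \o shift x) (h *: v) - F x)).
  by rewrite scale0r addr0.
split=> -[d1 d2]; split.
- by move: d1; rewrite /derivable E'.
- by rewrite -d2 /derive E'.
- by rewrite /derivable E'.
- by rewrite -d2 /derive E'.
Qed.

Lemma deriveZ_dir n (F : 'rV[R]_n -> R) (x v : 'rV[R]_n) (a d : R) :
  is_derive x v F d -> is_derive x (a *: v) F (a * d).
Proof.
move=> /is_derive_lineP dF; apply/is_derive_lineP.
rewrite (_ : (fun s => _) = (fun s => F (x + s *: v)) \o (fun s => a * s)); last first.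
  by apply/funext => s /=; rewrite scalerA mulrC.
have da : is_derive (0 : R) (1 : R) (fun s => a * s) a.
  by rewrite -[X in is_derive _ _ _ X]mulr1; exact: is_deriveZ.
rewrite mulrC; apply: is_derive1_comp.
by rewrite mulr0.
Qed.

Lemma derive_sum_dir n (F : 'rV[R]_n -> R) (x v : 'rV[R]_n) :
  (forall w y, derivable F y w) -> (forall w, continuous (fun y => 'D_w F y)) ->
  'D_v F x = \sum_i v 0 i * 'D_(delta_mx 0 i) F x.
Proof.
move=> dF cF; rewrite {1}[v]row_sum_delta.
elim/big_rec2 : _ => [|i y1 y2 _ <-].
  by have [_] := deriveZ_dir 0 (derivableP (dF 0 x)); rewrite scale0r mul0r.
have [_ ->] := deriveD_dir (w := y2) (dF (v 0 i *: delta_mx 0 i)) (dF y2 x) (cF _ x).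
by have [_ ->] := deriveZ_dir (v 0 i) (derivableP (dF (delta_mx 0 i) x)).
Qed.

Notation mu := (@lebesgue_measure R).

Lemma Rint01_cst (e : R) : \int[mu]_(_ in `[0, 1]) e = e.
Proof.
transitivity (e * fine (mu `[0, 1]%classic)); first exact: (@Rintegral_cst _ _ _ mu).
by rewrite lebesgue_measure_itv /= lte_fin ltr01 /= oppr0 addr0 mulr1.
Qed.

Section ParamInt.
Context {m : nat} (g : 'rV[R]_m -> R -> R).
Hypothesis cg : continuous (fun z : 'rV[R]_m * R => g z.1 z.2).

(** Joint continuity gives a product neighbourhood of each [(p, u)], and compactness of the segment
    makes the neighbourhood of [p] independent of [u]. This serves both the continuity of the
    integral and the domination needed to differentiate it. *)
Lemma param_unif (p : 'rV[R]_m) (e : R) : 0 < e ->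
  \forall q \near p, forall u, u \in `[0, 1] -> `|g q u - g p u| < e.
Proof.
move=> e0.
have /compact_near_coveringP := @segment_compact R 0 1.
move=> /(_ _ (nbhs p) (fun q u => `|g q u - g p u| < e) _) H.
apply: filterS (H _) => [q /= Hq u u01|u _]; first by apply: Hq.
have e2 : 0 < e / 2 by rewrite divr_gt0.
have /cvgrPdist_lt/(_ _ e2) := @cg (p, u).
rewrite /prop_near1 nbhs_simpl /= => -[[A B] /= [pA uB] AB].
exists (B, A) => //= -[u' q] /= [Bu Aq].
have h1 := AB (q, u') (conj Aq Bu); have h2 := AB (p, u') (conj (nbhs_singleton pA) Bu).
rewrite /= in h1 h2.
rewrite (splitr e) -[_ - _](subrKA (g p u)).
apply: le_lt_trans (ler_normD _ _) _; rewrite distrC addrC.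
by rewrite [ltRHS]addrC ltrD // distrC.
Qed.

Lemma param_cont p : continuous (g p).
Proof.
move=> u; apply: (@cvg_comp _ _ _ (fun v : R => (p, v)) (fun z => g z.1 z.2) (nbhs u)
  (nbhs (p, u))); last exact: (@cg (p, u)).
move=> t [[A B] [/= pA uB] AB]; apply: filterS uB => v Bv.
by apply: AB; split => //; exact: nbhs_singleton.
Qed.

Lemma param_integrable p : mu.-integrable `[0, 1] (EFin \o g p).
Proof.
apply: continuous_compact_integrable; first exact: segment_compact.
by apply: continuous_subspaceT; exact: param_cont.
Qed.

Lemma param_int_cont : continuous (fun p => \int[mu]_(u in `[0, 1]) g p u).
Proof.
move=> p; apply/(@cvgrPdist_le _ _ _ (nbhs (p : 'rV[R]_m)) _) => e e0.
apply: filterS (param_unif p e0) => q Hq.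
rewrite -RintegralB//; try exact: param_integrable.
have ii : mu.-integrable `[0, 1] (EFin \o (fun u => g p u - g q u)).
  apply: continuous_compact_integrable; first exact: segment_compact.
  apply: continuous_subspaceT => u; apply: cvgB; exact: param_cont.
apply: le_trans (le_normr_Rintegral _ ii) _ => //.
apply: (@le_trans _ _ (\int[mu]_(u in `[0, 1]) e)).
  apply: le_Rintegral => //.
  - by apply/integrable_norm.
  - apply: continuous_compact_integrable; first exact: segment_compact.
    by apply: continuous_subspaceT => u; exact: cst_continuous.
  - by move=> u u01; rewrite distrC ltW// Hq.
by rewrite Rint01_cst.
Qed.
End ParamInt.

(** On the line through [p] along [v] this is differentiation under the integral over a parameter
    interval []- e, e[]. The dominating constant is [M + 1]: [M] bounds [dg p] on the segment, and
    [e] is such that [dg] moves by less than 1. *)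
Lemma param_int_derive m (g dg : 'rV[R]_m -> R -> R) (p v : 'rV[R]_m) :
  continuous (fun z : 'rV[R]_m * R => g z.1 z.2) ->
  continuous (fun z : 'rV[R]_m * R => dg z.1 z.2) ->
  (forall q u, is_derive q v (g^~ u) (dg q u)) ->
  is_derive p v (fun q => \int[mu]_(u in `[0, 1]) g q u)
    (\int[mu]_(u in `[0, 1]) dg p u).
Proof.
move=> cg cdg dgP; apply/is_derive_lineP.
pose f (t u : R) := g (p + t *: v) u.
have fP t u : is_derive t (1 : R) (f^~ u) (dg (p + t *: v) u).
  by have [d <-] := dgP (p + t *: v) u; exact: is_derive_line.
have f1E t u : partial1of2 f t u = dg (p + t *: v) u.
  by rewrite partial1of2E; have [] := fP t u.
have [M HM] : exists M : R, forall u : R, u \in `[0, 1] -> `|dg p u| <= M.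
  have cn : {within `[0, 1], continuous (fun u => `|dg p u|)}.
    apply: continuous_subspaceT => u.
    by apply: cvg_norm; exact: (param_cont cdg).
  by have [c _ Mc] := EVT_max ler01 cn; exists `|dg p c|.
have line0 : (p + t *: v) @[t --> (0 : R)] --> p.
  rewrite -[X in _ --> X](_ : p + (0 : R) *: v = p); last by rewrite scale0r addr0.
  by apply: cvgD; [exact: cvg_cst|apply: cvgZr_tmp; exact: cvg_id].
have : nbhs (0 : R) (fun t : R => forall u : R, u \in `[0, 1] ->
    `|dg (p + t *: v) u - dg p u| < 1).
  exact: line0 _ (param_unif cdg p ltr01).
move=> /nbhs_ballP[e /= e0 He].
have I0 : `]- e, e[%classic (0 : R) by rewrite /= in_itv /= e0 oppr_lt0 e0.
have D := @cvg_differentiation_under_integral R _ _ mu f `[0, 1] _ 0 (- e) e I0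
  _ _ (fun=> M + 1) _ _ _.
have {}D : h^-1 *: ((fun x' => \int[mu]_(y in `[0, 1]) f x' y) (h + 0) - (fun x' => \int[mu]_(y in `[0, 1]) f x' y) 0) @[h --> (0 : R)^'] -->
   \int[mu]_(y in `[0, 1]) partial1of2 f 0 y.
  apply: D => //.
  - by move=> x _; exact: param_integrable.
  - move=> u; rewrite addr_ge0//; apply: (@le_trans _ _ `|dg p 0|) => //.
    by apply: HM; rewrite in_itv /= lexx ler01.
  - apply: continuous_compact_integrable; first exact: segment_compact.
    by apply: continuous_subspaceT => u; exact: cst_continuous.
  - move=> t u te u01; rewrite f1E.
    have /He/(_ u u01)/= : ball (0 : R) e t.
      by rewrite /ball /= sub0r normrN ltr_norml; move: te; rewrite /= in_itv.
    move=> H; rewrite -[dg _ _](subrK (dg p u)) addrC.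
    by apply: le_trans (ler_normD _ _) _; rewrite lerD ?HM// ltW.
have E : \int[mu]_(y in `[0, 1]) partial1of2 f 0 y = \int[mu]_(u in `[0, 1]) dg p u.
  by apply: eq_Rintegral => u _; rewrite f1E scale0r addr0.
rewrite E in D.
have {}D : h^-1 *: (((fun s => \int[mu]_(u in `[0, 1]) g (p + s *: v) u) \o shift 0) (h *: 1) - (fun s => \int[mu]_(u in `[0, 1]) g (p + s *: v) u) 0) @[h --> (0 : R)^'] -->
   \int[mu]_(u in `[0, 1]) dg p u.
  by move: D; apply: cvg_trans; apply: near_eq_cvg; near=> h; rewrite /= -[h *: 1]/(h * 1) mulr1.
split; last exact: (cvg_lim (@Rhausdorff R) D).
by apply/cvg_ex; exists (\int[mu]_(u in `[0, 1]) dg p u).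
Unshelve. all: by end_near. Qed.

End Calc.

(** * Hadamard's lemma with smooth coefficients *)

Section Hadamard.
Variable R : realType.
Notation mu := (@lebesgue_measure R).

Lemma cvg_row (T : Type) (F : set_system T) {FF : Filter F} n (f : T -> 'rV[R]_n) (y : 'rV[R]_n) :
  (forall i, (f x 0 i : R) @[x --> F] --> (y 0 i : R)) -> f x @[x --> F] --> y.
Proof.
move=> H A [B yB BA]; rewrite /nbhs /=.
have /filterS : F (fun x => forall j, B 0 j (f x 0 j)).
  by apply: filter_forall => j; apply: H; exact: yB.
by apply=> x Hx; apply: BA => i j; rewrite ord1; exact: Hx.
Qed.

Lemma cvg_coord (T : Type) (F : set_system T) {FF : Filter F} n (f : T -> 'rV[R]_n) (y : 'rV[R]_n) i :
  f x @[x --> F] --> y -> (f x 0 i : R) @[x --> F] --> (y 0 i : R).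
Proof.
move=> H; apply: (@cvg_comp _ _ _ f (fun z : 'rV[R]_n => z 0 i : R) _ _ _ H).
exact: coord_continuous.
Qed.

Lemma row_continuous (T : topologicalType) n (f : T -> 'rV[R]_n) :
  (forall i, continuous (fun x => f x 0 i : R)) -> continuous f.
Proof. by move=> H x; apply: (@cvg_row _ (nbhs x)) => i; exact: H. Qed.

Definition segpt n (p : 'rV[R]_(n + n)) (u : R) : 'rV[R]_n := lsubmx p + u *: rsubmx p.

Lemma segpt_continuous n : continuous (fun z : 'rV[R]_(n + n) * R => segpt z.1 z.2).
Proof.
apply: row_continuous => i.
rewrite (_ : (fun z => _) = (fun w : 'rV[R]_(n + n) * R =>
    w.1 0 (lshift n i) + w.2 * w.1 0 (rshift n i) : R)); last first.
  by apply/funext => w; rewrite !mxE.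
move=> z.
have c1 j : continuous (fun w : 'rV[R]_(n + n) * R => w.1 0 j : R).
  by move=> w; apply: (@cvg_coord _ (nbhs w)); exact: cvg_fst.
have c2 : continuous (fun w : 'rV[R]_(n + n) * R => w.2) by move=> w; exact: cvg_snd.
by apply: (@cvgD _ _ _ (nbhs z)); [exact: c1|apply: (@cvgM _ _ (nbhs z)); [exact: c2|exact: c1]].
Qed.

Lemma segptD n (p q : 'rV[R]_(n + n)) (s u : R) :
  segpt (p + s *: q) u = segpt p u + s *: segpt q u.
Proof.
rewrite /segpt !(linearD, linearZ) /= !scalerA (mulrC u).
by rewrite !addrA; congr (_ + _); rewrite addrAC.
Qed.

(** For [p = (y, w)] this is the integral of u^j F(y + u w) over [0, 1]. Differentiating in the [w]
    half produces a factor [u], so the powers make the family closed under differentiation and its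
    regularity follows by a single induction over all [j]. *)
Definition had n (j : nat) (F : 'rV[R]_n -> R) (p : 'rV[R]_(n + n)) : R :=
  \int[mu]_(u in `[0, 1]) (u ^+ j * F (segpt p u)).

Lemma had_int_cont n j (F : 'rV[R]_n -> R) : continuous F ->
  continuous (fun z : 'rV[R]_(n + n) * R => z.2 ^+ j * F (segpt z.1 z.2)).
Proof.
move=> cF z; apply: (@cvgM _ _ (nbhs z)).
  have c2 : w.2 @[w --> nbhs z] --> z.2 by exact: cvg_snd.
  by apply: (@cvg_comp _ _ _ snd (fun u : R => u ^+ j) _ _ _ c2); exact: exprn_continuous.
apply: (@cvg_comp _ _ _ (fun z => segpt z.1 z.2) F _ _ _ (@segpt_continuous n z)).
exact: cF.
Qed.

Lemma Ck1_derive n k (F : 'rV[R]_n -> R) x v : Ck k.+1 F -> is_derive x v F ('D_v F x).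
Proof. by case=> _ [dF _]; exact: derivableP. Qed.

Lemma Ck1_D n k (F : 'rV[R]_n -> R) v : Ck k.+1 F -> Ck k (fun x => 'D_v F x).
Proof. by case=> _ [_ DF]; exact: DF. Qed.

Lemma Ck1_deriveD n k (F : 'rV[R]_n -> R) x v w : Ck k.+1 F ->
  'D_(v + w) F x = 'D_v F x + 'D_w F x.
Proof.
case=> cF [dF DF].
by have [_ ->] := deriveD_dir (w := w) (dF v) (dF w x) (Ck_continuous (DF v) (x := x)).
Qed.

Lemma Ck1_deriveZ n k (F : 'rV[R]_n -> R) x v (a : R) : Ck k.+1 F ->
  'D_(a *: v) F x = a * 'D_v F x.
Proof. by move=> kF; have [] := deriveZ_dir a (Ck1_derive x v kF). Qed.

Lemma Ck1_derive_sum n k (F : 'rV[R]_n -> R) x v : Ck k.+1 F ->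
  'D_v F x = \sum_i v 0 i * 'D_(delta_mx 0 i) F x.
Proof.
move=> [cF [dF DF]]; apply: derive_sum_dir => // w.
exact: Ck_continuous (DF w).
Qed.

Lemma had_derive n j (F : 'rV[R]_n -> R) p v : Ck 1 F ->
  is_derive p v (had j F)
    (had j (fun x => 'D_(lsubmx v) F x) p + had j.+1 (fun x => 'D_(rsubmx v) F x) p).
Proof.
move=> kF.
have cF := Ck_continuous kF.
have cD w : continuous (fun x => 'D_w F x) by exact: Ck_continuous (Ck1_D w kF).
have c1 := had_int_cont (j := j) (cD (lsubmx v)).
have c2 := had_int_cont (j := j.+1) (cD (rsubmx v)).
rewrite /had -RintegralD//; last 2 first.
- exact: (@param_integrable _ _ (fun p u => u ^+ j * 'D_(lsubmx v) F (segpt p u)) c1 p).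
- exact: (@param_integrable _ _ (fun p u => u ^+ j.+1 * 'D_(rsubmx v) F (segpt p u)) c2 p).
apply: (@param_int_derive _ _ (fun p u => u ^+ j * F (segpt p u)) (fun p u =>
  u ^+ j * 'D_(lsubmx v) F (segpt p u) + u ^+ j.+1 * 'D_(rsubmx v) F (segpt p u))).
- exact: had_int_cont.
- by move=> z; apply: (@cvgD _ _ _ (nbhs z)); [exact: c1|exact: c2].
move=> q u.
have -> : u ^+ j * 'D_(lsubmx v) F (segpt q u) + u ^+ j.+1 * 'D_(rsubmx v) F (segpt q u)
   = u ^+ j * 'D_(segpt v u) F (segpt q u).
  by rewrite /segpt (Ck1_deriveD _ _ _ kF) (Ck1_deriveZ _ _ _ kF) mulrDr mulrA exprSr.
apply: is_deriveZ; apply/is_derive_lineP.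
rewrite (_ : (fun s => _) = (fun s : R => F (segpt q u + s *: segpt v u))).
  exact/is_derive_lineP/(Ck1_derive _ _ kF).
by apply/funext => s; rewrite segptD.
Qed.

Lemma Ck_leq n j k (F : 'rV[R]_n -> R) : (j <= k)%N -> Ck k F -> Ck j F.
Proof.
move=> /subnK <-; elim: (k - j)%N => [//|d IH] /= H.
by apply: IH; apply: CkW; exact: H.
Qed.

Lemma had_Ck n j k (F : 'rV[R]_n -> R) : Ck k F -> Ck k (had j F).
Proof.
elim: k j F => [|k IH] j F kF; split => //.
- by apply: param_int_cont; apply: had_int_cont; exact: Ck_continuous kF.
- by apply: param_int_cont; apply: had_int_cont; exact: Ck_continuous kF.
have k1 : Ck 1 F by exact: Ck_leq kF.
split=> [v x|v]; first by have [] := had_derive j x v k1.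
rewrite (_ : 'D_v _ = (fun p => had j (fun x => 'D_(lsubmx v) F x) p +
    had j.+1 (fun x => 'D_(rsubmx v) F x) p)).
  by apply: CkD; apply: IH; exact: Ck1_D.
by apply/funext => p; have [_ ->] := had_derive j p v k1.
Qed.

Lemma continuous_sumr (T : topologicalType) (I : Type) (s : seq I) (f : I -> T -> R) :
  (forall i, continuous (f i)) -> continuous (fun x => \sum_(i <- s) f i x).
Proof.
move=> cf; elim: s => [|i s IH].
  rewrite (_ : (fun x => _) = (fun=> 0)); first by move=> x; exact: cst_continuous.
  by apply/funext => x; rewrite big_nil.
rewrite (_ : (fun x => _) = (fun x => f i x + \sum_(j <- s) f j x)); last first.
  by apply/funext => x; rewrite big_cons.
by move=> x; apply: (@cvgD _ _ _ (nbhs x)); [exact: cf|exact: IH].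
Qed.

(** Fundamental theorem of calculus on the segment from [y] to [y + w], with ['D_w F] expanded in
    partial derivatives under the integral. *)
Lemma had_FTC n (F : 'rV[R]_n -> R) (y w : 'rV[R]_n) : Ck 1 F ->
  F (y + w) = F y + \sum_i w 0 i * had 0 (fun x => 'D_(delta_mx 0 i) F x) (row_mx y w).
Proof.
move=> kF.
have cD v : continuous (fun x => 'D_v F x) by exact: Ck_continuous (Ck1_D v kF).
have sE u : segpt (row_mx y w) u = y + u *: w by rewrite /segpt row_mxKl row_mxKr.
have D t : is_derive t (1 : R) (fun s => F (y + s *: w)) ('D_w F (y + t *: w)).
  by apply: is_derive_line; have [] := Ck1_derive (y + t *: w) w kF.
have cl : continuous (fun s : R => F (y + s *: w)).
  by move=> t; apply/differentiable_continuous/derivable1_diffP; have [] := D t.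
have cDl v : continuous (fun s : R => 'D_v F (y + s *: w)).
  have c2 := @param_cont _ _ (fun p u => u ^+ 0 * 'D_v F (segpt p u)) (had_int_cont (j := 0) (cD v)) (row_mx y w).
  by rewrite (_ : (fun s => _) = (fun u => u ^+ 0 * 'D_v F (segpt (row_mx y w) u)))//;
    apply/funext => u; rewrite expr0 mul1r sE.
have H : \int[mu]_(u in `[0, 1]) 'D_w F (y + u *: w) = F (y + w) - F y.
  rewrite /Rintegral (@continuous_FTC2 _ _ (fun s => F (y + s *: w)))//.
  - by rewrite scale1r scale0r addr0 /= .
  - by apply: continuous_subspaceT; exact: cDl.
  - split; first by move=> t _; have [] := D t.
    + by apply: cvg_within_filter; exact: cl.
    + by apply: cvg_within_filter; exact: cl.
  - by move=> t _; rewrite derive1E; have [] := D t.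
rewrite -[LHS](subrK (F y)) -H addrC; congr (_ + _).
transitivity (\int[mu]_(u in `[0, 1]) \sum_i w 0 i * 'D_(delta_mx 0 i) F (y + u *: w)).
  by apply: eq_Rintegral => u _; exact: Ck1_derive_sum kF.
have intD v : mu.-integrable `[0, 1] (EFin \o (fun u => 'D_v F (y + u *: w))).
  apply: continuous_compact_integrable; first exact: segment_compact.
  by apply: continuous_subspaceT; exact: cDl.
rewrite /had.
under [in RHS]eq_bigr => i _.
  under eq_Rintegral => u _ do rewrite expr0 mul1r sE.
  rewrite -RintegralZl//; over.
have cwD i : continuous (fun s : R => w 0 i * 'D_(delta_mx 0 i) F (y + s *: w) : R).
  by move=> u; apply: cvgMl_tmp; exact: cDl.
move: (index_enum _) => s.
have intS s' : mu.-integrable `[0, 1] (EFin \o (fun u => \sum_(i <- s') w 0 i * 'D_(delta_mx 0 i) F (y + u *: w))).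
  apply: continuous_compact_integrable; first exact: segment_compact.
  apply: continuous_subspaceT.
  exact: (@continuous_sumr R _ s' (fun i (u : R) => w 0 i * 'D_(delta_mx 0 i) F (y + u *: w)) cwD).
elim: s => [|i s IH].
  rewrite big_nil -[RHS](Rint01_cst 0).
  by apply: eq_Rintegral => u _; rewrite big_nil.
rewrite big_cons -IH -RintegralD//.
  by apply: eq_Rintegral => u _; rewrite big_cons.
apply: continuous_compact_integrable; first exact: segment_compact.
by apply: continuous_subspaceT; exact: cwD.
Qed.

Lemma Cinfty_D n (F : 'rV[R]_n -> R) v : Cinfty F -> Cinfty (fun x => 'D_v F x).
Proof. by move=> sF k; exact: Ck1_D (sF k.+1). Qed.

Lemma Hadamard n (F : 'rV[R]_n -> R) : Cinfty F ->
  exists G : 'I_n -> 'rV[R]_(n + n) -> R, (forall i, Cinfty (G i)) /\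
    forall y w, F (y + w) = F y + \sum_i w 0 i * G i (row_mx y w).
Proof.
move=> sF; exists (fun i => had 0 (fun x => 'D_(delta_mx 0 i) F x)); split.
  by move=> i k; apply: had_Ck; exact: Ck1_D (sF k.+1).
by move=> y w; exact: had_FTC (sF 1%N).
Qed.

End Hadamard.

(** * Chain rules, and smooth functions on R^n as a differential structure *)

Section ChainRule.
Variable R : realType.

Lemma row_mx_cvg (T : Type) (F : set_system T) {FF : Filter F} n m
    (f : T -> 'rV[R]_n) (g : T -> 'rV[R]_m) (y : 'rV[R]_n) (z : 'rV[R]_m) :
  f x @[x --> F] --> y -> g x @[x --> F] --> z ->
  row_mx (f x) (g x) @[x --> F] --> row_mx y z.
Proof.
move=> cf cg; apply: cvg_row => j; case: (splitP j) => k jk.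
  rewrite (_ : j = lshift m k); last exact: val_inj.
  by under eq_fun do rewrite row_mxEl; rewrite row_mxEl; exact: cvg_coord.
rewrite (_ : j = rshift n k); last exact: val_inj.
by under eq_fun do rewrite row_mxEr; rewrite row_mxEr; exact: cvg_coord.
Qed.

Lemma cvg_scale0 n (v : 'rV[R]_n) : (h *: v) @[h --> (0 : R)^'] --> (0 : 'rV[R]_n).
Proof.
rewrite -[X in _ --> X](scale0r v); apply: cvgZr_tmp.
by apply: cvg_within_filter; exact: cvg_id.
Qed.

Lemma cvg_sumr (T : Type) (F : set_system T) {FF : Filter F} (I : Type)
    (s : seq I) (f : I -> T -> R) (l : I -> R) :
  (forall i, f i x @[x --> F] --> l i) ->
  (\sum_(i <- s) f i x) @[x --> F] --> \sum_(i <- s) l i.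
Proof.
move=> cf; elim: s => [|i s IH].
  by rewrite big_nil; under eq_fun do rewrite big_nil; exact: cvg_cst.
by rewrite big_cons; under eq_fun do rewrite big_cons; exact: cvgD.
Qed.

Lemma is_derive_quot (f : R -> R) (t d : R) :
  (h^-1 * (f (h + t) - f t)) @[h --> (0 : R)^'] --> d -> is_derive t (1 : R) f d.
Proof.
move=> H.
have E : (fun h : R => h^-1 *: ((f \o shift t) (h *: 1) - f t)) @ 0^' --> d.
  rewrite (_ : (fun h => _) = (fun h => h^-1 * (f (h + t) - f t)))//.
  by apply/funext => h; rewrite /= -[h *: 1]/(h * 1) mulr1.
split; last exact: (cvg_lim (@Rhausdorff R) E).
by apply/cvg_ex; exists d.
Qed.

Lemma quot_is_derive (f : R -> R) (t d : R) :
  is_derive t (1 : R) f d -> (h^-1 * (f (h + t) - f t)) @[h --> (0 : R)^'] --> d.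
Proof.
move=> [df <-]; move: df; rewrite /derivable /derive.
rewrite (_ : (fun h => _) = (fun h => h^-1 * (f (h + t) - f t)))//.
by apply/funext => h; rewrite /= -[h *: 1]/(h * 1) mulr1.
Qed.

Lemma Cinfty_cst n (a : R) : Cinfty (fun _ : 'rV[R]_n => a).
Proof. by move=> k; exact: Ck_cst. Qed.

Lemma Cinfty_coord n (i : 'I_n) : Cinfty (fun z : 'rV[R]_n => z 0 i).
Proof. by move=> k; exact: Ck_coord. Qed.

Lemma CinftyD n (F G : 'rV[R]_n -> R) : Cinfty F -> Cinfty G -> Cinfty (fun z => F z + G z).
Proof. by move=> sF sG k; exact: CkD. Qed.

Lemma CinftyM n (F G : 'rV[R]_n -> R) : Cinfty F -> Cinfty G -> Cinfty (fun z => F z * G z).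
Proof. by move=> sF sG k; exact: CkM. Qed.

Lemma CinftyN n (F : 'rV[R]_n -> R) : Cinfty F -> Cinfty (fun z => - F z).
Proof.
move=> sF; rewrite (_ : (fun z => _) = (fun z => -1 * F z)).
  by apply: CinftyM => //; exact: Cinfty_cst.
by apply/funext => z; rewrite mulN1r.
Qed.

Lemma Cinfty_sum n (I : Type) (s : seq I) (F : I -> 'rV[R]_n -> R) :
  (forall i, Cinfty (F i)) -> Cinfty (fun z => \sum_(i <- s) F i z).
Proof.
move=> sF; elim: s => [|i s IH].
  rewrite (_ : (fun z => _) = (fun=> 0)); first exact: Cinfty_cst.
  by apply/funext => z; rewrite big_nil.
rewrite (_ : (fun z => _) = (fun z => F i z + \sum_(j <- s) F j z)); first exact: CinftyD.
by apply/funext => z; rewrite big_cons.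
Qed.

Lemma Cinfty_prod n (I : Type) (s : seq I) (F : I -> 'rV[R]_n -> R) :
  (forall i, Cinfty (F i)) -> Cinfty (fun z => \prod_(i <- s) F i z).
Proof.
move=> sF; elim: s => [|i s IH].
  rewrite (_ : (fun z => _) = (fun=> 1)); first exact: Cinfty_cst.
  by apply/funext => z; rewrite big_nil.
rewrite (_ : (fun z => _) = (fun z => F i z * \prod_(j <- s) F j z)); first exact: CinftyM.
by apply/funext => z; rewrite big_cons.
Qed.

Lemma Cinfty_continuous n (F : 'rV[R]_n -> R) : Cinfty F -> continuous F.
Proof. by move=> sF; exact: Ck_continuous (sF 0%N). Qed.

Lemma Cinfty_derive n (F : 'rV[R]_n -> R) x v : Cinfty F -> is_derive x v F ('D_v F x).
Proof. by move=> sF; exact: Ck1_derive (sF 1%N). Qed.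

(** For [w = h e_i] a single summand survives, so the difference quotient is exactly [G i] at a
    point tending to [(y, 0)]. This identifies any choice of the coefficients on the diagonal. *)
Lemma Hadamard_diag n (F : 'rV[R]_n -> R) (G : 'I_n -> 'rV[R]_(n + n) -> R) :
  (forall i, Cinfty (G i)) ->
  (forall y w, F (y + w) = F y + \sum_i w 0 i * G i (row_mx y w)) ->
  forall y i, 'D_(delta_mx 0 i) F y = G i (row_mx y 0).
Proof.
move=> sG FG y i.
suff [] : is_derive y (delta_mx 0 i) F (G i (row_mx y 0)) by [].
apply/is_derive_lineP/is_derive_quot; rewrite scale0r addr0.
have cG : G i (row_mx y (h *: delta_mx 0 i)) @[h --> (0 : R)^'] --> G i (row_mx y 0).
  apply: (@cvg_comp _ _ _ (fun h : R => row_mx y (h *: delta_mx 0 i)) (G i) _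
    (nbhs (row_mx y 0))); last exact: Cinfty_continuous.
  by apply: row_mx_cvg; [exact: cvg_cst|exact: cvg_scale0].
apply: cvg_trans cG; apply: near_eq_cvg.
apply: filterS (nbhs_dnbhs_neq (0 : R)) => h h0.
rewrite addr0 FG addrAC subrr add0r (bigD1 i)//= big1 ?addr0.
  by rewrite !mxE !eqxx mulr1 mulKf.
by move=> j ji; rewrite !mxE (negbTE ji) andbF mulr0 mul0r.
Qed.

(** By Hadamard's lemma the increment of [F] is a combination of the increments of the [c i] with
    continuous coefficients, so the limit is taken term by term. *)
Lemma chain_curve n (F : 'rV[R]_n -> R) (c : 'I_n -> R -> R) (t : R) (d : 'I_n -> R) :
  Cinfty F -> (forall i, is_derive t (1 : R) (c i) (d i)) ->
  is_derive t (1 : R) (fun s => F (\row_i c i s))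
    (\sum_i d i * 'D_(delta_mx 0 i) F (\row_i c i t)).
Proof.
move=> sF dc; have [G [sG FG]] := Hadamard sF.
apply: is_derive_quot.
pose y : 'rV[R]_n := \row_i c i t.
have c0 i : c i (h + t) @[h --> (0 : R)^'] --> c i t.
  have ct : {for t, continuous (c i)}.
    by apply/differentiable_continuous/derivable1_diffP; have [] := dc i.
  have st : (h + t) @[h --> (0 : R)^'] --> t.
    rewrite -[X in _ --> X]add0r; apply: cvgD; last exact: cvg_cst.
    by apply: cvg_within_filter; exact: cvg_id.
  exact: (@cvg_comp _ _ _ (fun h : R => h + t) (c i) _ (nbhs t) _ st ct).
have cw : (\row_i c i (h + t) - y) @[h --> (0 : R)^'] --> (0 : 'rV[R]_n).
  rewrite -(subrr y); apply: cvgB; last exact: cvg_cst.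
  apply: cvg_row => i; under eq_fun do rewrite mxE.
  by rewrite /y mxE; exact: c0.
have cG i : G i (row_mx y (\row_i c i (h + t) - y)) @[h --> (0 : R)^'] --> G i (row_mx y 0).
  apply: (@cvg_comp _ _ _ (fun h : R => row_mx y (\row_i c i (h + t) - y)) (G i) _
    (nbhs (row_mx y 0))); last exact: Cinfty_continuous.
  by apply: row_mx_cvg; [exact: cvg_cst|].
under [X in _ --> X]eq_bigr do rewrite (Hadamard_diag sG FG).
apply: (@cvg_trans _ ((\sum_i h^-1 * (c i (h + t) - c i t) *
    G i (row_mx y (\row_i c i (h + t) - y))) @[h --> (0 : R)^'])); last first.
  by apply: cvg_sumr => i; apply: cvgM; [exact: quot_is_derive|exact: cG].
apply: near_eq_cvg.
apply: filterS (nbhs_dnbhs_neq (0 : R)) => h h0.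
have -> : F (\row_i c i (h + t)) =
    F y + \sum_i (\row_i c i (h + t) - y) 0 i * G i (row_mx y (\row_i c i (h + t) - y)).
  by rewrite -FG subrKC.
rewrite -/y [F y + _]addrC addrK mulr_sumr.
by apply: eq_bigr => i _; rewrite !mxE mulrA.
Qed.

Lemma chain_line n m (F : 'rV[R]_n -> R) (f : 'I_n -> 'rV[R]_m -> R) (x v : 'rV[R]_m)
    (d : 'I_n -> R) :
  Cinfty F -> (forall i, is_derive x v (f i) (d i)) ->
  is_derive x v (fun z => F (\row_i f i z))
    (\sum_i d i * 'D_(delta_mx 0 i) F (\row_i f i x)).
Proof.
move=> sF df; apply/is_derive_lineP.
have := @chain_curve n F (fun i s => f i (x + s *: v)) 0 d sF.
by rewrite scale0r addr0; apply => i; exact/is_derive_lineP.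
Qed.

Lemma Ck_comp n m k (F : 'rV[R]_n -> R) (f : 'I_n -> 'rV[R]_m -> R) :
  Cinfty F -> (forall i, Ck k (f i)) -> Ck k (fun z => F (\row_i f i z)).
Proof.
have cc (F0 : 'rV[R]_n -> R) k' : Cinfty F0 -> (forall i, Ck k' (f i)) ->
    continuous (fun z => F0 (\row_i f i z)).
  move=> sF sf z.
  apply: (@cvg_comp _ _ _ (fun z : 'rV[R]_m => \row_i f i z) F0 (nbhs z)
    (nbhs (\row_i f i z))); last exact: Cinfty_continuous.
  apply: cvg_row => i; under eq_fun do rewrite mxE.
  by rewrite mxE; exact: Ck_continuous (sf i) z.
elim: k F => [|k IH] F sF sf; split => //; try exact: cc sf.
have D x v := chain_line sF (fun i => Ck1_derive x v (sf i)).
split=> [v x|v]; first by have [] := D x v.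
rewrite (_ : 'D_v _ = (fun x => \sum_i 'D_v (f i) x * 'D_(delta_mx 0 i) F (\row_i f i x))).
  elim: (index_enum _) => [|i s IHs].
    rewrite (_ : (fun x => _) = (fun=> 0)); first exact: Ck_cst.
    by apply/funext => x; rewrite big_nil.
  rewrite (_ : (fun x => _) = (fun x => 'D_v (f i) x * 'D_(delta_mx 0 i) F (\row_i f i x)
     + \sum_(i <- s) 'D_v (f i) x * 'D_(delta_mx 0 i) F (\row_i f i x))).
    apply: CkD => //; apply: CkM; first exact: Ck1_D.
    by apply: (IH (fun y => 'D_(delta_mx 0 i) F y)); [exact: Cinfty_D|move=> j; exact: CkW].
  by apply/funext => x; rewrite big_cons.
by apply/funext => x; have [_ ->] := D x v.
Qed.

Lemma Cinfty_comp n m (F : 'rV[R]_n -> R) (f : 'I_n -> 'rV[R]_m -> R) :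
  Cinfty F -> (forall i, Cinfty (f i)) -> Cinfty (fun z => F (\row_i f i z)).
Proof. by move=> sF sf k; apply: Ck_comp => // i; exact: sf. Qed.

Lemma CinftyV n (F : 'rV[R]_n -> R) : Cinfty F -> (forall z, F z != 0) ->
  Cinfty (fun z => (F z)^-1).
Proof.
move=> sF F0.
have cV : continuous (fun z => (F z)^-1).
  move=> z; apply: (@cvgV _ _ (nbhs z)); first exact: F0.
  exact: (Cinfty_continuous sF (x := z)).
suff H k : Ck k (fun z : 'rV[R]_n => (F z)^-1) by exact: H.
elim: k => [|k IH]; split => //; split=> [v x|v].
  by apply: derivableV => //; have [] := Cinfty_derive x v sF.
rewrite (_ : 'D_v _ = (fun x => - 1 * 'D_v F x * ((F x)^-1 * (F x)^-1))).
  apply: CkM; last exact: CkM.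
  apply: CkM; [exact: Ck_cst|exact: Ck1_D (sF k.+1)].
apply/funext => x; rewrite deriveV//; last by have [] := Cinfty_derive x v sF.
by rewrite mulN1r mulNr -[_ *: _]/(_ * _) mulNr expr2 invfM mulrC.
Qed.

Lemma Ck_local n k (f : 'rV[R]_n -> R) :
  (forall x : 'rV[R]_n, exists2 g, Ck k g & \forall y \near x, f y = g y) -> Ck k f.
Proof.
elim: k f => [|k IH] f lf.
  split => // x; have [g [cg _] fg] := lf x.
  have E : f x = g x by exact: nbhs_singleton fg.
  change (f y @[y --> nbhs (x : 'rV[R]_n)] --> f x).
  rewrite E; apply: cvg_trans (cg x); apply: (@near_eq_cvg _ _ (nbhs (x : 'rV[R]_n))).
  by apply: filterS fg => y ->.
have lf0 (x : 'rV[R]_n) : exists2 g, Ck k g & \forall y \near x, f y = g y.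
  by have [g kg fg] := lf x; exists g => //; exact: CkW.
have cf : continuous f by exact: Ck_continuous (IH _ lf0).
split => //; split=> [v x|v].
  have [g [_ [dg _]] fg] := lf x.
  by apply: near_eq_derivable (dg v x); apply: filterS fg => y ->.
apply: IH => x; have [g kg fg] := lf x.
exists (fun y => 'D_v g y); first exact: Ck1_D.
by apply: filterS (near_join fg) => y fgy; exact: near_eq_derive.
Qed.

Lemma Cinfty_local n (f : 'rV[R]_n -> R) :
  (forall x : 'rV[R]_n, exists2 g, Cinfty g & \forall y \near x, f y = g y) -> Cinfty f.
Proof.
by move=> lf k; apply: Ck_local => x; have [g sg fg] := lf x; exists g.
Qed.

Lemma Cinfty_pos_near n (phi : 'rV[R]_n -> R) (x : 'rV[R]_n) : Cinfty phi ->
  0 < phi x -> \forall y \near x, 0 < phi y.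
Proof.
move=> sphi phix; have /cvgrPdist_lt/(_ _ phix) := Cinfty_continuous sphi (x := x).
apply: filterS => y; rewrite ltr_distlC => /andP[+ _].
by rewrite subrr.
Qed.

Lemma Cinfty_dstr n : is_dstr (fun f : 'rV[R]_n -> R => Cinfty f).
Proof.
split=> [m F phi sF sphi|f lf]; first exact: Cinfty_comp.
apply: Cinfty_local => x; have [U [oU Ux [g sg fg]]] := lf x.
exists g => //; have [phi [sphi phix phiU]] := oU x Ux.
by apply: filterS (Cinfty_pos_near sphi phix) => y /phiU /fg.
Qed.

(** The generated structure is contained in [Cinfty] because [Cinfty] is itself a differential
    structure containing the coordinates; conversely [f] is [f] applied to the coordinate
    functions. *)
Lemma sm_euclidP n (f : 'rV[R]_n -> R) : @sm R (euclid R n) f <-> Cinfty f.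
Proof.
split=> [sf|sf].
  by apply: sf; [exact: Cinfty_dstr|move=> g [i ->]; exact: Cinfty_coord].
have := @dstr_comp _ _ _ (sm_dstr (euclid R n)) n f (fun i z => z 0 i) sf.
rewrite (_ : (fun x => _) = f).
  by apply=> i; apply: gen_sub; exists i.
by apply/funext => x; congr f; apply/rowP => i; rewrite mxE.
Qed.

Lemma sm_reallineP (f : R -> R) :
  @sm R (realline R) f <-> Cinfty (fun z : 'rV[R]_1 => f (z 0 0)).
Proof.
split=> [sf|sf]; last first.
  have H := @dstr_comp _ _ _ (sm_dstr (realline R)) 1 _ (fun i z => z) sf.
  have E : f = (fun x : R => f ((\row_(j < 1) x) 0 0)).
    by apply/funext => x; rewrite mxE.
  by rewrite E; apply: H => i; exact: gen_sub.
apply: (sf (fun f : R -> R => Cinfty (fun z : 'rV[R]_1 => f (z 0 0)))); last first.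
  by move=> g ->; exact: Cinfty_coord.
split=> [m F phi sF sphi|g lg].
  by apply: (@Cinfty_comp _ _ F (fun i z => phi i (z 0 0))).
apply: Cinfty_local => x; have [U [oU Ux [k sk gk]]] := lg (x 0 0).
exists (fun z => k (z 0 0)) => //; have [phi [sphi phix phiU]] := oU _ Ux.
by apply: filterS (Cinfty_pos_near sphi phix) => y /phiU /gk.
Qed.

End ChainRule.

(** * Cut-off functions *)

Section FlatFunction.
Variable R : realType.

(* The derivative of [flat k] is a combination of [flat k.+1], [flat k.+2]. *)
Definition flat (k : nat) (t : R) : R :=
  if 0 < t then t^-1 ^+ k * expR (- t^-1) else 0.

Lemma flat_ge0 k t : 0 <= flat k t.
Proof.
rewrite /flat; case: ifP => // t0.
by rewrite mulr_ge0 ?expR_ge0// exprn_ge0// invr_ge0 ltW.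
Qed.

(** With s = 1/t, the exponential series gives exp(s) >= s^(k+1) / (k+1)!, hence s^k exp(-s) <=
    (k+1)! t. A bound linear in [t] is what makes the derivative at 0 exist. *)
Lemma flat_le k t : flat k t <= k.+1`!%:R * `|t|.
Proof.
rewrite /flat; case: ifP => [t0|_]; last by rewrite mulr_ge0.
have s0 : 0 < t^-1 by rewrite invr_gt0.
have fk : (0 : R) < k.+1`!%:R by rewrite ltr0n fact_gt0.
have : t^-1 ^+ k.+1 / k.+1`!%:R <= expR t^-1.
  by apply: le_trans (expR_ge1Dxn k (ltW s0)); rewrite lerDr.
rewrite ler_pdivrMr// expRN ler_pdivrMr ?expR_gt0// gtr0_norm// exprS.
move=> H; rewrite -(ler_pM2l s0); apply: le_trans H _.
have tn0 : t != 0 by rewrite gt_eqF.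
by rewrite (_ : t^-1 * _ = expR t^-1 * k.+1`!%:R)//; field.
Qed.

Lemma is_derive_flat k t : is_derive t (1 : R) (flat k) (flat k.+2 t - k%:R * flat k.+1 t).
Proof.
have [t0|t0|t0] := ltgtP t 0.
- have -> : flat k.+2 t - k%:R * flat k.+1 t = 0.
    by rewrite /flat ltNge ltW//= mulr0 subr0.
  apply: (@near_eq_is_derive _ _ _ (cst 0)).
    have : \forall y \near t, y < 0 by exact: lt_nbhsl.
    by apply: filterS => y y0; rewrite /flat ltNge ltW.
- have dV : is_derive t (1 : R) (fun y : R => y^-1) (- t^-1 ^+ 2).
    have tn0 : t != 0 by rewrite gt_eqF.
    apply: DeriveDef; first by apply: derivableV => //; exact: derivable_id.
    by rewrite deriveV ?derive_id//; rewrite -[_ *: _]/(_ * _) mulr1 exprVn.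
  have dg (s : R) : is_derive s (1 : R) (fun y : R => y ^+ k * expR (- y))
      (k%:R * s ^+ k.-1 * expR (- s) - s ^+ k * expR (- s)).
    have dE : is_derive s (1 : R) (fun y : R => expR (- y)) (- expR (- s)).
      rewrite -mulrN1; apply: (@is_derive1_comp _ expR -%R) => //.
    have dX : is_derive s (1 : R) (fun y : R => y ^+ k) (k%:R * s ^+ k.-1).
      have := @is_deriveX _ _ id k s 1 1 (is_derive_id _ _).
      rewrite -[_ *: _]/(_ * _) mulr1; congr (is_derive _ _ _ _).
      by apply/funext => y; rewrite exprfctE.
    have := is_deriveM dX dE.
    rewrite (_ : _ + _ = k%:R * s ^+ k.-1 * expR (- s) - s ^+ k * expR (- s))//.
    by rewrite -![_ *: _]/(_ * _); ring.
  have := @is_derive1_comp _ (fun y : R => y ^+ k * expR (- y)) (fun y : R => y^-1) t _ _ (dg t^-1) dV.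
  rewrite (_ : _ * _ = flat k.+2 t - k%:R * flat k.+1 t); last first.
    rewrite /flat t0; case: k {dg} => [|k0] /=; rewrite ?exprS; ring.
  apply: near_eq_is_derive.
  have : \forall y \near t, 0 < y by exact: lt_nbhsr.
  by apply: filterS => y y0; rewrite /flat y0.
- have -> : flat k.+2 t - k%:R * flat k.+1 t = 0.
    by rewrite t0 /flat ltxx mulr0 subr0.
  apply: is_derive_quot; rewrite t0.
  have f0 : flat k 0 = 0 by rewrite /flat ltxx.
  apply/cvgr0Pnorm_le => e e0.
  have C0 : (0 : R) < k.+2`!%:R by rewrite ltr0n fact_gt0.
  apply: filterS2 (dnbhs0_le (divr_gt0 e0 C0)) (nbhs_dnbhs_neq (0 : R)) => h he h0.
  rewrite addr0 f0 subr0.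
  have [hp|hn|hz] := ltgtP h 0; last by rewrite hz eqxx in h0.
    by rewrite /flat ltNge (ltW hp) mulr0 normr0 ltW.
  (* On the positive side the difference quotient at 0 is again a member of the family, and
     [flat_le] makes it tend to 0. *)
  have -> : h^-1 * flat k h = flat k.+1 h by rewrite /flat hn exprS mulrA.
  rewrite ger0_norm ?flat_ge0//; apply: le_trans (flat_le _ _) _.
  by rewrite mulrC -ler_pdivlMr.
Qed.

Lemma flat_Ck k j : Ck j (fun z : 'rV[R]_1 => flat k (z 0 0)).
Proof.
have D k' (x v : 'rV[R]_1) : is_derive x v (fun z : 'rV[R]_1 => flat k' (z 0 0))
    (v 0 0 * (flat k'.+2 (x 0 0) - k'%:R * flat k'.+1 (x 0 0))).
  apply/is_derive_lineP.
  have /is_derive_lineP dc := is_derive_coord 0 x v.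
  have := @is_derive1_comp R (flat k') _ 0 _ (v 0 0) (is_derive_flat _ _) dc.
  by rewrite scale0r addr0 mulrC.
have dc k' : continuous (flat k').
  by move=> t; apply/differentiable_continuous/derivable1_diffP; have [] := is_derive_flat k' t.
have cf k' : continuous (fun z : 'rV[R]_1 => flat k' (z 0 0)).
  move=> z; apply: (@cvg_comp _ _ _ (fun z : 'rV[R]_1 => z 0 0) (flat k') (nbhs z) (nbhs (z 0 0))).
    exact: coord_continuous.
  exact: dc.
elim: j k => [|j IH] k; split => //; split=> [v x|v]; first by have [] := D k x v.
rewrite (_ : 'D_v _ = (fun x : 'rV[R]_1 => v 0 0 * (flat k.+2 (x 0 0) + (- k%:R) * flat k.+1 (x 0 0)))).
  by apply: CkM; [exact: Ck_cst|apply: CkD => //; apply: CkM => //; exact: Ck_cst].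
by apply/funext => x; have [_ ->] := D k x v; rewrite mulNr.
Qed.

Lemma flat0_Cinfty : Cinfty (fun z : 'rV[R]_1 => flat 0 (z 0 0)).
Proof. by move=> k; exact: flat_Ck. Qed.
End FlatFunction.

Section CutoffFunctions.
Variable R : realType.

Lemma flat0_gt0 (t : R) : 0 < t -> 0 < flat 0 t.
Proof. by move=> t0; rewrite /flat t0 expr0 mul1r expR_gt0. Qed.

Lemma flat0_le0 (t : R) : t <= 0 -> flat 0 t = 0.
Proof. by move=> t0; rewrite /flat ltNge t0. Qed.

(** A smooth step from 0, for [t <= 0], to 1, for [t >= 1]. The denominator is positive since [t]
    and [1 - t] are never both nonpositive. *)
Definition chi (t : R) : R := flat 0 t / (flat 0 t + flat 0 (1 - t)).

Lemma chi_den (t : R) : 0 < flat 0 t + flat 0 (1 - t).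
Proof.
have [t0|t0] := ltP 0 t; first by rewrite ltr_pwDl ?flat0_gt0 ?flat_ge0.
by rewrite ltr_wpDl ?flat_ge0// flat0_gt0// subr_gt0 (le_lt_trans t0).
Qed.

Lemma chi_le0 (t : R) : t <= 0 -> chi t = 0.
Proof. by move=> t0; rewrite /chi flat0_le0// mul0r. Qed.

Lemma chi_gt0 (t : R) : 0 < t -> 0 < chi t.
Proof. by move=> t0; rewrite divr_gt0 ?flat0_gt0 ?chi_den. Qed.

Lemma chi_ge1 (t : R) : 1 <= t -> chi t = 1.
Proof.
move=> t1; rewrite /chi [flat 0 (1 - t)]flat0_le0 ?subr_le0// addr0 divff//.
by rewrite gt_eqF// flat0_gt0// (lt_le_trans ltr01).
Qed.

Lemma chi_ge0 (t : R) : 0 <= chi t.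
Proof. by rewrite divr_ge0 ?flat_ge0// ltW ?chi_den. Qed.

Lemma chi_le1 (t : R) : chi t <= 1.
Proof. by rewrite ler_pdivrMr ?chi_den// mul1r lerDl flat_ge0. Qed.

Lemma Cinfty_comp1 n (f : R -> R) (F : 'rV[R]_n -> R) :
  Cinfty (fun z : 'rV[R]_1 => f (z 0 0)) -> Cinfty F -> Cinfty (fun z => f (F z)).
Proof.
move=> sf sF; have := @Cinfty_comp _ _ _ _ (fun _ => F) sf (fun _ => sF).
by congr Cinfty; apply/funext => z; rewrite mxE.
Qed.

Lemma chi_Cinfty : Cinfty (fun z : 'rV[R]_1 => chi (z 0 0)).
Proof.
have s1 := @flat0_Cinfty R.
have s2 : Cinfty (fun z : 'rV[R]_1 => flat 0 (1 - z 0 0)).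
  apply: (Cinfty_comp1 s1 (F := fun z => 1 - z 0 0)).
  by apply: CinftyD; [exact: Cinfty_cst|apply: CinftyN; exact: Cinfty_coord].
apply: CinftyM => //; apply: CinftyV; first exact: CinftyD.
by move=> z; rewrite gt_eqF// chi_den.
Qed.

(** The identity on [-1, 1], where [2 - t ^+ 2] is at least 1, and 0 once |t| is at least 2. Bounded
    and globally Lipschitz, it turns a map controlled only near 0 into one controlled everywhere, as
    a global contraction requires. *)
Definition kap (t : R) : R := t * chi (2 - t ^+ 2).

Lemma kap_Cinfty : Cinfty (fun z : 'rV[R]_1 => kap (z 0 0)).
Proof.
have sc := @Cinfty_coord R 1 0.
apply: CinftyM => //; apply: (Cinfty_comp1 chi_Cinfty (F := fun z => 2 - z 0 0 ^+ 2)).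
apply: CinftyD; first exact: Cinfty_cst.
by apply: CinftyN; apply: CinftyM.
Qed.

Lemma kap_id (t : R) : `|t| <= 1 -> kap t = t.
Proof.
move=> t1; rewrite /kap chi_ge1 ?mulr1// lerBrDr -lerBrDl.
by rewrite (_ : 2 - 1 = 1) ?addrK// -real_normK ?num_real// expr_le1.
Qed.

Lemma kap_out (t : R) : 2 <= `|t| -> kap t = 0.
Proof.
move=> t2; rewrite /kap chi_le0 ?mulr0// subr_le0 -real_normK ?num_real//.
by apply: (le_trans t2); rewrite expr2 ler_peMl// (le_trans _ t2)// ler1n.
Qed.

Lemma kap_le2 (t : R) : `|kap t| <= 2.
Proof.
have [t2|t2] := leP 2 `|t|; first by rewrite kap_out// normr0.
rewrite /kap normrM (ger0_norm (chi_ge0 _)).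
apply: le_trans (ltW t2); rewrite ler_piMr//; exact: chi_le1.
Qed.

(** The derivative is continuous and vanishes outside [-2, 2], hence is bounded; the added 1 only
    makes the constant positive. *)
Lemma kap_lipschitz : exists2 C : R, 0 < C & forall s t, `|kap s - kap t| <= C * `|s - t|.
Proof.
pose F (z : 'rV[R]_1) := kap (z 0 0).
pose e : 'rV[R]_1 := const_mx 1.
pose dk (t : R) := 'D_e F (t *: e).
have D t : is_derive t (1 : R) kap (dk t).
  have := @is_derive_line _ _ F 0 e t; rewrite add0r.
  rewrite (_ : (fun s => _) = kap); last first.
    by apply/funext => s; rewrite /F add0r !mxE mulr1.
  by apply; have [] := Cinfty_derive (t *: e) e kap_Cinfty.
have cdk : continuous dk.
  move=> t; apply: (@cvg_comp _ _ _ (fun t : R => t *: e) (fun z => 'D_e F z) (nbhs t) (nbhs (t *: e))).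
    by apply: cvgZr_tmp; exact: cvg_id.
  exact: Cinfty_continuous (Cinfty_D e kap_Cinfty) _.
have dk0 t : 2 < `|t| -> dk t = 0.
  move=> t2; have [_ <-] := D t; rewrite -(derive_cst (0 : R) t (1 : R)).
  apply: near_eq_derive.
  have : \forall s \near t, 2 < `|s|.
    have cn : {for t, continuous (fun s : R => `|s|)} by exact: norm_continuous.
    have /cvgrPdist_lt/(_ (`|t| - 2)) := cn; rewrite subr_gt0 => /(_ t2).
    by apply: filterS => s; rewrite ltr_distlC => /andP[+ _]; rewrite opprB addrC subrK.
  by apply: filterS => s s2; rewrite kap_out// ltW.
have cn : {within `[- 2, 2], continuous (fun t => `|dk t|)}.
  by apply: continuous_subspaceT => t; apply: cvg_norm; exact: cdk.
have n22 : - 2 <= 2 :> R by rewrite (@le_trans _ _ 0)// oppr_le0.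
have [c _ Hc] := EVT_max n22 cn.
exists (`|dk c| + 1) => [|s t]; first by rewrite ltr_wpDl.
have B x : `|dk x| <= `|dk c| + 1.
  have [x2|x2] := leP `|x| 2; last by rewrite dk0// normr0 addr_ge0.
  have xI : x \in `[- 2, 2] by move: x2; rewrite ler_norml in_itv.
  by rewrite (le_trans (Hc x xI))// lerDl ler01.
have H u v : u <= v -> `|kap v - kap u| <= (`|dk c| + 1) * `|v - u|.
  move=> uv; have ck : {within `[u, v], continuous kap}.
    apply: continuous_subspaceT => x.
    by apply/differentiable_continuous/derivable1_diffP; have [] := D x.
  have [x _ ->] := MVT_segment uv (fun x _ => D x) ck.
  by rewrite normrM ler_wpM2r.
by have [st|/ltW ts] := leP s t; [rewrite distrC [`|s - t|]distrC|]; exact: H.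
Qed.

End CutoffFunctions.

(** * Fixed points depending on parameters, and retractions onto fibres *)

HB.instance Definition _ (R : realType) (m n : nat) :=
  Uniform_isComplete.Build 'M[R]_(m, n) (@mx_complete R m n).

Section ImplicitFunction.
Variable R : realType.

Lemma coord_le_norm n (x : 'rV[R]_n) i : `|x 0 i| <= `|x|.
Proof.
rewrite {2}/Num.norm /= mx_normrE.
exact: (le_bigmax_cond _ (fun k : 'I_1 * 'I_n => `|x k.1 k.2|) (j := (0, i))).
Qed.

Lemma norm_le_coord n (x : 'rV[R]_n) (M : R) : 0 <= M ->
  (forall i, `|x 0 i| <= M) -> `|x| <= M.
Proof.
move=> M0 H; rewrite {1}/Num.norm /= mx_normrE.
by apply: bigmax_le => // -[i j] _ /=; rewrite ord1.
Qed.

Lemma contraction_fixpoint l (f : 'rV[R]_l -> 'rV[R]_l) :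
  (forall t u, `|f t - f u| <= 2^-1 * `|t - u|) -> exists t, t = f t.
Proof.
move=> Lf.
have ff : set_fun setT setT f by [].
pose g := mkfun_fun ff.
have C : is_contraction g.
  exists (2^-1)%:nng; split; first by rewrite /= invf_lt1// ltr1n.
  by move=> [t u] _; exact: Lf.
have [t _ tf] := @banach_fixed_point R 'rV[R]_l setT g C closedT (ex_intro _ 0 I).
by exists t.
Qed.

Lemma dnbhs0_norm_le (f : R -> R) (d M : R) :
  f h @[h --> (0 : R)^'] --> d -> (forall h, h != 0 -> `|f h| <= M) -> `|d| <= M.
Proof.
move=> fd fM; have [//|Md] := leP `|d| M.
move/cvgrPdist_lt : fd => /(_ (`|d| - M)); rewrite subr_gt0 => /(_ Md) H.
have [h [H1 h0]] := @filter_ex _ (0 : R)^' _ _ (filterI H (nbhs_dnbhs_neq (0 : R))).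
have := ler_normD (d - f h) (f h); rewrite subrK; have := fM h h0; lra.
Qed.

Lemma cvg_line n (q v : 'rV[R]_n) : (q + h *: v) @[h --> (0 : R)^'] --> q.
Proof.
rewrite -[X in _ --> X](addr0 q).
by apply: cvgD; [exact: cvg_cst|exact: cvg_scale0].
Qed.

Lemma sum_delta n (f : 'I_n -> R) j : \sum_i f i * (i == j)%:R = f j.
Proof.
rewrite (bigD1 j)//= eqxx mulr1 big1 ?addr0// => i /negbTE ->.
by rewrite mulr0.
Qed.

Section Param.
Variables (m l : nat) (W : 'I_l -> 'rV[R]_(m + l) -> R).
Hypothesis sW : forall j, Cinfty (W j).
Let Wv (q : 'rV[R]_m) (t : 'rV[R]_l) : 'rV[R]_l := \row_j W j (row_mx q t).
Hypothesis LW : forall q t u, `|Wv q t - Wv q u| <= 2^-1 * `|t - u|.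
Variable T : 'rV[R]_m -> 'rV[R]_l.
Hypothesis TW : forall q, T q = Wv q (T q).

Lemma fix_unique q t : t = Wv q t -> t = T q.
Proof.
move=> tW; apply/eqP; rewrite -subr_eq0 -normr_le0 -(pmulr_rle0 _ (_ : 0 < 1 - 2^-1 :> R)).
  by rewrite mulrBl mul1r subr_le0 {1}tW {1}TW.
by rewrite subr_gt0 invf_lt1// ltr1n.
Qed.

Lemma fix_continuous : continuous T.
Proof.
move=> q0; set q1 : 'rV[R]_m := q0; change (T q @[q --> nbhs q1] --> T q1).
have cW : Wv q (T q1) @[q --> nbhs q1] --> Wv q1 (T q1).
  apply: cvg_row => j; under eq_fun do rewrite mxE; rewrite mxE.
  apply: (@cvg_comp _ _ _ (fun q => row_mx q (T q1)) (W j) _ (nbhs (row_mx q1 (T q1)))).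
    by apply: row_mx_cvg; [exact: cvg_id|exact: cvg_cst].
  exact: Cinfty_continuous.
apply/cvgrPdist_le => e e0; have e2 : 0 < e / 2 by rewrite divr_gt0.
move/cvgrPdist_le : cW => /(_ _ e2); apply: filterS => q Hq.
have H : `|T q1 - T q| <= e / 2 + 2^-1 * `|T q1 - T q|.
  rewrite {1}TW {1}[T q]TW -(subrKA (Wv q (T q1))).
  by apply: le_trans (ler_normD _ _) _; rewrite lerD.
lra.
Qed.

Let N (G : 'I_l -> 'I_(m + l) -> 'rV[R]_((m + l) + (m + l)) -> R) p : 'M[R]_l :=
  \matrix_(i, j) ((i == j)%:R - G j (rshift m i) p).

Lemma det_Cinfty n k (A : 'rV[R]_k -> 'M[R]_n) :
  (forall i j, Cinfty (fun z => A z i j)) -> Cinfty (fun z => \det (A z)).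
Proof.
move=> sA; apply: Cinfty_sum => s; apply: CinftyM; first exact: Cinfty_cst.
by apply: Cinfty_prod => i.
Qed.

Lemma adj_Cinfty n k (A : 'rV[R]_k -> 'M[R]_n) i j :
  (forall i j, Cinfty (fun z => A z i j)) -> Cinfty (fun z => (\adj (A z)) i j).
Proof.
move=> sA; rewrite (_ : (fun z => _) = (fun z => (-1) ^+ (j + i) * \det (row' j (col' i (A z))))).
  apply: CinftyM; first exact: Cinfty_cst.
  apply: det_Cinfty => i' j'; rewrite (_ : (fun z => _) = (fun z => A z (lift j i') (lift i j')))//.
  by apply/funext => z; rewrite !mxE.
by apply/funext => z; rewrite !mxE.
Qed.

(** A vector [u] in the kernel equals the derivative of [W] at [y] along [(0, u)], whose norm is at
    most half that of [u] by the contraction bound; so [u = 0]. *)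
Lemma fix_det G : (forall j i, Cinfty (G j i)) ->
  (forall j y w, W j (y + w) = W j y + \sum_i w 0 i * G j i (row_mx y w)) ->
  forall y, \det (N G (row_mx y 0)) != 0.
Proof.
move=> sG WG y; apply/negP => /det0P[u u0 uN].
move/negP : u0; apply; rewrite -normr_le0.
suff H : `|u| <= 2^-1 * `|u| by lra.
apply: norm_le_coord => [|j]; first by rewrite mulr_ge0.
have -> : u 0 j = 'D_(row_mx 0 u) (W j) y.
  have := congr1 (fun v : 'rV[R]_l => v 0 j) uN; rewrite !mxE.
  under eq_bigr => i _ do rewrite !mxE mulrBr.
  rewrite sumrB sum_delta.
  move/eqP; rewrite subr_eq0 => /eqP ->.
  rewrite (Ck1_derive_sum _ _ (sW j 1%N)) big_split_ord /= [X in _ = X + _]big1 ?add0r.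
    by apply: eq_bigr => i _; rewrite row_mxEr (Hadamard_diag (sG j) (WG j)).
  by move=> i _; rewrite row_mxEl mxE mul0r.
have D := Cinfty_derive y (row_mx 0 u) (sW j).
move/is_derive_lineP/quot_is_derive : D; rewrite scale0r addr0 => D.
apply: (dnbhs0_norm_le D) => h h0.
rewrite addr0 normrM normfV ler_pdivrMl ?normr_gt0//.
have := LW (lsubmx y) (rsubmx y + h *: u) (rsubmx y).
rewrite (addrC (rsubmx y)) addrK normrZ (addrC (h *: u)) => H.
rewrite mulrCA; apply: le_trans H; apply: le_trans (coord_le_norm _ j).
rewrite !mxE hsubmxK scale_row_mx scaler0.
by rewrite -[X in W j (X + _)]hsubmxK add_row_mx addr0.
Qed.

(** By Hadamard's lemma the increment D of [T] along [h *: v] satisfies D N = h b, where [N] and [b]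
    depend smoothly on the base point and the increment. Hence D / h = b N^-1, written with the
    adjugate, and in the limit the derivative of [T] is a smooth function [P] of [(q, T q)]. Each
    order of differentiability of [T] then yields the next. *)
Lemma fix_Cinfty j : Cinfty (fun q => T q 0 j).
Proof.
have /choice[G GP] j0 : exists G : 'I_(m + l) -> 'rV[R]_((m + l) + (m + l)) -> R,
    (forall i, Cinfty (G i)) /\
    forall y w, W j0 (y + w) = W j0 y + \sum_i w 0 i * G i (row_mx y w).
  exact: Hadamard.
have sG j0 i : Cinfty (G j0 i) by have [] := GP j0.
have WG j0 : forall y w, W j0 (y + w) = W j0 y + \sum_i w 0 i * G j0 i (row_mx y w).
  by have [] := GP j0.
have dN := fix_det sG WG.
pose b (v : 'rV[R]_m) p : 'rV[R]_l := \row_j0 \sum_i v 0 i * G j0 (lshift l i) p.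
pose Q v p : 'rV[R]_l := (\det (N G p))^-1 *: (b v p *m \adj (N G p)).
pose P v j0 y := Q v (row_mx y 0) 0 j0.
have sN i i' : Cinfty (fun p => N G p i i').
  rewrite (_ : (fun p => _) = (fun p => (i == i')%:R + - G i' (rshift m i) p)).
    by apply: CinftyD; [exact: Cinfty_cst|apply: CinftyN].
  by apply/funext => p; rewrite mxE.
have sd := det_Cinfty sN.
have sr : forall i, Cinfty (fun y : 'rV[R]_(m + l) => (row_mx y (0 : 'rV[R]_(m + l))) 0 i).
  move=> i; case: (splitP i) => k ik.
    rewrite (_ : i = lshift _ k); last exact: val_inj.
    by under eq_fun do rewrite row_mxEl; exact: Cinfty_coord.
  rewrite (_ : i = rshift _ k); last exact: val_inj.
  by under eq_fun do rewrite row_mxEr mxE; exact: Cinfty_cst.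
have restr (f : 'rV[R]_((m + l) + (m + l)) -> R) : Cinfty f ->
    Cinfty (fun y : 'rV[R]_(m + l) => f (row_mx y 0)).
  move=> sf; have := Cinfty_comp sf sr; congr Cinfty.
  by apply/funext => y; congr f; apply/rowP => i; rewrite mxE.
have sb v j0 : Cinfty (fun p => b v p 0 j0).
  under eq_fun do rewrite mxE.
  by apply: Cinfty_sum => i; apply: CinftyM; [exact: Cinfty_cst|].
have sbN v j0 : Cinfty (fun p => (b v p *m \adj (N G p)) 0 j0).
  under eq_fun do rewrite mxE.
  by apply: Cinfty_sum => i; apply: CinftyM => //; exact: adj_Cinfty.
have sP v j0 : Cinfty (P v j0).
  rewrite /P /Q; under eq_fun do rewrite mxE.
  apply: CinftyM; last exact: (restr (fun p => (b v p *m \adj (N G p)) 0 j0)).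
  by apply: CinftyV; [exact: (restr (fun p => \det (N G p)))|].
have D q v j0 : is_derive q v (fun q => T q 0 j0) (P v j0 (row_mx q (T q))).
  apply/is_derive_lineP/is_derive_quot.
  pose y := row_mx q (T q).
  pose w h := row_mx (h *: v) (T (q + h *: v) - T q).
  have c0 : y @[h --> (0 : R)^'] --> y by exact: cvg_cst.
  have cw : w h @[h --> (0 : R)^'] --> (0 : 'rV[R]_(m + l)).
    rewrite -[X in _ --> X](row_mx0 _ 1 m l); apply: row_mx_cvg; first exact: cvg_scale0.
    rewrite -(subrr (T q)); apply: cvgB; last exact: cvg_cst.
    apply: (@cvg_comp _ _ _ (fun h : R => q + h *: v) T _ (nbhs q)); last exact: fix_continuous.
    exact: cvg_line.
  have cp : row_mx y (w h) @[h --> (0 : R)^'] --> row_mx y 0 by exact: row_mx_cvg.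
  have cf (f : 'rV[R]_((m + l) + (m + l)) -> R) : Cinfty f ->
      f (row_mx y (w h)) @[h --> (0 : R)^'] --> f (row_mx y 0).
    move=> sf; apply: (@cvg_comp _ _ _ (fun h => row_mx y (w h)) f _ _ _ cp).
    exact: Cinfty_continuous.
  have cdet := cf _ sd.
  have cQ : Q v (row_mx y (w h)) 0 j0 @[h --> (0 : R)^'] --> P v j0 y.
    rewrite /P /Q; under eq_fun do rewrite mxE; rewrite mxE.
    apply: cvgM; first by apply: cvgV => //; exact: dN.
    exact: cf (sbN v j0).
  apply: cvg_trans cQ; apply: near_eq_cvg.
  have dn0 : \forall h \near (0 : R)^', \det (N G (row_mx y (w h))) != 0.
    have := dN y; rewrite -normr_gt0 => d0.
    move/cvgrPdist_lt : cdet => /(_ _ d0); apply: filterS => h.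
    by apply: contraTneq => ->; rewrite subr0 ltxx.
  apply: filterS2 (nbhs_dnbhs_neq (0 : R)) dn0 => h h0 {}dn0.
  rewrite addr0 scale0r addr0.
  suff H : h *: b v (row_mx y (w h)) = (T (q + h *: v) - T q) *m N G (row_mx y (w h)).
    have -> : T (q + h *: v) 0 j0 - T q 0 j0 = (T (q + h *: v) - T q) 0 j0 by rewrite !mxE.
    apply: (mulfI h0); rewrite mulVKf//.
    suff <- : h *: Q v (row_mx y (w h)) = T (q + h *: v) - T q by rewrite [RHS]mxE.
    rewrite /Q scalerA mulrC -scalerA scalemxAl H -mulmxA mul_mx_adj.
    by rewrite mul_mx_scalar scalerA mulVf// scale1r.
  apply/rowP => j1; rewrite !mxE.
  have E : T (q + h *: v) 0 j1 = W j1 (y + w h).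
    by rewrite {1}TW mxE; congr W; rewrite /y /w add_row_mx addrC subrKC.
  have E0 : T q 0 j1 = W j1 y by rewrite {1}TW mxE.
  rewrite WG big_split_ord /= in E.
  under [in RHS]eq_bigr => i _ do rewrite [N G _ i j1]mxE mulrBr.
  rewrite sumrB sum_delta !mxE E -E0 mulr_sumr.
  rewrite (eq_bigr (fun i => (w h) 0 (lshift l i) * G j1 (lshift l i) (row_mx y (w h)))); last first.
    by move=> i _; rewrite row_mxEl mxE mulrA.
  rewrite [X in _ = _ - X](eq_bigr (fun i => (w h) 0 (rshift m i) * G j1 (rshift m i) (row_mx y (w h)))); last first.
    by move=> i _; rewrite /w row_mxEr.
  ring.
suff H k : forall j0, Ck k (fun q => T q 0 j0) by move=> k; exact: H.
elim: k => [|k IH] j0.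
  split => // q; apply: (@cvg_coord _ _ (nbhs (q : 'rV[R]_m))); exact: fix_continuous.
split; first exact: Ck_continuous (IH j0).
split=> [v q|v]; first by have [] := D q v j0.
rewrite (_ : 'D_v _ = (fun q => P v j0 (\row_i (row_mx q (T q)) 0 i))).
  apply: (@Ck_comp _ _ _ _ _ (fun i q => (row_mx q (T q)) 0 i)) => // i.
  case: (splitP i) => i0 ik.
    rewrite (_ : i = lshift _ i0); last exact: val_inj.
    by under eq_fun do rewrite row_mxEl; exact: Ck_coord.
  rewrite (_ : i = rshift _ i0); last exact: val_inj.
  by under eq_fun do rewrite row_mxEr; exact: IH.
apply/funext => q; have [_ ->] := D q v j0.
by congr (P v j0); apply/rowP => i; rewrite [RHS]mxE.
Qed.

End Param.
End ImplicitFunction.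

(** * Smooth retractions onto the fibres of a submersion of R^k *)

Section Retraction.
Variable R : realType.

Definition kapv n (d : R) (z : 'rV[R]_n) : 'rV[R]_n := \row_i (d * kap (d^-1 * z 0 i)).

Lemma kapv_Cinfty n d i : Cinfty (fun z : 'rV[R]_n => kapv d z 0 i).
Proof.
under eq_fun do rewrite mxE.
apply: CinftyM; first exact: Cinfty_cst.
apply: (Cinfty_comp1 (@kap_Cinfty R) (F := fun z => d^-1 * z 0 i)).
by apply: CinftyM; [exact: Cinfty_cst|exact: Cinfty_coord].
Qed.

Lemma kapv_id n d (z : 'rV[R]_n) : 0 < d -> `|z| <= d -> kapv d z = z.
Proof.
move=> d0 zd; apply/rowP => i; rewrite mxE kap_id ?mulVKf ?gt_eqF//.
rewrite normrM gtr0_norm ?invr_gt0// ler_pdivrMl// mulr1.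
exact: le_trans (coord_le_norm z i) zd.
Qed.

Lemma kapv_le n d (z : 'rV[R]_n) : 0 < d -> `|kapv d z| <= d * 2.
Proof.
move=> d0; apply: norm_le_coord => [|i]; first by rewrite mulr_ge0// ltW.
by rewrite mxE normrM gtr0_norm// ler_pM2l// kap_le2.
Qed.

(** The constant does not depend on the scale [d], so [d] may be chosen after the size of the
    contraction has been fixed. *)
Lemma kapv_lipschitz n : exists2 C : R, 0 < C &
  forall d (z w : 'rV[R]_n), 0 < d -> `|kapv d z - kapv d w| <= C * `|z - w|.
Proof.
have [C C0 LC] := kap_lipschitz R; exists C => // d z w d0.
apply: norm_le_coord => [|i]; first by rewrite mulr_ge0// ltW.
rewrite !mxE -mulrBr normrM gtr0_norm//.
apply: (@le_trans _ _ (d * (C * `|d^-1 * z 0 i - d^-1 * w 0 i|))).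
  by rewrite ler_pM2l.
rewrite -mulrBr normrM gtr0_norm ?invr_gt0//.
rewrite mulrCA mulVKf ?gt_eqF// ler_pM2l//.
by have := coord_le_norm (z - w) i; rewrite !mxE.
Qed.

Lemma filter_ord (T : Type) (F : set_system T) {FF : Filter F} n (P : 'I_n -> set T) :
  (forall i, F (P i)) -> F (fun x => forall i, P i x).
Proof. by move=> H; apply: filter_forall. Qed.

(** The Hadamard coefficients at [(u', u - u')] vanish at the origin, so each is at most e / (n+1)
    near it, and [n] of them add up to at most [e]; [n.+1] avoids dividing by 0. *)
Lemma small_lipschitz n (g : 'rV[R]_n -> R) (e : R) : Cinfty g -> 0 < e ->
  (forall i, 'D_(delta_mx 0 i) g 0 = 0) ->
  exists2 r, 0 < r & forall u u', `|u| < r -> `|u'| < r -> `|g u - g u'| <= e * `|u - u'|.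
Proof.
move=> sg e0 dg; have [G [sG gG]] := Hadamard sg.
have G0 i : G i 0 = 0.
  by rewrite -[RHS](dg i) (Hadamard_diag sG gG) row_mx0.
pose e1 := e / n.+1%:R.
have e10 : 0 < e1 by rewrite divr_gt0.
have : nbhs (0 : 'rV[R]_(n + n)) (fun p => forall i, `|G i p| <= e1).
  apply: filter_ord => i.
  have /cvgrPdist_le/(_ _ e10) := Cinfty_continuous (sG i) (x := 0).
  by apply: filterS => p; rewrite G0 sub0r normrN.
move=> /nbhs_ballP[r /= r0 Hr]; exists (r / 2); first by rewrite divr_gt0.
move=> u u' ur u'r.
rewrite -{1}(subrKC u' u) gG addrC addKr.
apply: le_trans (ler_norm_sum _ _ _) _.
apply: (@le_trans _ _ (\sum_(i < n) `|u - u'| * e1)).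
  apply: ler_sum => i _; rewrite normrM ler_pM//; first exact: coord_le_norm.
  apply: Hr; rewrite mx_norm_ball /ball_ /= sub0r normrN.
  have H : `|row_mx u' (u - u')| <= Num.max `|u'| `|u - u'|.
    apply: norm_le_coord => [|j]; first by rewrite le_max normr_ge0.
    case: (splitP j) => k jk.
      rewrite (_ : j = lshift n k); last exact: val_inj.
      by rewrite row_mxEl le_max coord_le_norm.
    rewrite (_ : j = rshift n k); last exact: val_inj.
    by rewrite row_mxEr le_max coord_le_norm orbT.
  apply: le_lt_trans H _; rewrite gt_max; apply/andP; split; first by lra.
  by apply: le_lt_trans (ler_normB _ _) _; lra.
rewrite sumr_const card_ord -[_ *+ n]mulr_natr -mulrA mulrC ler_wpM2r//.
by rewrite /e1 mulrAC ler_pdivrMr// ler_pM2l// ler_nat.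
Qed.

Lemma mulmx_norm_le n m (B : 'M[R]_(n, m)) : exists2 b : R, 0 < b &
  forall t : 'rV[R]_n, `|t *m B| <= b * `|t|.
Proof.
pose b := 1 + \sum_i \sum_j `|B i j|.
have b0 : 0 < b by rewrite ltr_pwDl// sumr_ge0// => i _; rewrite sumr_ge0.
exists b => // t; apply: norm_le_coord => [|j]; first by rewrite mulr_ge0// ltW.
rewrite mxE; apply: le_trans (ler_norm_sum _ _ _) _.
apply: (@le_trans _ _ (\sum_i \sum_j `|B i j| * `|t|)); last first.
  under eq_bigr do rewrite -mulr_suml.
  by rewrite -mulr_suml ler_wpM2r// lerDr.
apply: ler_sum => i _; rewrite normrM mulrC.
rewrite (bigD1 j)//= -[leLHS]addr0 lerD//; first by rewrite ler_wpM2l// coord_le_norm.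
by rewrite sumr_ge0 // => j' _; rewrite mulr_ge0.
Qed.

(** The map sought is rho(x, z) = x + t B, where B S = 1 for the Jacobian [S] at [a] and [t] solves
    s(x + t B) = z. If [g] is what remains of [s] at [a] beyond its affine part, the equation reads
    t = (z - s a) - (x - a) S - g(x - a + t B). Once [g] is cut off this is a contraction uniform in
    (x, z), so [t] depends smoothly on them; for z = s x near [a] the solution is t = 0, by
    uniqueness. *)
Lemma retraction_rV k l (s : 'I_l -> 'rV[R]_k -> R) (a : 'rV[R]_k) :
  (forall j, Cinfty (s j)) ->
  (forall w : 'rV[R]_l, exists v : 'rV[R]_k, forall j, 'D_v (s j) a = w 0 j) ->
  exists rho : 'I_k -> 'rV[R]_(k + l) -> R,
    [/\ forall i, Cinfty (rho i),
        \forall p \near row_mx a (\row_j s j a),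
          forall j, s j (\row_i rho i p) = p 0 (rshift k j) &
        \forall x \near a, \row_i rho i (row_mx x (\row_j s j x)) = x].
Proof.
move=> ss onto.
have /choice[beta betaP] j : exists v : 'rV[R]_k, forall j', 'D_v (s j') a = (j == j')%:R.
  have [v Hv] := onto (delta_mx 0 j); exists v => j'.
  by rewrite Hv mxE eqxx /= eq_sym.
pose B : 'M[R]_(l, k) := \matrix_(j, i) beta j 0 i.
pose S : 'M[R]_(k, l) := \matrix_(i, j) 'D_(delta_mx 0 i) (s j) a.
have DS (v : 'rV[R]_k) j : 'D_v (s j) a = (v *m S) 0 j.
  rewrite (Ck1_derive_sum _ _ (ss j 1%N)) mxE.
  by apply: eq_bigr => i _; rewrite !mxE.
have BS : B *m S = 1%:M.
  apply/matrixP => j j'; rewrite [RHS]mxE -betaP DS !mxE.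
  by apply: eq_bigr => i _; rewrite !mxE.
pose g j (u : 'rV[R]_k) := s j (a + u) + (- s j a + - (\sum_i u 0 i * S i j)).
have gE j u : g j u = s j (a + u) - s j a - (u *m S) 0 j by rewrite /g mxE addrA.
have ssh j : Cinfty (fun u : 'rV[R]_k => s j (a + u)).
  have := @Cinfty_comp _ _ _ (s j) (fun i u => a 0 i + u 0 i) (ss j).
  rewrite (_ : (fun z => _) = (fun u : 'rV[R]_k => s j (a + u))); last first.
    by apply/funext => u; congr (s j); apply/rowP => i; rewrite !mxE.
  by apply=> i; apply: CinftyD; [exact: Cinfty_cst|exact: Cinfty_coord].
have sg j : Cinfty (g j).
  apply: CinftyD => //; apply: CinftyD; first exact: Cinfty_cst.
  apply: CinftyN; apply: Cinfty_sum => i.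
  by apply: CinftyM; [exact: Cinfty_coord|exact: Cinfty_cst].
have dg j i : 'D_(delta_mx 0 i) (g j) 0 = 0.
  suff [] : is_derive 0 (delta_mx 0 i) (g j) 0 by [].
  apply/is_derive_lineP.
  have d1 : is_derive (0 : R) (1 : R) (fun t : R => s j (a + t *: delta_mx 0 i)) (S i j).
    by apply/is_derive_lineP; rewrite mxE; exact: Cinfty_derive.
  have d2 : is_derive (0 : R) (1 : R) (fun t : R => - s j a + - (t * S i j)) (- S i j).
    rewrite -[X in is_derive _ _ _ X]add0r; apply: is_deriveD.
    apply: is_deriveN; rewrite -[X in is_derive _ _ _ X]mul1r -[X in is_derive _ _ _ X]addr0.
    have := @is_deriveM _ _ id (cst (S i j)) 0 1 1 0 (is_derive_id _ _) (is_derive_cst _ _ _).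
    by rewrite scaler0 add0r -[_ *: _]/(_ * _) mulr1 mul1r addr0.
  have := is_deriveD d1 d2; rewrite subrr; congr (is_derive _ _ _ _).
  apply/funext => t; rewrite /g /= add0r; congr (_ + (_ - _)).
  rewrite (bigD1 i)//= big1 ?addr0 => [|i' ii']; rewrite !mxE ?eqxx ?mulr1//.
  by rewrite (negbTE ii') andbF mulr0 mul0r.
have [C C0 LC] := kapv_lipschitz k.
have [b b0 bB] := mulmx_norm_le B.
(* The constants [C] of the cut-off and [b] of [t |-> t *m B] multiply, so [g] must have Lipschitz
   constant 1 / (2 C b) for the fixed-point map to contract by 1/2. *)
have Cb0 : 0 < 2 * (C * b) by rewrite !mulr_gt0.
have e0 : 0 < (2 * (C * b))^-1 by rewrite invr_gt0.
have /choice[r rP] j : exists r : R, 0 < r /\ forall u u' : 'rV[R]_k, `|u| < r -> `|u'| < r ->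
    `|g j u - g j u'| <= (2 * (C * b))^-1 * `|u - u'|.
  by have [r r0 Hr] := small_lipschitz (sg j) e0 (dg j); exists r.
pose r0 := \big[Num.min/1]_j r j.
have r00 : 0 < r0.
  by rewrite /r0; elim/big_ind : _ => [|x y x0 y0|j _]; rewrite ?lt_min ?x0//; have [] := rP j.
have r0r j : r0 <= r j by exact: bigmin_le_cond.
(* Values of [kapv d] have norm at most 2 d = r0 / 2, inside every ball on which some [g j] is
   controlled. *)
pose d := r0 / 4.
have d0 : 0 < d by rewrite divr_gt0.
have kr (u : 'rV[R]_k) j : `|kapv d u| < r j.
  apply: le_lt_trans (kapv_le u d0) _; apply: lt_le_trans (r0r j).
  by rewrite /d; lra.
pose gt j u := g j (kapv d u).
have sgt j : Cinfty (gt j).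
  have := @Cinfty_comp _ _ _ (g j) (fun i u => kapv d u 0 i) (sg j).
  rewrite (_ : (fun z => _) = gt j); last first.
    by apply/funext => u; congr (g j); apply/rowP => i; rewrite mxE.
  by apply=> i; exact: kapv_Cinfty.
have Lgt j u u' : `|gt j u - gt j u'| <= (2 * (C * b))^-1 * (C * `|u - u'|).
  apply: le_trans ((rP j).2 _ _ (kr u j) (kr u' j)) _.
  by rewrite ler_pM2l// LC.
pose W j (p : 'rV[R]_((k + l) + l)) : R :=
  p 0 (lshift l (rshift k j)) + (- (\sum_i p 0 (lshift l (lshift l i)) * S i j) +
    - gt j (\row_i (p 0 (lshift l (lshift l i)) + \sum_j' p 0 (rshift (k + l) j') * B j' i))).
have WE j (q : 'rV[R]_(k + l)) t : W j (row_mx q t) =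
    q 0 (rshift k j) - (lsubmx q *m S) 0 j - gt j (lsubmx q + t *m B).
  rewrite /W row_mxEl -addrA; congr (_ + (- _ - gt j _)).
    by rewrite mxE; apply: eq_bigr => i _; rewrite row_mxEl !mxE.
  apply/rowP => i; rewrite mxE row_mxEl [RHS]mxE [lsubmx q 0 i]mxE [(t *m B) 0 i]mxE.
  by congr (_ + _); apply: eq_bigr => j' _; rewrite row_mxEr.
have sW j : Cinfty (W j).
  apply: CinftyD; first exact: Cinfty_coord.
  apply: CinftyD; apply: CinftyN.
    by apply: Cinfty_sum => i; apply: CinftyM; [exact: Cinfty_coord|exact: Cinfty_cst].
  apply: (@Cinfty_comp _ _ _ (gt j) (fun i p => p 0 (lshift l (lshift l i)) + \sum_j' p 0 (rshift (k + l) j') * B j' i)) => // i.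
  apply: CinftyD; first exact: Cinfty_coord.
  by apply: Cinfty_sum => j'; apply: CinftyM; [exact: Cinfty_coord|exact: Cinfty_cst].
have LW (q : 'rV[R]_(k + l)) (t u : 'rV[R]_l) :
    `|\row_j W j (row_mx q t) - \row_j W j (row_mx q u)| <= 2^-1 * `|t - u|.
  apply: norm_le_coord => [|j]; first by rewrite mulr_ge0.
  have mxB (x y : 'rV[R]_l) : (x - y) 0 j = x 0 j - y 0 j by rewrite !mxE.
  rewrite mxB [X in X - _]mxE [X in _ - X]mxE !WE.
  set A := q 0 _ - _; set g1 := gt _ _; set g2 := gt _ _.
  have -> : A - g1 - (A - g2) = g2 - g1 by ring.
  apply: le_trans (Lgt _ _ _) _.
  have -> : lsubmx q + u *m B - (lsubmx q + t *m B) = (u - t) *m B.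
    by rewrite opprD addrACA subrr add0r mulmxBl.
  apply: (@le_trans _ _ ((2 * (C * b))^-1 * (C * (b * `|u - t|)))).
    by rewrite ler_pM2l// ler_pM2l// bB.
  have Cn : C != 0 by rewrite gt_eqF.
  have bn : b != 0 by rewrite gt_eqF.
  rewrite (distrC u t); move: `|t - u| => x.
  suff -> : (2 * (C * b))^-1 * (C * (b * x)) = 2^-1 * x by [].
  by field; rewrite Cn bn.
have /choice[T TW] (q : 'rV[R]_(k + l)) : exists t : 'rV[R]_l, t = \row_j W j (row_mx q t).
  by apply: contraction_fixpoint => t u; exact: LW.
have Tu q t := fix_unique LW TW (q := q) (t := t).
have sT j := fix_Cinfty sW LW TW j.
pose p0 : 'rV[R]_(k + l) := row_mx a (\row_j s j a).
pose u (p : 'rV[R]_(k + l)) : 'rV[R]_k := lsubmx p - a + T (p - p0) *m B.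
exists (fun i (p : 'rV[R]_(k + l)) => p 0 (lshift l i) + \sum_j T (p - p0) 0 j * B j i).
have rhoE (p : 'rV[R]_(k + l)) : \row_i (p 0 (lshift l i) + \sum_j T (p - p0) 0 j * B j i) = a + u p.
  by apply/rowP => i; rewrite !mxE addrA subrKC.
have gt0 j (v : 'rV[R]_k) : `|v| <= d -> gt j v = s j (a + v) - s j a - (v *m S) 0 j.
  by move=> vd; rewrite /gt kapv_id// gE.
have l0 : lsubmx (0 : 'rV[R]_(k + l)) = 0 by apply/rowP => i; rewrite !mxE.
have T0 : T 0 = 0.
  symmetry; apply: Tu; apply/rowP => j; rewrite !mxE WE gt0.
    by rewrite l0 !mul0mx !addr0 !mul0mx subrr !mxE !subr0.
  by rewrite l0 mul0mx addr0 normr0 ltW.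
have mxBn n (x y : 'rV[R]_n) i : (x - y) 0 i = x 0 i - y 0 i by rewrite !mxE.
have srho i : Cinfty (fun p : 'rV[R]_(k + l) => p 0 (lshift l i) + \sum_j T (p - p0) 0 j * B j i).
  apply: CinftyD; first exact: Cinfty_coord.
  apply: Cinfty_sum => j; apply: CinftyM; last exact: Cinfty_cst.
  have := @Cinfty_comp _ _ _ (fun q => T q 0 j) (fun i (p : 'rV[R]_(k + l)) => p 0 i + - p0 0 i) (sT j).
  rewrite (_ : (fun z => _) = (fun p => T (p - p0) 0 j)); last first.
    by apply/funext => p; congr (T _ 0 j); apply/rowP => i'; rewrite !mxE.
  by apply=> i'; apply: CinftyD; [exact: Cinfty_coord|exact: Cinfty_cst].
have su i : Cinfty (fun p => u p 0 i).
  have := CinftyD (srho i) (Cinfty_cst _ (- a 0 i)); congr Cinfty.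
  apply/funext => p; have := congr1 (fun v : 'rV[R]_k => v 0 i) (rhoE p).
  by rewrite /= mxE [RHS]mxE => ->; rewrite addrAC subrr add0r.
split => //.
- rewrite -/p0.
  have cu : u p @[p --> nbhs p0] --> (0 : 'rV[R]_k).
    have <- : u p0 = 0 by rewrite /u /p0 row_mxKl !subrr T0 mul0mx add0r.
    by apply: cvg_row => i; exact: Cinfty_continuous.
  move/cvgrPdist_le : cu => /(_ _ d0); apply: filterS => p; rewrite sub0r normrN => ud j.
  rewrite rhoE.
  have lE : lsubmx (p - p0) = lsubmx p - a by rewrite linearB /= /p0 row_mxKl.
  have := congr1 (fun t : 'rV[R]_l => t 0 j) (TW (p - p0)); rewrite /= [in RHS]mxE WE.
  rewrite lE -/(u p) gt0// mxBn.
  have -> : p0 0 (rshift k j) = s j a by rewrite /p0 row_mxEr mxE.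
  have -> : (u p *m S) 0 j = ((lsubmx p - a) *m S) 0 j + T (p - p0) 0 j.
    by rewrite /u mulmxDl -mulmxA BS mulmx1 [LHS]mxE.
  set A := s j (a + _); set Z := (_ *m _) 0 j; move=> H; lra.
- have cx : \forall x \near a, `|x - a| <= d.
    have /cvgrPdist_le/(_ _ d0) := @cvg_id _ (nbhs a).
    by apply: filterS => x; rewrite distrC.
  apply: filterS cx => x xd; rewrite rhoE /u row_mxKl.
  suff <- : 0 = T (row_mx x (\row_j s j x) - p0) by rewrite mul0mx addr0 subrKC.
  apply: Tu; apply/rowP => j; rewrite [RHS]mxE WE [LHS]mxE.
  have -> : lsubmx (row_mx x (\row_j s j x) - p0) = x - a.
    by rewrite linearB /= /p0 !row_mxKl.
  rewrite mul0mx addr0 gt0// subrKC mxBn /p0 !row_mxEr ![(\row__ _) _ _]mxE; lra.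
Qed.
End Retraction.

(** * Differential spaces and tangent vectors *)

Section DiffSpaceBasics.
Variable R : realType.
Implicit Types X Y Z : diffspace R.

Definition dsnbhs X (x : X) : set_system X := [set A |
  exists phi, [/\ @sm R X phi, 0 < phi x & forall y, 0 < phi y -> A y]].

Lemma sm_comp1 X (f : R -> R) (phi : X -> R) :
  Cinfty (fun z : 'rV[R]_1 => f (z 0 0)) -> sm phi -> sm (fun x => f (phi x)).
Proof.
move=> sf sphi; have := @dstr_comp _ _ _ (sm_dstr X) 1 _ (fun _ => phi) sf (fun _ => sphi).
by congr sm; apply/funext => x; rewrite mxE.
Qed.

Lemma sm_flat X (phi : X -> R) : sm phi -> sm (fun x => flat 0 (phi x)).
Proof. exact: (sm_comp1 (@flat0_Cinfty R)). Qed.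

#[global] Instance dsnbhs_filter X (x : X) : ProperFilter (dsnbhs x).
Proof.
split; first by case=> phi [_ phix H]; exact: H phix.
split.
- by exists (fun=> 1); split => //; exact: sm_cst.
- move=> A B [phi [sphi phix phiA]] [psi [spsi psix psiB]].
  (* [flat 0] vanishes where its argument is nonpositive, so the product cannot become positive
     through two negative factors. *)
  exists (fun y => flat 0 (phi y) * flat 0 (psi y)); split.
  + by apply: sm_mul; exact: sm_flat.
  + by rewrite mulr_gt0// flat0_gt0.
  + move=> y; have [/flat0_le0 ->|py] := leP (phi y) 0; first by rewrite mul0r ltxx.
    have [/flat0_le0 ->|qy _] := leP (psi y) 0; first by rewrite mulr0 ltxx.
    by split; [exact: phiA|exact: psiB].
- move=> A B AB [phi [sphi phix phiA]]; exists phi; split => // y /phiA; exact: AB.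
Qed.

Lemma dsnbhs_self X (x : X) A : dsnbhs x A -> A x.
Proof. by case=> phi [_ phix]; exact. Qed.

Lemma dsnbhs_join X (x : X) A : dsnbhs x A -> dsnbhs x (fun y => dsnbhs y A).
Proof.
by case=> phi [sphi phix phiA]; exists phi; split => // y phiy; exists phi.
Qed.

Lemma dsnbhs_pos X (x : X) (phi : X -> R) (a : R) : sm phi -> a < phi x ->
  dsnbhs x (fun y => a < phi y).
Proof.
move=> sphi ax; exists (fun y => phi y + - a); rewrite subr_gt0; split => //.
  by apply: sm_add => //; exact: sm_cst.
by move=> y; rewrite subr_gt0.
Qed.

Lemma sm_opp X (phi : X -> R) : sm phi -> sm (fun x => - phi x).
Proof.
move=> s; have := sm_mul (sm_cst X (-1)) s; congr sm.
by apply/funext => x; rewrite mulN1r.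
Qed.

Lemma sm_sum X (I : Type) (s : seq I) (F : I -> X -> R) :
  (forall i, sm (F i)) -> sm (fun x => \sum_(i <- s) F i x).
Proof.
move=> sF; elim: s => [|i s IH].
  rewrite (_ : (fun x => _) = (fun=> 0)); first exact: sm_cst.
  by apply/funext => x; rewrite big_nil.
rewrite (_ : (fun x => _) = (fun x => F i x + \sum_(j <- s) F j x)); first exact: sm_add.
by apply/funext => x; rewrite big_cons.
Qed.

Lemma dsnbhs_neg X (x : X) (phi : X -> R) (a : R) : sm phi -> phi x < a ->
  dsnbhs x (fun y => phi y < a).
Proof.
move=> sphi xa; have := @dsnbhs_pos X x _ (- a) (sm_opp sphi); rewrite ltrN2 => /(_ xa).
by apply: filterS => y; rewrite ltrN2.
Qed.

Lemma dsnbhs_neq0 X (x : X) (phi : X -> R) : sm phi -> phi x != 0 ->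
  dsnbhs x (fun y => phi y != 0).
Proof.
move=> sphi; rewrite neq_lt => /orP[/(dsnbhs_neg sphi)|/(dsnbhs_pos sphi)];
  by apply: filterS => y; rewrite neq_lt => ->; rewrite ?orbT.
Qed.

Lemma smooth_near X Y (f : smap X Y) (x : X) A : dsnbhs (f x) A ->
  dsnbhs x (fun y => A (f y)).
Proof.
case=> phi [sphi phix phiA]; exists (phi \o f); split => //.
  exact: (smap_smooth f).
by move=> y /phiA.
Qed.

Lemma dspace_open_nbhs X (U : set X) x : dspace_open U -> U x -> dsnbhs x U.
Proof. by move=> oU Ux; exact: oU. Qed.

Lemma sm_local X (f : X -> R) :
  (forall x, exists2 g, sm g & dsnbhs x (fun y => f y = g y)) -> sm f.
Proof.
move=> lf; apply: (dstr_loc (sm_dstr X)) => x; have [g sg [phi [sphi phix fg]]] := lf x.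
exists [set y | 0 < phi y]; split => //; last by exists g.
by move=> y phiy; exists phi.
Qed.

(** The alternative in the third clause allows an object defined on [A], multiplied by [psi], to be
    extended by 0: every point has [A] as a neighbourhood or sees [psi] vanish around it. *)
Lemma bump_exists X (x : X) A : dsnbhs x A -> exists psi, [/\ @sm R X psi,
  dsnbhs x (fun y => psi y = 1),
  (forall y, dsnbhs y A \/ dsnbhs y (fun z => psi z = 0)) & forall y, 0 <= psi y].
Proof.
move=> [phi [sphi phix phiA]].
(* The argument of [chi] is at least 1 where [phi y] is at least 2/3 of [phi x], and at most 0 where
   it is at most 1/3 of [phi x]. *)
pose psi y := chi (3 / phi x * phi y + - 1).
have spsi : @sm R X psi.
  apply: (sm_comp1 (@chi_Cinfty R)); apply: sm_add; last exact: sm_cst.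
  by apply: sm_mul => //; exact: sm_cst.
exists psi; split => //.
- have H : 2 / 3 * phi x < phi x by rewrite gtr_pMl// ltr_pdivrMr// mul1r ltr_nat.
  apply: filterS (dsnbhs_pos sphi H) => y Hy; rewrite /psi chi_ge1//.
  rewrite lerBrDr (_ : 1 + 1 = 3 / phi x * (2 / 3 * phi x)).
    by rewrite ler_pM2l ?ltW// divr_gt0.
  by field; rewrite gt_eqF.
- move=> y; have [phiy|phiy] := ltP 0 (phi y); [left|right].
    by exists phi.
  have H : phi y < 1 / 3 * phi x by rewrite (le_lt_trans phiy)// mulr_gt0// divr_gt0.
  apply: filterS (dsnbhs_neg sphi H) => z Hz; rewrite /psi chi_le0//.
  have E : 3 / phi x * (1 / 3 * phi x) = 1 by field; rewrite gt_eqF.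
  by rewrite lerBlDr add0r -[leRHS]E ler_pM2l ?ltW// divr_gt0.
- by move=> y; exact: chi_ge0.
Qed.

Lemma sval_eta (T : Type) (P : T -> Prop) (v : {x | P x}) : exist P (sval v) (svalP v) = v.
Proof. by case: v => x Px; congr exist; exact: Prop_irrelevance. Qed.

Lemma sig_ext (T : Type) (P : T -> Prop) (u v : {x | P x}) : sval u = sval v -> u = v.
Proof.
case: u v => x Px [y Py] /= xy; case: y / xy Py => Py.
by congr exist; exact: Prop_irrelevance.
Qed.

(** By minimality of the generated structure it is enough that the locally extendable functions form
    a differential structure containing the restrictions from [X]. *)
Lemma sm_subtype X (A : set X) (h : dsub A -> R) (u : dsub A) : sm h ->
  exists2 g, @sm R X g & dsnbhs (sval u) (fun y => forall Ay : A y, h (exist _ y Ay) = g y).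
Proof.
move=> sh; pose C (h : dsub A -> R) := forall u : dsub A, exists2 g, @sm R X g &
  dsnbhs (sval u) (fun y => forall Ay : A y, h (exist _ y Ay) = g y).
suff : C h by exact.
apply: sh; last by move=> _ [g sg ->] v; exists g => //; exact: filterE.
split=> [n F phi sF Cphi v|f lf v].
  have /choice[g gP] i : exists g, @sm R X g /\
      dsnbhs (sval v) (fun y => forall Ay : A y, phi i (exist _ y Ay) = g y).
    by have [g sg Hg] := Cphi i v; exists g.
  exists (fun y => F (\row_i g i y)).
    by apply: (dstr_comp (sm_dstr X)) => // i; have [] := gP i.
  have : dsnbhs (sval v) (fun y => forall i, forall Ay : A y, phi i (exist _ y Ay) = g i y).
    by apply: filter_ord => i; have [] := gP i.
  apply: filterS => y H Ay; congr F; apply/rowP => i; rewrite !mxE; exact: H.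
have [U [oU Uv [k Ck fk]]] := lf v.
have [g sg gk] := Ck v; exists g => //.
have [phi [Cphi phiv phiU]] := oU v Uv.
have [p sp pphi] := Cphi v.
have pv : 0 < p (sval v).
  by rewrite -(dsnbhs_self pphi (svalP v)) sval_eta.
apply: filterS3 gk pphi (dsnbhs_pos sp pv) => y Hg Hp py Ay.
by rewrite -Hg fk//; apply: phiU; rewrite Hp.
Qed.

Lemma smooth_gen X (T : Type) (Phi : set (T -> R)) (f : X -> T) :
  (forall g, Phi g -> sm (g \o f)) ->
  @smooth R X (DiffSpace (gen_dstr Phi)) f.
Proof.
move=> Hf g sg; apply: (sg (fun g => @sm R X (g \o f))); last exact: Hf.
split=> [n F phi sF sphi|k lk].
  exact: (dstr_comp (sm_dstr X) (phi := fun i => phi i \o f) sF).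
apply: (dstr_loc (sm_dstr X)) => x; have [U [oU Ux [l sl kl]]] := lk (f x).
exists (f @^-1` U); split => //; last by exists (l \o f) => // y /kl.
move=> y /oU[phi [sphi phiy phiU]]; exists (phi \o f); split => //.
by move=> z /phiU.
Qed.

Lemma smooth_prod X Y Z (f : Z -> X) (g : Z -> Y) : smooth f -> smooth g ->
  @smooth R Z (dprod X Y) (fun z => (f z, g z)).
Proof.
by move=> sf sg; apply: smooth_gen => h [[k sk ->]|[k sk ->]]; [exact: sf|exact: sg].
Qed.

Lemma smooth_sub X Z (A : set X) (f : Z -> dsub A) :
  @smooth R Z X (fun z => sval (f z)) -> smooth f.
Proof. by move=> sf; apply: smooth_gen => h [k sk ->]; exact: sf. Qed.

Lemma smooth_euclid X n (f : X -> 'rV[R]_n) :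
  (forall i, @sm R X (fun x => f x 0 i)) -> @smooth R X (euclid R n) f.
Proof. by move=> sf; apply: smooth_gen => h [i ->]; exact: sf. Qed.

Lemma smooth_realline X (f : X -> R) : sm f -> @smooth R X (realline R) f.
Proof. by move=> sf; apply: smooth_gen => h ->; exact: sf. Qed.

Lemma smooth_snd X Y : @smooth R (dprod X Y) Y snd.
Proof. by move=> g Xg; apply: gen_sub; right; exists g. Qed.

Lemma smooth_cst X Y (y : Y) : @smooth R X Y (fun=> y).
Proof. by move=> g sg; exact: sm_cst. Qed.

Lemma smooth_compf X Y Z (g : Y -> Z) (f : X -> Y) :
  smooth g -> smooth f -> smooth (fun x => g (f x)).
Proof. by move=> sg sf h sh; exact: sf (sg h sh). Qed.

Definition sid X : smap X X := @Smap R X X id (fun g sg => sg).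
Definition scst X Y (y : Y) : smap X Y := Smap (@smooth_cst X Y y).
Definition spair X Y Z (f : smap Z X) (g : smap Z Y) : smap Z (dprod X Y) :=
  Smap (smooth_prod (smap_smooth f) (smap_smooth g)).
Definition sfst X Y : smap (dprod X Y) X := Smap (@smooth_fst R X Y).
Definition ssnd X Y : smap (dprod X Y) Y := Smap (@smooth_snd X Y).
Definition sincl X (A : set X) : smap (dsub A) X := Smap (@smooth_val R X A).

Lemma sm_smap X Y (f : smap X Y) (g : Y -> R) : sm g -> sm (fun x => g (f x)).
Proof. exact: (smap_smooth f). Qed.

(** Near t0 = g x the function 1/t is replaced by t / den(t), where [den] has no zero and equals t^2
    as soon as t^2 >= t0^2 / 2. *)
Lemma sm_div X (f g : X -> R) x : sm f -> sm g -> g x != 0 ->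
  exists2 h, sm h & dsnbhs x (fun y => h y = f y / g y).
Proof.
move=> sf sg g0; pose t0 := g x; have t02 : 0 < t0 ^+ 2 by rewrite exprn_even_gt0.
pose den (t : R) := t * t + chi (2 + - (4 / t0 ^+ 2 * (t * t))).
have den0 t : den t != 0.
  rewrite gt_eqF//; have [->|tn0] := eqVneq t 0.
    by rewrite /den !mulr0 add0r oppr0 addr0 chi_gt0.
  by rewrite /den -expr2 ltr_pwDl ?chi_ge0// exprn_even_gt0.
have sc := @Cinfty_coord R 1 0.
have sden : Cinfty (fun z : 'rV[R]_1 => den (z 0 0)).
  apply: CinftyD; first exact: CinftyM.
  apply: (Cinfty_comp1 (@chi_Cinfty R) (F := fun z => 2 + - (4 / t0 ^+ 2 * (z 0 0 * z 0 0)))).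
  apply: CinftyD; first exact: Cinfty_cst.
  by apply: CinftyN; apply: CinftyM; [exact: Cinfty_cst|exact: CinftyM].
have sF : Cinfty (fun z : 'rV[R]_1 => z 0 0 * (den (z 0 0))^-1).
  by apply: CinftyM => //; exact: CinftyV.
exists (fun y => f y * (g y * (den (g y))^-1)).
  by apply: sm_mul => //; exact: (sm_comp1 (f := fun t => t * (den t)^-1) sF).
have H : t0 ^+ 2 / 2 < g x * g x.
  by rewrite -expr2 -/t0 ltr_pdivrMr// ltr_pMr// ltr1n.
apply: filterS2 (dsnbhs_pos (sm_mul sg sg) H) (dsnbhs_neq0 sg g0) => y Hy gy0.
congr (_ * _); rewrite /den chi_le0; last first.
  rewrite subr_le0 -ler_pdivrMl ?divr_gt0//; apply: le_trans (ltW Hy).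
  have t00 : t0 != 0 by [].
  by rewrite (_ : (4 / t0 ^+ 2)^-1 * 2 = t0 ^+ 2 / 2)//; field.
by rewrite addr0; field.
Qed.

End DiffSpaceBasics.

(** * Derivations at a point: linearity, locality, chain rule *)

Section TangentCalculus.
Variable R : realType.
Implicit Types X Y Z : diffspace R.

(* The derivative of [f] along [v]; for [f] not smooth this is the junk value 0. *)
Definition dd X (x : X) (v : tangent x) (f : X -> R) : R :=
  tan_fun v (insubd (0 : Cinf X) (f : X -> R^o)).

Lemma ddE X (x : X) (v : tangent x) (h : Cinf X) : tan_fun v h = dd v (val h).
Proof. by rewrite /dd valKd. Qed.

Lemma val_insubd X (f : X -> R) : sm f -> val (insubd (0 : Cinf X) (f : X -> R^o)) = f.
Proof. by move=> sf; rewrite insubdK//; exact/asboolP. Qed.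

Lemma ddP X (x : X) (v : tangent x) (h : Cinf X) (f : X -> R) : (val h : X -> R) = f ->
  tan_fun v h = dd v f.
Proof. by move=> <-; exact: ddE. Qed.

Lemma tangent_ext X (x : X) (v w : tangent x) : (forall f, sm f -> dd v f = dd w f) -> v = w.
Proof.
move=> H; apply/val_inj/funext => h; rewrite -[LHS]/(tan_fun v h) -[RHS]/(tan_fun w h).
by rewrite !ddE; apply: H; exact: Cinf_sm.
Qed.

Lemma dd_dmap X Y (f : smap X Y) (x : X) (v : tangent x) (h : Y -> R) : sm h ->
  dd (dmap f v) h = dd v (fun y => h (f y)).
Proof.
move=> sh; rewrite {1}/dd /dmap /= -[LHS]/(tan_fun v (pull f _)); apply: ddP.
by rewrite /= val_insubd.
Qed.

Lemma dd_lin X (x : X) (a : R) (v w : tangent x) f :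
  dd (a *: v + w) f = a * dd v f + dd w f.
Proof. by []. Qed.

Lemma ddDv X (x : X) (v w : tangent x) f : dd (v + w) f = dd v f + dd w f.
Proof. by []. Qed.

Lemma ddZv X (x : X) (a : R) (v : tangent x) f : dd (a *: v) f = a * dd v f.
Proof. by []. Qed.

Lemma dd0v X (x : X) f : dd (0 : tangent x) f = 0.
Proof. by []. Qed.

Lemma ddBv X (x : X) (v w : tangent x) f : dd (v - w) f = dd v f - dd w f.
Proof. by []. Qed.

Lemma dd_sumv X (x : X) (I : Type) (s : seq I) (v : I -> tangent x) f :
  dd (\sum_(i <- s) v i) f = \sum_(i <- s) dd (v i) f.
Proof. by elim: s => [|i s IH]; rewrite ?big_nil// !big_cons ddDv IH. Qed.

Lemma ddZD X (x : X) (v : tangent x) (a : R) f g : sm f -> sm g ->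
  dd v (fun y => a * f y + g y) = a * dd v f + dd v g.
Proof.
move=> sf sg; rewrite {2 3}/dd -(der_lin (tangentP v)); symmetry; apply: ddP.
by apply/funext => y /=; rewrite !val_insubd.
Qed.

Lemma ddM X (x : X) (v : tangent x) f g : sm f -> sm g ->
  dd v (fun y => f y * g y) = f x * dd v g + g x * dd v f.
Proof.
move=> sf sg; have := der_mul (tangentP v) (mkCinf sf) (mkCinf sg).
rewrite (ddP v (h := mkCinf sf) (f := f))// (ddP v (h := mkCinf sg) (f := g))// => <-.
by symmetry; exact: ddP.
Qed.

Lemma ddD X (x : X) (v : tangent x) f g : sm f -> sm g ->
  dd v (fun y => f y + g y) = dd v f + dd v g.
Proof.
move=> sf sg; rewrite -[dd v f in RHS]mul1r -ddZD//; congr dd.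
by apply/funext => y; rewrite mul1r.
Qed.

Lemma dd1 X (x : X) (v : tangent x) : dd v (fun=> 1) = 0.
Proof.
have := ddM v (sm_cst X 1) (sm_cst X 1); rewrite mul1r.
move=> H; lra.
Qed.

Lemma ddZ X (x : X) (v : tangent x) (a : R) f : sm f -> dd v (fun y => a * f y) = a * dd v f.
Proof.
move=> sf; have := ddZD v a sf (sm_cst X 0).
have d0 : dd v (fun=> 0) = 0.
  have := ddZD v (-1) (sm_cst X 1) (sm_cst X 1); rewrite dd1 mulr0 addr0.
  by congr (dd v _ = _); apply/funext => y; rewrite mulr1 addNr.
rewrite d0 addr0 => <-; congr dd; by apply/funext => y; rewrite addr0.
Qed.

Lemma dd_cst X (x : X) (v : tangent x) (a : R) : dd v (fun=> a) = 0.
Proof.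
have := ddZ v a (sm_cst X 1); rewrite dd1 mulr0.
by congr (dd v _ = _); apply/funext => y; rewrite mulr1.
Qed.

Lemma ddN X (x : X) (v : tangent x) f : sm f -> dd v (fun y => - f y) = - dd v f.
Proof.
move=> sf; rewrite -mulN1r -ddZ//; congr dd; by apply/funext => y; rewrite mulN1r.
Qed.

Lemma ddB X (x : X) (v : tangent x) f g : sm f -> sm g ->
  dd v (fun y => f y - g y) = dd v f - dd v g.
Proof. by move=> sf sg; rewrite ddD ?ddN//; exact: sm_opp. Qed.

Lemma dd_sum X (x : X) (v : tangent x) (I : Type) (s : seq I) (F : I -> X -> R) :
  (forall i, sm (F i)) ->
  dd v (fun y => \sum_(i <- s) F i y) = \sum_(i <- s) dd v (F i).
Proof.
move=> sF; elim: s => [|i s IH].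
  transitivity (dd v (fun=> 0)); last by rewrite dd_cst big_nil.
  by congr dd; apply/funext => y; rewrite big_nil.
rewrite big_cons -IH -ddD//; last exact: sm_sum.
by congr dd; apply/funext => y; rewrite big_cons.
Qed.

(** Derivations are local: [flat 0 (phi y)] times [f - g] vanishes identically, and Leibniz's rule
    at [x], where the first factor is positive and the second is 0, isolates the derivative of
    [f - g]. *)
Lemma dd_near X (x : X) (v : tangent x) f g : sm f -> sm g ->
  dsnbhs x (fun y => f y = g y) -> dd v f = dd v g.
Proof.
move=> sf sg [phi [sphi phix fg]]; apply/eqP; rewrite -subr_eq0 -ddB//; apply/eqP.
have spsi := sm_flat sphi; have sk := sm_add sf (sm_opp sg).
have := ddM v spsi sk.
rewrite (_ : (fun y => _) = (fun=> 0)); last first.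
  apply/funext => y; have [phiy|phiy] := ltP 0 (phi y).
    by rewrite fg// subrr mulr0.
  by rewrite flat0_le0// mul0r.
rewrite dd_cst fg// subrr mul0r addr0 => /esym/eqP.
by rewrite mulf_eq0 gt_eqF ?flat0_gt0//= => /eqP.
Qed.

(** Hadamard's lemma around the value at [x] writes the composite as a constant plus a sum of
    [phi i y - phi i x] times smooth functions; a derivation at [x] only sees the values of the
    latter at [x], which are the partial derivatives of [F]. *)
Lemma dd_comp X (x : X) (v : tangent x) n (F : 'rV[R]_n -> R) (phi : 'I_n -> X -> R) :
  Cinfty F -> (forall i, sm (phi i)) ->
  dd v (fun y => F (\row_i phi i y)) =
  \sum_i 'D_(delta_mx 0 i) F (\row_i phi i x) * dd v (phi i).
Proof.
move=> sF sphi; have [G [sG FG]] := Hadamard sF.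
pose z0 : 'rV[R]_n := \row_i phi i x.
pose W y : 'rV[R]_n := \row_i phi i y - z0.
pose Gi i y := G i (row_mx z0 (W y)).
have sGi i : sm (Gi i).
  pose c (j : 'I_(n + n)) y := (row_mx z0 (W y)) 0 j.
  have := @dstr_comp _ _ _ (sm_dstr X) _ (G i) c (sG i).
  rewrite (_ : (fun y => _) = Gi i).
    apply=> j; rewrite /c; case: (splitP j) => k jk.
      rewrite (_ : j = lshift n k); last exact: val_inj.
      by under eq_fun do rewrite row_mxEl; exact: sm_cst.
    rewrite (_ : j = rshift n k); last exact: val_inj.
    under eq_fun do rewrite row_mxEr !mxE.
    by apply: sm_add => //; exact: sm_cst.
  by apply/funext => y; congr (G i _); apply/rowP => j; rewrite mxE.
have -> : (fun y => F (\row_i phi i y)) =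
    (fun y => F z0 + \sum_i (phi i y - phi i x) * Gi i y).
  apply/funext => y; rewrite -[in LHS](subrKC z0 (\row_i phi i y)) FG; congr (_ + _).
  by apply: eq_bigr => i _; rewrite !mxE.
have sd i : sm (fun y => phi i y - phi i x) by apply: sm_add => //; exact: sm_cst.
rewrite ddD ?dd_cst ?add0r; last 2 first.
- exact: sm_cst.
- by apply: sm_sum => i; exact: sm_mul.
rewrite dd_sum => [|i]; last exact: sm_mul.
apply: eq_bigr => i _; rewrite ddM// subrr mul0r add0r ddB//; last exact: sm_cst.
rewrite dd_cst subr0; congr (_ * _).
by rewrite (Hadamard_diag sG FG) /Gi /W subrr.
Qed.

End TangentCalculus.

(** * Local charts and submersions *)

Section LocalCharts.
Variable R : realType.
Implicit Types X Y Z : diffspace R.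

Lemma dsnbhs_euclid n (z : 'rV[R]_n) (A : set 'rV[R]_n) :
  @dsnbhs R (euclid R n) z A <-> nbhs z A.
Proof.
split=> [[phi [/sm_euclidP sphi phiz phiA]]|/nbhs_ballP[r /= r0 rA]].
  by apply: filterS (Cinfty_pos_near sphi phiz).
exists (fun y : 'rV[R]_n => r ^+ 2 + - (\sum_i (y 0 i + - z 0 i) * (y 0 i + - z 0 i))).
split.
- apply/sm_euclidP; apply: CinftyD; first exact: Cinfty_cst.
  apply: CinftyN; apply: Cinfty_sum => i.
  by apply: CinftyM; apply: CinftyD; try exact: Cinfty_coord; exact: Cinfty_cst.
- by rewrite big1 ?oppr0 ?addr0 ?exprn_gt0// => i _; rewrite subrr mulr0.
- move=> y; rewrite subr_gt0 => H; apply: rA; rewrite mx_norm_ball /ball_ /=.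
  have {}H i : `|(z - y) 0 i| < r.
    rewrite -(ltr_pXn2r (n := 2))// ?nnegrE ?ltW//.
    apply: le_lt_trans H; rewrite (bigD1 i)//= !mxE -normrX ger0_norm ?sqr_ge0//.
    rewrite -[leLHS]addr0 lerD//; first by rewrite -expr2 -sqrrN opprB.
    by rewrite sumr_ge0// => j _; rewrite -expr2 sqr_ge0.
  have [n0|] := eqVneq `|z - y| 0; first by rewrite n0.
  move=> /mx_norm_neq0[[i j] /= ]; rewrite ord1 => E.
  by have := H j; rewrite -E.
Qed.

Lemma dsnbhs_realline (t : R) (A : set R) : @dsnbhs R (realline R) t A -> nbhs t A.
Proof.
move=> [phi [/sm_reallineP sphi phit phiA]].
have := Cinfty_pos_near (x := const_mx t) sphi; rewrite mxE => /(_ phit).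
have c : const_mx s @[s --> nbhs t] --> (const_mx t : 'rV[R]_1).
  by apply: cvg_row => i; under eq_fun do rewrite mxE; rewrite mxE; exact: cvg_id.
by move=> H; have := c _ H; apply: (@filterS _ (nbhs t)) => s /=; rewrite mxE => /phiA.
Qed.

Lemma sm_euclid_coord n i : @sm R (euclid R n) (fun z : 'rV[R]_n => z 0 i).
Proof. by apply: gen_sub; exists i. Qed.

Lemma sm_coord X n (C : smap X (euclid R n)) i : sm (fun x => C x 0 i).
Proof. exact: (sm_smap C (sm_euclid_coord i)). Qed.

Lemma sm_realline_derive (f : R -> R) (t : R) : @sm R (realline R) f ->
  is_derive t (1 : R) f ('D_1 f t).
Proof.
move=> /sm_reallineP sf; apply: derivableP.
have := @is_derive_line R 1 (fun z => f (z 0 0)) 0 (const_mx 1) t; rewrite add0r.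
rewrite (_ : (fun s => _) = f); last first.
  by apply/funext => s; rewrite add0r !mxE mulr1.
by move=> H; have [] := H (let: DeriveDef d _ := Cinfty_derive _ _ sf in d).
Qed.

Lemma sm_affine n (F : 'rV[R]_n -> R) (a u : 'rV[R]_n) : Cinfty F ->
  @sm R (realline R) (fun e => F (a + e *: u)).
Proof.
move=> sF; apply/sm_reallineP.
have := @Cinfty_comp _ _ _ _ (fun i (z : 'rV[R]_1) => a 0 i + z 0 0 * u 0 i) sF.
rewrite (_ : (fun z => F _) = (fun z : 'rV[R]_1 => F (a + z 0 0 *: u))); last first.
  by apply/funext => z; congr F; apply/rowP => i; rewrite !mxE.
apply=> i; apply: CinftyD; first exact: Cinfty_cst.
by apply: CinftyM; [exact: Cinfty_coord|exact: Cinfty_cst].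
Qed.

Lemma smooth_affine n (a u : 'rV[R]_n) :
  @smooth R (realline R) (euclid R n) (fun e : R => a + e *: u).
Proof.
by apply: smooth_euclid => i; apply: (sm_affine (F := fun z => z 0 i)); exact: Cinfty_coord.
Qed.

Lemma tanR_subproof n (a u : 'rV[R]_n) :
  @derivation_at R (euclid R n) a (fun h => 'D_u (val h : 'rV[R]_n -> R) a).
Proof.
have H (h : Cinf (euclid R n)) : is_derive a u (val h : 'rV[R]_n -> R) ('D_u (val h) a).
  by apply: Cinfty_derive; apply/sm_euclidP; exact: Cinf_sm.
split=> [c f g|f g].
  by have [_ ->] := is_deriveD (is_deriveZ c (H f)) (H g).
by have [_ ->] := is_deriveM (H f) (H g).
Qed.

Definition tanR n (a u : 'rV[R]_n) : @tangent R (euclid R n) a := mkTangent (tanR_subproof a u).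

Lemma dd_tanR n (a u : 'rV[R]_n) f : @sm R (euclid R n) f -> dd (tanR a u) f = 'D_u f a.
Proof.
move=> sf; rewrite /dd -[LHS]/('D_u (val (insubd (0 : Cinf (euclid R n)) f)) a).
by rewrite val_insubd.
Qed.

Definition tcast X (x y : X) (e : x = y) (v : tangent x) : tangent y := ecast z (tangent z) e v.

Lemma dd_tcast X (x y : X) (e : x = y) (v : tangent x) f : dd (tcast e v) f = dd v f.
Proof. by case: y / e. Qed.

(** The base point [x] is not tied to [c 0] by the type, which spares transports when the two are
    only provably equal. *)
Definition vel X (x : X) (c : R -> X) (v : tangent x) : Prop :=
  forall h, sm h -> is_derive (0 : R) (1 : R) (fun e => h (c e)) (dd v h).

Lemma vel_dd X (x y : X) (c : R -> X) (v : tangent x) (w : tangent y) :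
  vel c v -> vel c w -> forall h, sm h -> dd v h = dd w h.
Proof. by move=> cv cw h sh; have [_ <-] := cv h sh; have [_ <-] := cw h sh. Qed.

Lemma vel_dmap X Y (f : smap X Y) (x : X) (c : R -> X) (v : tangent x) :
  vel c v -> vel (fun e => f (c e)) (dmap f v).
Proof. by move=> cv h sh; rewrite dd_dmap//; apply: cv; exact: sm_smap. Qed.

Lemma tanC_subproof X (c : smap (realline R) X) :
  @derivation_at R X (c 0) (fun h => 'D_1 (fun e : R => (val h : X -> R) (c e)) (0 : R)).
Proof.
have H (h : Cinf X) := sm_realline_derive (0 : R) (sm_smap c (Cinf_sm h)).
split=> [a f g|f g].
  by have [_ ->] := is_deriveD (is_deriveZ a (H f)) (H g).
by have [_ ->] := is_deriveM (H f) (H g).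
Qed.

Lemma curve_tangent X (c : smap (realline R) X) (x : X) : c 0 = x ->
  exists v : tangent x, vel c v.
Proof.
move=> cx; exists (tcast cx (mkTangent (tanC_subproof c))) => h sh; rewrite dd_tcast.
rewrite /dd -[X in is_derive _ _ _ X]/('D_1 (fun e => val (insubd (0 : Cinf X) h) (c e)) (0 : R)).
by rewrite val_insubd//; exact: sm_realline_derive (sm_smap c sh).
Qed.

(** Near [p] the identity factors smoothly through R^k. Unlike a chart, this passes to fibre
    products by composing retractions, and it suffices to give coordinates of tangent vectors,
    curves with prescribed velocity and vector fields through a given vector. *)
Definition lret X (p : X) k (E : smap (euclid R k) X) (C : smap X (euclid R k)) : Prop :=
  dsnbhs p (fun x => E (C x) = x).

Definition lchart X (p : X) k (E : smap (euclid R k) X) (C : smap X (euclid R k)) : Prop :=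
  lret p E C /\ nbhs (C p : 'rV[R]_k) (fun z => C (E z) = z).

Lemma lret_near X (p : X) k E C : @lret X p k E C -> dsnbhs p (fun x => lret x E C).
Proof. exact: dsnbhs_join. Qed.

Lemma Cinfty_E X k (E : smap (euclid R k) X) (h : X -> R) : sm h ->
  Cinfty (fun z : 'rV[R]_k => h (E z)).
Proof. by move=> sh; apply/sm_euclidP; exact: sm_smap. Qed.

Lemma dd_lret X (p : X) k E C (v : tangent p) h : @lret X p k E C -> sm h ->
  dd v h = \sum_i 'D_(delta_mx 0 i) (fun z : 'rV[R]_k => h (E z)) (C p) * dd v (fun y => C y 0 i).
Proof.
move=> L sh.
have rE y : \row_i (C y : 'rV[R]_k) 0 i = C y by apply/rowP => i; rewrite mxE.
have := dd_comp v (Cinfty_E E sh) (sm_coord C); rewrite rE => <-.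
apply: dd_near => //; last by apply: filterS L => y Ey; rewrite rE Ey.
under eq_fun do rewrite rE; exact: sm_smap (sm_smap E sh).
Qed.

Definition coord_vec X (p : X) k (C : smap X (euclid R k)) (v : tangent p) : 'rV[R]_k :=
  \row_i dd v (fun y => C y 0 i).

Lemma dd_lret_D X (p : X) k E C (v : tangent p) h : @lret X p k E C -> sm h ->
  dd v h = 'D_(coord_vec C v) (fun z : 'rV[R]_k => h (E z)) (C p).
Proof.
move=> L sh; rewrite (dd_lret v L sh) (Ck1_derive_sum _ _ (Cinfty_E E sh 1%N)).
by apply: eq_bigr => i _; rewrite mxE mulrC.
Qed.

Lemma lret_coord_inj X (p : X) k E C (v w : tangent p) : @lret X p k E C ->
  coord_vec C v = coord_vec C w -> v = w.
Proof.
by move=> L vw; apply: tangent_ext => h sh; rewrite (dd_lret_D v L sh) (dd_lret_D w L sh) vw.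
Qed.

Lemma lret_tangent X (p : X) k E C (u : 'rV[R]_k) : @lret X p k E C ->
  exists v : tangent p, forall h, sm h -> dd v h = 'D_u (fun z => h (E z)) (C p : 'rV[R]_k).
Proof.
move=> /dsnbhs_self L; exists (tcast L (dmap E (tanR (C p) u))) => h sh.
by rewrite dd_tcast dd_dmap// dd_tanR//; exact: sm_smap.
Qed.

Lemma lchart_coord X (p : X) k E C (u : 'rV[R]_k) : @lchart X p k E C ->
  exists v : tangent p, coord_vec C v = u.
Proof.
move=> [L LC]; have [v vE] := lret_tangent u L; exists v; apply/rowP => i.
rewrite mxE vE; last exact: sm_coord.
have [_ <-] := is_derive_coord i (C p : 'rV[R]_k) u.
by apply: near_eq_derive; apply: filterS LC => z ->.
Qed.

Lemma lret_curve X (p : X) k E C (v : tangent p) : @lret X p k E C ->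
  exists2 c : smap (realline R) X, c 0 = p & vel c v.
Proof.
move=> L; exists (smap_comp E (Smap (smooth_affine (C p) (coord_vec C v)))).
  by rewrite /= scale0r addr0; exact: dsnbhs_self L.
move=> h sh; rewrite (dd_lret_D v L sh).
apply: (iffRL (is_derive_lineP (fun z : 'rV[R]_k => h (E z)) _ _ _)).
exact: Cinfty_derive (Cinfty_E E sh).
Qed.

(** The fields are the images under [E] of the coordinate fields. The factor [psi] is there because
    differentiating [h] along [E] at [C x] is a derivation at [x] only where [E (C x) = x]. *)
Lemma lret_frame X (p : X) k E C : @lret X p k E C -> exists V : 'I_k -> vfield X,
  dsnbhs p (fun x => forall v : tangent x, v = \sum_i dd v (fun y => C y 0 i) *: V i x).
Proof.
move=> L; have [psi [spsi psi1 psi0 _]] := bump_exists L.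
pose d i (x : X) (h : Cinf X) : R :=
  psi x * 'D_(delta_mx 0 i) (fun z : 'rV[R]_k => (val h : X -> R) (E z)) (C x).
have dd0 i x : derivation_at x (d i x).
  have [ps0|psn0] := eqVneq (psi x) 0.
    by split=> [a f g|f g]; rewrite /d ps0 !mul0r; ring.
  have Ex : E (C x) = x.
    by case: (psi0 x) => /dsnbhs_self// ps0; rewrite ps0 eqxx in psn0.
  have H (h : Cinf X) := Cinfty_derive (C x : 'rV[R]_k) (delta_mx 0 i) (Cinfty_E E (Cinf_sm h)).
  split=> [a f g|f g]; rewrite /d.
    have [_ ->] := is_deriveD (is_deriveZ a (H f)) (H g).
    by rewrite -[_ *: _]/(_ * _); ring.
  have [_ ->] := is_deriveM (H f) (H g); rewrite Ex.
  by rewrite -![_ *: _]/(_ * _); ring.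
have sV i (h : Cinf X) : sm (fun x => tan_fun (mkTangent (dd0 i x)) h).
  apply: (@sm_mul _ _ psi) => //.
  apply: (sm_smap C (g := fun w => 'D_(delta_mx 0 i) (fun z => (val h : X -> R) (E z)) w)).
  by apply/sm_euclidP; apply: Cinfty_D; exact: Cinfty_E (Cinf_sm h).
exists (fun i => VField (sV i)).
apply: filterS2 psi1 (lret_near L) => x px Lx v.
apply: tangent_ext => h sh; rewrite dd_sumv (dd_lret v Lx sh).
apply: eq_bigr => i _; rewrite ddZv mulrC; congr (_ * _).
rewrite {1}/dd -[RHS]/(d i x (insubd (0 : Cinf X) h)) /d px mul1r.
by rewrite val_insubd.
Qed.

Lemma vfield_comb_subproof X k (c : 'I_k -> R) (V : 'I_k -> vfield X) (h : Cinf X) :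
  sm (fun x => tan_fun (\sum_i c i *: V i x) h).
Proof.
rewrite (_ : (fun x => _) = (fun x => \sum_i c i * tan_fun (V i x) h)).
  by apply: sm_sum => i; apply: sm_mul; [exact: sm_cst|exact: vf_smooth].
by apply/funext => x; rewrite ddE dd_sumv; apply: eq_bigr => i _; rewrite ddZv -ddE.
Qed.

Definition vfield_comb X k (c : 'I_k -> R) (V : 'I_k -> vfield X) : vfield X :=
  VField (vfield_comb_subproof c V).

Lemma vfield_through X (p : X) k E C (v : tangent p) : @lret X p k E C ->
  exists V : vfield X, V p = v.
Proof.
move=> L; have [V VP] := lret_frame L.
exists (vfield_comb (fun i => dd v (fun y => C y 0 i)) V).
by rewrite /= -(dsnbhs_self VP).
Qed.

Lemma sm_vf X (V : vfield X) h : sm h -> sm (fun x => dd (V x) h).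
Proof. by move=> sh; exact: (vf_smooth V (insubd (0 : Cinf X) h)). Qed.

Lemma dd_bracket X (V W : vfield X) (x : X) h : sm h ->
  dd (lie_bracket V W x) h = dd (V x) (fun y => dd (W y) h) - dd (W x) (fun y => dd (V y) h).
Proof.
move=> sh; rewrite {1}/dd.
rewrite -[LHS]/(tan_fun (V x) (vf_app W (insubd (0 : Cinf X) h)) -
  tan_fun (W x) (vf_app V (insubd (0 : Cinf X) h))).
by congr (_ - _); exact: ddP.
Qed.

(* The 2-form sum df_i /\ dg_i only depends on sum f_i dg_i. *)
Lemma form_derivative X (p : X) k E C (I : finType) (f g : I -> X -> R) : @lret X p k E C ->
  (forall i, sm (f i)) -> (forall i, sm (g i)) ->
  dsnbhs p (fun x => forall v : tangent x, \sum_i f i x * dd v (g i) = 0) ->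
  forall v w : tangent p, \sum_i (dd v (f i) * dd w (g i) - dd w (f i) * dd v (g i)) = 0.
Proof.
move=> L sf sg H v w; have [V Vp] := vfield_through v L; have [W Wp] := vfield_through w L.
have D (U : vfield X) (u : tangent p) :
    \sum_i (f i p * dd u (fun y => dd (U y) (g i)) + dd (U p) (g i) * dd u (f i)) = 0.
  have sfU i : sm (fun x => f i x * dd (U x) (g i)) by apply: sm_mul => //; exact: sm_vf.
  transitivity (dd u (fun x => \sum_i f i x * dd (U x) (g i))).
    by rewrite dd_sum//; apply: eq_bigr => i _; rewrite ddM//; exact: sm_vf.
  rewrite -[RHS](dd_cst u 0); apply: dd_near; [exact: sm_sum|exact: sm_cst|].
  by apply: filterS H => x; exact.
have B := dsnbhs_self H (lie_bracket V W p).
have := D W v; have := D V w; rewrite Vp Wp => D1 D2.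
have -> : \sum_i (dd v (f i) * dd w (g i) - dd w (f i) * dd v (g i)) =
    \sum_i (f i p * dd v (fun y => dd (W y) (g i)) + dd w (g i) * dd v (f i)) -
    \sum_i (f i p * dd w (fun y => dd (V y) (g i)) + dd v (g i) * dd w (f i)) -
    \sum_i f i p * dd (lie_bracket V W p) (g i).
  rewrite -!sumrB; apply: eq_bigr => i _; rewrite dd_bracket// Vp Wp; ring.
by rewrite D1 D2 B !subr0.
Qed.

End LocalCharts.

(** * Submersions: retractions onto fibres, local sections, lifted curves *)

Section Submersions.
Variable R : realType.
Implicit Types X Y Z : diffspace R.

(** Smooth maps are total: precomposition with [tau] extends a map defined only on [A] to all of R^n
    without changing it near [c0]. *)
Lemma euclid_cut n (c0 : 'rV[R]_n) (A : set 'rV[R]_n) : nbhs c0 A ->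
  exists tau : smap (euclid R n) (euclid R n),
    (forall z, A (tau z)) /\ nbhs c0 (fun z : 'rV[R]_n => tau z = z).
Proof.
move=> /nbhs_ballP[r /= r0 rA]; pose d := r / 4; have d0 : 0 < d by rewrite divr_gt0.
have st : @smooth R (euclid R n) (euclid R n) (fun z : 'rV[R]_n => c0 + kapv d (z - c0)).
  apply: smooth_euclid => i; apply/sm_euclidP.
  have := @Cinfty_comp _ _ _ _ (fun j (z : 'rV[R]_n) => z 0 j + - c0 0 j) (@kapv_Cinfty R n d i).
  move=> /(_ _)/(CinftyD (Cinfty_cst n (c0 0 i))) H.
  have {}H := H (fun j => CinftyD (@Cinfty_coord R n j) (Cinfty_cst n (- c0 0 j))).
  congr (Cinfty _) : H; apply/funext => z; rewrite [RHS]mxE; congr (_ + kapv d _ 0 i).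
  by apply/rowP => j; rewrite !mxE.
exists (Smap st); split=> [z|] /=.
  apply: rA; rewrite mx_norm_ball /ball_ /= opprD addNKr normrN.
  by apply: le_lt_trans (kapv_le _ d0) _; rewrite /d; lra.
apply/nbhs_ballP; exists d => //= z; rewrite mx_norm_ball /ball_ /= distrC => zd.
by rewrite kapv_id ?ltW// subrKC.
Qed.

Lemma realline_cut (A : set R) : nbhs (0 : R) A ->
  exists kappa : smap (realline R) (realline R),
    [/\ kappa 0 = 0, forall e, A (kappa e) & nbhs (0 : R) (fun e => kappa e = e)].
Proof.
move=> /nbhs_ballP[r /= r0 rA]; pose d := r / 4; have d0 : 0 < d by rewrite divr_gt0.
have st : @smooth R (realline R) (realline R) (fun e : R => d * kap (d^-1 * e)).
  apply: smooth_realline; apply/sm_reallineP; apply: CinftyM; first exact: Cinfty_cst.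
  apply: (Cinfty_comp1 (@kap_Cinfty R) (F := fun z => d^-1 * z 0 0)).
  by apply: CinftyM; [exact: Cinfty_cst|exact: Cinfty_coord].
have kid e : `|e| < d -> d * kap (d^-1 * e) = e.
  move=> ed; rewrite kap_id ?mulVKf ?gt_eqF//.
  by rewrite normrM gtr0_norm ?invr_gt0// ler_pdivrMl// mulr1 ltW.
exists (Smap st); split=> /= [|e|]; first by rewrite kid ?normr0.
  apply: rA; rewrite /ball /= sub0r normrN normrM gtr0_norm//.
  by apply: le_lt_trans (ler_wpM2l (ltW d0) (kap_le2 _)) _; rewrite /d; lra.
by apply/nbhs_ballP; exists d => //= z; rewrite /ball /= sub0r normrN => /kid.
Qed.

Lemma coord_near X n (C : smap X (euclid R n)) (x : X) (A : set 'rV[R]_n) :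
  nbhs (C x : 'rV[R]_n) A -> dsnbhs x (fun y => A (C y)).
Proof. by move=> /dsnbhs_euclid; exact: smooth_near. Qed.

(** The coordinates of the chart are extended beyond [U] one at a time by [sm_subtype]; the inverse
    chart is made total by precomposing it with a cut into [V]. *)
Lemma manifold_lchart X (x : X) : is_manifold X ->
  exists n E C, @lchart R X x n E C.
Proof.
case=> n [_ _ /(_ x)[U [V [oU Ux oV [phi [sphi [psi [spsi phiK psiK]]]]]]]].
have /choice[g gP] i : exists g : X -> R, sm g /\ dsnbhs x (fun y =>
    forall Uy : U y, (sval (phi (exist _ y Uy)) : 'rV[R]_n) 0 i = g y).
  have sh : @sm R (dsub U) (fun u => (sval (phi u) : 'rV[R]_n) 0 i).
    apply: sphi (fun v => (sval v : 'rV[R]_n) 0 i) _.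
    exact: smooth_val (@sm_euclid_coord R n i).
  by have [g sg gP] := sm_subtype (exist _ x Ux) sh; exists g.
have sC : @smooth R X (euclid R n) (fun y => \row_i g i y).
  by apply: smooth_euclid => i; under eq_fun do rewrite mxE; have [] := gP i.
pose C := Smap sC.
have phiC : dsnbhs x (fun y => forall Uy : U y, sval (phi (exist _ y Uy)) = C y).
  have : dsnbhs x (fun y => forall i, forall Uy : U y,
      (sval (phi (exist _ y Uy)) : 'rV[R]_n) 0 i = g i y).
    by apply: filter_ord => i; have [] := gP i.
  by apply: filterS => y H Uy; apply/rowP => i; rewrite H mxE.
have VC : nbhs (C x : 'rV[R]_n) V.
  apply/dsnbhs_euclid; apply: oV; rewrite -(dsnbhs_self phiC Ux).
  exact: svalP.
have [tau [tauV tau_id]] := euclid_cut VC.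
have sE : @smooth R (euclid R n) X (fun z => sval (psi (exist _ (tau z) (tauV z)))).
  apply: (smooth_compf (@smooth_val R X U)); apply: (smooth_compf spsi).
  by apply: smooth_sub => /=; exact: smap_smooth.
pose E := Smap sE; exists n, E, C.
have L : lret x E C.
  have tC : dsnbhs x (fun y => tau (C y) = C y).
    exact: (coord_near (A := fun z => tau z = z)).
  apply: filterS3 (dspace_open_nbhs oU Ux) phiC tC => y Uy Cy ty.
  rewrite /E /= (_ : exist _ _ _ = phi (exist _ y Uy)) ?phiK//.
  by apply: sig_ext; rewrite Cy -ty.
split => //.
have EC : dsnbhs (E (C x)) (fun y => forall Uy : U y, sval (phi (exist _ y Uy)) = C y).
  by rewrite (dsnbhs_self L).
have /dsnbhs_euclid := smooth_near EC.
apply: filterS2 tau_id => z tz /(_ (svalP _)) <-.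
by rewrite sval_eta psiK.
Qed.

Lemma smooth_row_mx X k l (f : smap X (euclid R k)) (g : smap X (euclid R l)) :
  @smooth R X (euclid R (k + l)) (fun x => row_mx (f x) (g x)).
Proof.
apply: smooth_euclid => i; case: (splitP i) => j ij.
  rewrite (_ : i = lshift l j); last exact: val_inj.
  by under eq_fun do rewrite row_mxEl; exact: sm_coord.
rewrite (_ : i = rshift k j); last exact: val_inj.
by under eq_fun do rewrite row_mxEr; exact: sm_coord.
Qed.

Lemma smooth_lsubmx k l : @smooth R (euclid R (k + l)) (euclid R k) (fun z : 'rV[R]_(k + l) => lsubmx z).
Proof.
by apply: smooth_euclid => i; under eq_fun do rewrite mxE; exact: sm_euclid_coord.
Qed.

Lemma smooth_rsubmx k l : @smooth R (euclid R (k + l)) (euclid R l) (fun z : 'rV[R]_(k + l) => rsubmx z).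
Proof.
by apply: smooth_euclid => i; under eq_fun do rewrite mxE; exact: sm_euclid_coord.
Qed.

Lemma near_fst X Y (p : X) (q : Y) A : dsnbhs p A ->
  dsnbhs ((p, q) : dprod X Y) (fun z => A z.1).
Proof. exact: (smooth_near (f := sfst X Y) (x := (p, q))). Qed.

Lemma near_snd X Y (p : X) (q : Y) A : dsnbhs q A ->
  dsnbhs ((p, q) : dprod X Y) (fun z => A z.2).
Proof. exact: (smooth_near (f := ssnd X Y) (x := (p, q))). Qed.

Lemma lret_prod X Y (p : X) (q : Y) k E C l E' C' : @lret R X p k E C -> @lret R Y q l E' C' ->
  exists E'' : smap (euclid R (k + l)) (dprod X Y),
    @lret R (dprod X Y) (p, q) (k + l) E''
      (Smap (smooth_row_mx (smap_comp C (sfst X Y)) (smap_comp C' (ssnd X Y)))).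
Proof.
move=> L L'; exists (spair (smap_comp E (Smap (@smooth_lsubmx k l)))
  (smap_comp E' (Smap (@smooth_rsubmx k l)))).
apply: filterS2 (near_fst q L) (near_snd p L') => -[x y] /= Lx Ly.
by rewrite row_mxKl row_mxKr Lx Ly.
Qed.

Definition lretract X (p : X) := exists k E C, @lret R X p k E C.

Lemma lchart_lretract X (p : X) k E C : @lchart R X p k E C -> lretract p.
Proof. by case=> L _; exists k, E, C. Qed.

Lemma prod_tangent_ext X Y (p : X) (q : Y) (w w' : @tangent R (dprod X Y) (p, q)) :
  lretract p -> lretract q ->
  (forall h, sm h -> dd w (fun z => h z.1) = dd w' (fun z => h z.1)) ->
  (forall h, sm h -> dd w (fun z => h z.2) = dd w' (fun z => h z.2)) -> w = w'.
Proof.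
move=> [k [E [C L]]] [l [E' [C' L']]] H1 H2; have [E'' L''] := lret_prod L L'.
apply: (lret_coord_inj L''); apply/rowP => i; rewrite !mxE.
case: (splitP i) => j ij.
  rewrite (_ : i = lshift l j); last exact: val_inj.
  by under eq_fun do rewrite /= row_mxEl; exact: H1 (sm_coord C j).
rewrite (_ : i = rshift k j); last exact: val_inj.
by under eq_fun do rewrite /= row_mxEr; exact: H2 (sm_coord C' j).
Qed.

Definition onto_at X Z (s : smap X Z) (p : X) :=
  forall w : tangent (s p), exists v : tangent p, dmap s v = w.

(** In coordinates this is [retraction_rV]: [rho (x, z)] pushes [x] into the fibre over [z] and
    fixes [x] when it already lies there. *)
Lemma submersion_retraction X Z (s : smap X Z) (p : X) l E' C' :
  lretract p -> @lchart R Z (s p) l E' C' -> onto_at s p ->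
  exists rho : smap (dprod X Z) X,
    dsnbhs ((p, s p) : dprod X Z) (fun q => s (rho q) = q.2) /\
    dsnbhs p (fun x => rho (x, s x) = x).
Proof.
move=> [k [E [C L]]] [L' C'E'] onto; have Ep := dsnbhs_self L.
pose sj (j : 'I_l) (z : 'rV[R]_k) : R := (C' (s (E z)) : 'rV[R]_l) 0 j.
have ssj j : Cinfty (sj j) by exact: Cinfty_E (sm_smap s (sm_coord C' j)).
have [|rho [srho rho1 rho2]] := @retraction_rV R k l sj (C p) ssj.
  move=> w; have [v' v'w] := lchart_coord w (conj L' C'E').
  have [v vv'] := onto v'; exists (coord_vec C v) => j.
  rewrite -v'w -vv' mxE dd_dmap; last exact: sm_coord.
  by rewrite (dd_lret_D v L)//; exact: sm_smap (sm_coord C' j).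
have sr : @smooth R (euclid R (k + l)) (euclid R k) (fun z => \row_i rho i z).
  by apply: smooth_euclid => i; under eq_fun do rewrite mxE; exact/sm_euclidP.
pose RC := Smap (smooth_row_mx (smap_comp C (sfst X Z)) (smap_comp C' (ssnd X Z))).
pose rh := smap_comp (Smap sr) RC.
have sCE : \row_j sj j (C p) = C' (s p).
  by apply/rowP => j; rewrite mxE /sj Ep.
exists (smap_comp E rh); split.
- have r0 : rh (p, s p) = C p by rewrite /= -sCE; exact: nbhs_singleton rho2.
  have H1 : dsnbhs ((p, s p) : dprod X Z) (fun q => forall j, sj j (rh q) = (C' q.2 : 'rV[R]_l) 0 j).
    have := @coord_near _ _ RC (p, s p) (fun z => forall j, sj j (\row_i rho i z) = z 0 (rshift k j)).
    rewrite -[RC (p, s p)]/(row_mx (C p) (C' (s p))) -sCE => /(_ rho1).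
    apply: (@filterS _ (@dsnbhs R (dprod X Z) (p, s p))) => q H j.
    by rewrite [LHS]H [LHS]row_mxEr.
  have H2 : dsnbhs ((p, s p) : dprod X Z) (fun q => E' (C' (s (E (rh q)))) = s (E (rh q))).
    apply: (smooth_near (f := smap_comp s (smap_comp E rh)) (A := fun z => E' (C' z) = z)).
    by rewrite -[smap_comp _ _ _]/(s (E (rh (p, s p)))) r0 Ep.
  apply: filterS3 H1 H2 (near_snd p L') => q H1 H2 <-; rewrite -[s _]H2; congr (E' _).
  by apply/rowP => j; exact: H1.
- have H1 : dsnbhs p (fun x => \row_i rho i (row_mx (C x) (\row_j sj j (C x))) = C x).
    exact: (coord_near (A := fun z => \row_i rho i (row_mx z (\row_j sj j z)) = z)).
  apply: filterS2 L H1 => x Ex; rewrite /= (_ : \row_j _ = C' (s x)) => [->//|].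
  by apply/rowP => j; rewrite mxE /sj Ex.
Qed.

Lemma submersion_section X Z (s : smap X Z) (p : X) : lretract p -> is_manifold Z ->
  onto_at s p -> exists sigma : smap Z X, sigma (s p) = p /\ dsnbhs (s p) (fun z => s (sigma z) = z).
Proof.
move=> Lp /(manifold_lchart (s p))[l [E' [C' L']]] onto.
have [rho [H1 H2]] := submersion_retraction Lp L' onto.
pose j := spair (scst Z p) (sid Z).
exists (smap_comp rho j); split; first exact: (dsnbhs_self H2).
exact: (smooth_near (f := j) (x := s p) H1).
Qed.

Lemma vel_near X (x : X) (c c' : R -> X) (v : tangent x) : vel c v ->
  nbhs (0 : R) (fun e => c e = c' e) -> vel c' v.
Proof.
move=> cv cc' h sh; have cvh := cv h sh.
by apply: near_eq_is_derive cvh; apply: filterS cc' => e ->.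
Qed.

Lemma vel_pair X Y (p : X) (q : Y) (b : smap (realline R) X) (c : smap (realline R) Y)
  (w : @tangent R (dprod X Y) (p, q)) (v : tangent p) (u : tangent q) :
  lretract p -> lretract q -> b 0 = p -> c 0 = q -> vel b v -> vel c u ->
  (forall h, sm h -> dd w (fun z => h z.1) = dd v h) ->
  (forall h, sm h -> dd w (fun z => h z.2) = dd u h) -> vel (fun e => (b e, c e) : dprod X Y) w.
Proof.
move=> Lp Lq b0 c0 bv cu w1 w2.
have [|w' bcw'] := @curve_tangent R (dprod X Y) (spair b c) (p, q); first by rewrite /= b0 c0.
rewrite (_ : w = w')//; apply: prod_tangent_ext => // h sh.
- rewrite w1//; have [_ <-] := bv h sh.
  by have [_ <-] := bcw' _ (sm_smap (sfst X Y) sh).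
- rewrite w2//; have [_ <-] := cu h sh.
  by have [_ <-] := bcw' _ (sm_smap (ssnd X Y) sh).
Qed.

(* Lift the curve c through rho(b, c), where b is any curve with the prescribed velocity. *)
Lemma curve_lift X Z (s : smap X Z) (p : X) (v : tangent p) (c : smap (realline R) Z) :
  lretract p -> is_manifold Z -> onto_at s p -> c 0 = s p -> vel c (dmap s v) ->
  exists (kappa : smap (realline R) (realline R)) (c' : smap (realline R) X),
    [/\ kappa 0 = 0, nbhs (0 : R) (fun e => kappa e = e), c' 0 = p, vel c' v &
        forall e, s (c' e) = c (kappa e)].
Proof.
move=> Lp mZ onto c0 cv; have [l [E' [C' L']]] := manifold_lchart (s p) mZ.
have [rho [H1 H2]] := submersion_retraction Lp L' onto.
have [k [E [C LC]]] := Lp; have [b b0 bv] := lret_curve v LC.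
pose bc := spair b c.
have bc0 : bc 0 = (p, s p) by rewrite /= b0 c0.
have nb : nbhs (0 : R) (fun e => s (rho (bc e)) = c e).
  apply: dsnbhs_realline; apply: (smooth_near (f := bc) (A := fun q => s (rho q) = q.2)).
  by rewrite bc0.
(* [rho] of [bc] lies over [c] only near 0; reparametrizing by [kappa] gives a lift defined on all
   of R. *)
have [kappa [k0 kA kid]] := realline_cut nb.
exists kappa, (smap_comp rho (smap_comp bc kappa)); split => //.
  by rewrite /= k0 b0 c0; exact: (dsnbhs_self H2).
(* The curves [(b, c)] and [(b, s b)] have the same velocity, and [rho] sends the second one back to
   [b]; hence the lift has velocity [v]. *)
pose j := spair (sid X) s.
have bw : vel (fun e => j (b e)) (dmap j v) by exact: vel_dmap.
have bcw : vel bc (dmap j v).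
  apply: (vel_pair Lp (lchart_lretract L') b0 c0 bv cv) => h sh.
    exact: (dd_dmap j v (sm_smap (sfst X Z) sh)).
  by rewrite [RHS]dd_dmap//; exact: (dd_dmap j v (sm_smap (ssnd X Z) sh)).
have rbc := vel_dmap rho bcw; have rjb := vel_dmap rho bw.
have vb : vel (fun e => rho (j (b e))) v.
  apply: (vel_near bv); apply: dsnbhs_realline.
  have : dsnbhs (b 0) (fun x => rho (x, s x) = x) by rewrite b0.
  by move=> /smooth_near; apply: filterS => e /= ->.
apply: (@vel_near _ _ (fun e => rho (bc e))).
  move=> h sh; rewrite -(vel_dd rjb vb sh); exact: rbc.
by apply: filterS kid => e /= ->.
Qed.

Lemma lretract_dsub X (A : set X) (r : smap X X) (p : dsub A) : lretract (sval p) ->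
  dsnbhs (sval p) (fun x => A (r x)) -> dsnbhs (sval p) (fun x => A x -> r x = x) ->
  lretract p.
Proof.
move=> [k [E [C L]]] rA rid.
have Ep := dsnbhs_self L.
have nA : nbhs (C (sval p) : 'rV[R]_k) (fun z => A (r (E z))).
  apply/dsnbhs_euclid; apply: (smooth_near (f := E) (A := fun x => A (r x))).
  by rewrite Ep.
have [tau [tauA tauid]] := euclid_cut nA.
have sE : @smooth R (euclid R k) (dsub A) (fun z => exist _ (r (E (tau z))) (tauA z)).
  apply: smooth_sub => /=; exact: (smap_smooth (smap_comp r (smap_comp E tau))).
exists k, (Smap sE), (smap_comp C (sincl A)).
have H1 : dsnbhs p (fun y => tau (C (sval y)) = C (sval y)).
  exact: (coord_near (C := smap_comp C (sincl A)) (A := fun z => tau z = z)).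
apply: filterS3 H1 (smooth_near (f := sincl A) rid) (smooth_near (f := sincl A) L) => y /= t1 t2 t3; apply: sig_ext => /=.
by rewrite t1 t3; apply: t2; exact: svalP.
Qed.

(** The map (x, y) |-> (rho(x, g y), y) retracts a neighbourhood in the product onto the fibre
    product. *)
Lemma lretract_fibprod X Y Z (s : smap X Z) (g : smap Y Z) (p : fibprod s g) :
  lretract (sval p).1 -> lretract (sval p).2 -> is_manifold Z -> onto_at s (sval p).1 ->
  lretract p.
Proof.
case: p => -[x y] sxy /= Lx Ly mZ onto; have sg : s x = g y := sxy.
have [l [E' [C' L']]] := manifold_lchart (s x) mZ.
have [rho [H1 H2]] := submersion_retraction Lx L' onto.
pose gy := spair (sfst X Y) (smap_comp g (ssnd X Y)).
have gxy : gy (x, y) = (x, s x) by rewrite /= sg.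
apply: (@lretract_dsub (dprod X Y) _ (spair (smap_comp rho gy) (ssnd X Y))) => /=.
- have [k [E [C L]]] := Lx; have [k' [E0 [C0 L0]]] := Ly.
  by have [E'' L''] := lret_prod L L0; exists (k + k')%N; do 2 eexists; exact: L''.
- have : dsnbhs (gy (x, y)) (fun q => s (rho q) = q.2) by rewrite gxy.
  by move=> /smooth_near; apply: filterS => -[a b].
- by apply: filterS (near_fst y H2) => -[a b] /= rab <-; rewrite rab.
Qed.

(* Smooth functions on A extend locally to X, so they only see the velocity in X. *)
Lemma vel0_dsub X Y (A : set X) (phi : smap (dsub A) Y) (c : smap (realline R) (dsub A))
  (y : Y) (w : tangent y) : vel (fun e => sval (c e)) (0 : tangent (sval (c 0))) ->
  vel (fun e => phi (c e)) w -> w = 0.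
Proof.
move=> c0 cw; apply: tangent_ext => h sh; rewrite dd0v.
have [g sg gP] := sm_subtype (c 0) (sm_smap phi sh).
have [_ <-] := cw h sh; have [_ E] := c0 g sg; rewrite dd0v in E.
rewrite -[RHS]E; apply: near_eq_derive.
apply: dsnbhs_realline; move/(smooth_near (f := smap_comp (sincl A) c) (x := 0)) : gP.
by apply: filterS => e /= /(_ (svalP _)) <-; rewrite sval_eta.
Qed.

End Submersions.

(** * Line bundles, forms and connections *)

Section LinearFacts.
Variables (R : realType) (V W : lmodType R) (f : V -> W).
Hypothesis lf : linear f.

Definition lin_map : {linear V -> W} := HB.pack f (GRing.isLinear.Build R V W *:%R f lf).

Lemma lin0 : f 0 = 0. Proof. exact: (linear0 lin_map). Qed.
Lemma linD v w : f (v + w) = f v + f w. Proof. exact: (linearD lin_map). Qed.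
Lemma linB v w : f (v - w) = f v - f w. Proof. exact: (linearB lin_map). Qed.
Lemma linN v : f (- v) = - f v. Proof. exact: (linearN lin_map). Qed.
Lemma linZ a v : f (a *: v) = a *: f v. Proof. exact: (linearZZ lin_map). Qed.
Lemma lin_sum (I : Type) (s : seq I) (F : I -> V) :
  f (\sum_(i <- s) F i) = \sum_(i <- s) f (F i).
Proof. exact: (linear_sum lin_map). Qed.

End LinearFacts.

Section Frames.
Variable R : realType.

Lemma smooth_section_E (X : diffspace R) (E : line_bundle X) (mu : forall x, E x) :
  smooth_section mu -> forall h : total_space E -> R, sm h -> sm (fun x => h (in_total (mu x))).
Proof. by []. Qed.

Lemma in_total_inj (X : diffspace R) (E : line_bundle X) (x : X) (e e' : E x) :
  in_total e = in_total e' -> e = e'.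
Proof.
move=> H; have := projT2_eq H.
by rewrite (Prop_irrelevance (projT1_eq H) (erefl x)).
Qed.

Variables (X : diffspace R) (E : line_bundle X).
Implicit Types (x y : X).

Lemma frame_map_local (U : set X) (lam0 : forall y, E y) x (u : X -> R)
    (h : total_space E -> R) :
  dspace_open U -> U x ->
  @smooth R (dprod (dsub U) (realline R))
    (@dsub R (total_space E) [set e | U (projT1 e)]) (frame_map (U := U) lam0) ->
  sm u -> sm h ->
  exists2 g, sm g & dsnbhs x (fun y => h (in_total (u y *: lam0 y)) = g y).
Proof.
move=> oU Ux sfm su sh.
pose F := smap_comp (sincl _) (smap_comp (Smap sfm)
  (spair (sid (dsub U)) (smap_comp (Smap (smooth_realline su)) (sincl U)))).
have [g sg gP] := sm_subtype (exist _ x Ux) (sm_smap F sh).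
exists g => //; apply: filterS2 (dspace_open_nbhs oU Ux) gP => y Uy /(_ Uy) <-.
by [].
Qed.

Lemma smooth_section_local (mu : forall x, E x) :
  (forall x, exists2 mu' : forall x, E x, smooth_section mu' & dsnbhs x (fun y => mu y = mu' y)) ->
  smooth_section mu.
Proof.
move=> H h sh; apply: sm_local => x; have [mu' smu' E'] := H x.
by exists (fun y => h (in_total (mu' y))); [exact: smu'|apply: filterS E' => y /= ->].
Qed.

Lemma smooth_section0 : smooth_section (fun x => 0 : E x).
Proof.
move=> h sh; apply: sm_local => x.
have [U [lam0 [oU Ux [sfm _]]]] := lb_trivial E x.
have [g sg gP] := frame_map_local oU Ux sfm (sm_cst X 0) sh; exists g => //.
by apply: filterS gP => y; rewrite scale0r.
Qed.

(* A global section lam without zeros near x, together with a smooth function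
   on the total space giving the coefficient with respect to lam near x. *)
Definition is_frame x (lam : forall y, E y) (r : total_space E -> R) : Prop :=
  [/\ sm r, forall u, sm u -> smooth_section (fun y => u y *: lam y) &
      dsnbhs x (fun y => lam y != 0 /\ forall e : E y, e = r (in_total e) *: lam y)].

Lemma sproj_subproof : @smooth R (total_space E) X (fun e => projT1 e).
Proof. exact: lb_proj_smooth. Qed.

Definition sproj : smap (total_space E) X := Smap sproj_subproof.

(** Local section and local coefficient are both multiplied by a bump function to become global;
    where the bump is 1 they are a frame and its coefficient. *)
Lemma frame_exists x : exists lam r, is_frame x lam r.
Proof.
have [U [lam0 [oU Ux [sfm [inv [sinv fmK invK]]]]]] := lb_trivial E x.
have [psi [spsi psi1 psi0 _]] := bump_exists (dspace_open_nbhs oU Ux).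
pose r0 (e : total_space E) : R := match pselect (U (projT1 e)) with
  | left Ue => (inv (exist _ e Ue)).2 | right _ => 0 end.
have r0E e (Ue : U (projT1 e)) : r0 e = (inv (exist _ e Ue)).2.
  rewrite /r0; case: pselect => [Ue'|//].
  by congr (inv _).2; exact: sig_ext.
exists (fun y => psi y *: lam0 y), (fun e => psi (projT1 e) * r0 e); split.
- apply: sm_local => e; have [Ay|ps0] := psi0 (projT1 e); last first.
    exists (fun=> 0); first exact: sm_cst.
    by apply: filterS (smooth_near (f := sproj) ps0) => z /= ->; rewrite mul0r.
  have Ue := dsnbhs_self Ay.
  have s2 : sm (fun z : @dsub R (total_space E) [set e | U (projT1 e)] => (inv z).2 : R).
    have sid1 : @sm R (realline R) id by exact: gen_sub.
    exact: (sinv _ (sm_smap (ssnd (dsub U) (realline R)) sid1)).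
  have [g sg gP] := sm_subtype (exist _ e Ue) s2.
  exists (fun z => psi (projT1 z) * g z).
    by apply: sm_mul => //; exact: (sm_smap sproj spsi).
  apply: filterS2 (smooth_near (f := sproj) (x := e) Ay) gP => z Uz /(_ Uz) <-.
  by rewrite -r0E.
- move=> u su h sh; apply: sm_local => y; have [Ay|ps0] := psi0 y; last first.
    exists (fun y => h (in_total (0 : E y))); first exact: smooth_section0.
    by apply: filterS ps0 => z /= ->; rewrite scale0r scaler0.
  have [g sg gP] := frame_map_local oU (dsnbhs_self Ay) sfm (sm_mul su spsi) sh.
  by exists g => //; apply: filterS gP => z; rewrite /= scalerA.
apply: filterS2 psi1 (dspace_open_nbhs oU Ux) => y psi1' Uy; rewrite psi1' scale1r; split.
  apply/negP => /eqP l0; have := fmK (exist _ y Uy, 1).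
  have := fmK (exist _ y Uy, 0); rewrite /frame_map /= l0 !scaler0 => -> [] /eqP.
  by rewrite eq_sym oner_eq0.
move=> e; have Ue : U (projT1 (in_total e)) by [].
rewrite mul1r (r0E _ Ue).
have := congr1 (@proj1_sig _ _) (invK (exist _ (in_total e) Ue)).
case: (inv _) => -[y' Uy'] t /= H.
have yy' : y' = y := congr1 (@projT1 _ _) H.
case: y / yy' e Uy Ue psi1' H => e Uy Ue _ /in_total_inj <-; congr (_ *: _).
Qed.

Lemma is_frame_near x lam r : is_frame x lam r -> dsnbhs x (fun y => is_frame y lam r).
Proof. by case=> sr sl /dsnbhs_join; apply: filterS => y ny; split. Qed.

Lemma is_frame_section x lam r : is_frame x lam r -> smooth_section lam.
Proof.
move=> [_ /(_ _ (sm_cst X 1)) H _]; move: H; congr smooth_section.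
by apply/functional_extensionality_dep => y; rewrite scale1r.
Qed.

Lemma is_frame_neq0 x lam r : is_frame x lam r -> lam x != 0.
Proof. by case=> _ _ /dsnbhs_self[]. Qed.

Lemma is_frame_gen x lam r (e : E x) : is_frame x lam r -> e = r (in_total e) *: lam x.
Proof. by case=> _ _ /dsnbhs_self[_]; exact. Qed.

Lemma scale_inj (V : lmodType R) (e : V) : e != 0 -> injective (fun a : R => a *: e).
Proof.
move=> e0 a b /eqP; rewrite -subr_eq0 -scalerBl scaler_eq0 (negPf e0) orbF subr_eq0.
by move/eqP.
Qed.

Lemma is_frame_coef x lam r (a : R) : is_frame x lam r -> r (in_total (a *: lam x)) = a.
Proof.
move=> F; apply: (scale_inj (is_frame_neq0 F)) => /=.
by rewrite -is_frame_gen.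
Qed.

Lemma smooth_section_frame x lam r (mu : forall y, E y) : is_frame x lam r ->
  smooth_section mu ->
  exists2 u, sm u & dsnbhs x (fun y => mu y = u y *: lam y).
Proof.
move=> F smu; exists (fun y => r (in_total (mu y))).
  by apply: smu; case: F.
by apply: filterS (is_frame_near F) => y Fy; exact: is_frame_gen.
Qed.

Lemma smooth_section_coef (mu : forall y, E y) :
  (forall x, exists lam r u, [/\ is_frame x lam r, sm u & dsnbhs x (fun y => mu y = u y *: lam y)]) ->
  smooth_section mu.
Proof.
move=> H; apply: smooth_section_local => x; have [lam [r [u [[_ F _] su E']]]] := H x.
by exists (fun y => u y *: lam y) => //; exact: F.
Qed.

Lemma smooth_sectionZ (mu : forall y, E y) u : smooth_section mu -> sm u ->
  smooth_section (fun y => u y *: mu y).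
Proof.
move=> smu su; apply: smooth_section_coef => x; have [lam [r F]] := frame_exists x.
have [w sw muE] := smooth_section_frame F smu; exists lam, r, (fun y => u y * w y).
by split=> //; [exact: sm_mul|apply: filterS muE => y ->; rewrite scalerA].
Qed.

Lemma smooth_sectionD (mu nu : forall y, E y) : smooth_section mu -> smooth_section nu ->
  smooth_section (fun y => mu y + nu y).
Proof.
move=> smu snu; apply: smooth_section_coef => x; have [lam [r F]] := frame_exists x.
have [w sw muE] := smooth_section_frame F smu; have [w' sw' nuE] := smooth_section_frame F snu.
exists lam, r, (fun y => w y + w' y); split => //; first exact: sm_add.
by apply: filterS2 muE nuE => y -> ->; rewrite scalerDl.
Qed.

Lemma smooth_section_sum (I : Type) (s : seq I) (mu : I -> forall y, E y) :
  (forall i, smooth_section (mu i)) -> smooth_section (fun y => \sum_(i <- s) mu i y).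
Proof.
move=> smu; elim: s => [|i s IH].
  rewrite (_ : (fun y => _) = (fun y => 0)); first exact: smooth_section0.
  by apply/functional_extensionality_dep => y; rewrite big_nil.
rewrite (_ : (fun y => _) = (fun y => mu i y + \sum_(j <- s) mu j y)).
  exact: smooth_sectionD.
by apply/functional_extensionality_dep => y; rewrite big_cons.
Qed.

Definition local_form (theta : form1 E) x (lam : forall y, E y) n (f g : 'I_n -> X -> R) : Prop :=
  [/\ forall i, sm (f i), forall i, sm (g i) &
      dsnbhs x (fun y => forall v : tangent y, theta y v = (\sum_i f i y * dd v (g i)) *: lam y)].

Lemma local_form_exists (theta : form1 E) x lam r : is_form1 theta -> lretract x ->
  is_frame x lam r -> exists n (f g : 'I_n -> X -> R), local_form theta x lam f g.
Proof.
move=> [lt st] [k [T [C L]]] F; have [V VP] := lret_frame L.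
exists k, (fun i y => r (in_total (theta y (V i y)))), (fun i y => C y 0 i); split.
- by move=> i; apply: (st (V i)); case: F.
- by move=> i; exact: sm_coord.
apply: filterS2 VP (is_frame_near F) => y Vy Fy v.
rewrite {1}(Vy v) (lin_sum (lt y)) scaler_suml; apply: eq_bigr => i _.
by rewrite (linZ (lt y)) [in LHS](is_frame_gen (theta y (V i y)) Fy) scalerA mulrC.
Qed.

Lemma local_form_is_form1 (theta : form1 E) : (forall x, linear (theta x)) ->
  (forall x, exists lam r, is_frame x lam r /\
    exists n (f g : 'I_n -> X -> R), local_form theta x lam f g) -> is_form1 theta.
Proof.
move=> lt H; split => // V; apply: smooth_section_coef => x.
have [lam [r [F [n [f [g [sf sg fg]]]]]]] := H x.
exists lam, r, (fun y => \sum_i f i y * dd (V y) (g i)); split => //.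
  by apply: sm_sum => i; apply: sm_mul => //; exact: sm_vf.
by apply: filterS fg => y ->.
Qed.

End Frames.

Section BundleMaps.
Variable R : realType.
Variables (X Y : diffspace R) (E : line_bundle X) (E' : line_bundle Y) (f : smap X Y).
Variable F : vbmap E E' f.

Lemma vbmap_coef x lam r lam' r' : is_frame x lam r -> @is_frame R Y E' (f x) lam' r' ->
  exists2 b, @sm R X b & dsnbhs x (fun y => F y (lam y) = b y *: lam' (f y)).
Proof.
move=> Fl [sr' sl' nl']; exists (fun y => r' (in_total (F y (lam y)))).
  exact: (smooth_section_E (is_frame_section Fl) (sm_smap (vb_total F) sr')).
by apply: filterS (smooth_near nl') => y [_]; exact.
Qed.

Lemma vbmap_bij x : (forall v, F x v = 0 -> v = 0) -> forall w, exists v, F x v = w.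
Proof.
move=> inj w; have [lam [r Fl]] := frame_exists E x.
have [lam' [r' Fl']] := frame_exists E' (f x).
have Fn0 : F x (lam x) != 0.
  by apply/eqP => /inj /eqP; rewrite (negPf (is_frame_neq0 Fl)).
rewrite (is_frame_gen w Fl') (is_frame_gen (F x (lam x)) Fl') in Fn0 *.
set a := r' _; set b := r' _ in Fn0 *.
have b0 : b != 0 by apply: contraNneq Fn0 => ->; rewrite scale0r.
exists ((a / b) *: lam x); rewrite linearZ /= (is_frame_gen (F x (lam x)) Fl') scalerA -/b.
by rewrite divfK.
Qed.

Lemma linv_vbmap x : (forall v, F x v = 0 -> v = 0) -> forall w, F x (linv (F x) w) = w.
Proof.
move=> inj w; have [v Fv] := vbmap_bij inj w.
by rewrite /linv; case: xgetP => [v' _ //|/(_ v)] /=.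
Qed.

Lemma vbmap_inj x : (forall v, F x v = 0 -> v = 0) -> injective (F x).
Proof. by move=> inj v w /eqP; rewrite -subr_eq0 -linearB => /eqP/inj/eqP; rewrite subr_eq0 => /eqP. Qed.

End BundleMaps.

(** * Existence and local expression of connections *)

Section Connections.
Variable R : realType.
Variables (X : diffspace R) (E : line_bundle X).
Implicit Types (x y : X).

Lemma frame_cover : second_countable_dspace X ->
  exists (phi : nat -> X -> R) (lam : nat -> forall y, E y) (r : nat -> total_space E -> R),
    [/\ forall k, sm (phi k), forall k, sm (r k), forall k, smooth_section (lam k),
        forall k x, 0 < phi k x -> is_frame x (lam k) (r k) &
        forall x, exists k, 0 < phi k x].
Proof.
move=> [B [_ BP]].
pose ok (d : (X -> R) * (forall y, E y) * (total_space E -> R)) :=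
  [/\ sm d.1.1, sm d.2, smooth_section d.1.2 &
      forall x, 0 < d.1.1 x -> is_frame x d.1.2 d.2].
have /choice[d dP] (k : nat) : exists d, ok d /\
    ((exists d', ok d' /\ forall x, B k x -> 0 < d'.1.1 x) -> forall x, B k x -> 0 < d.1.1 x).
  have [[d [okd dB]]|nd] := pselect (exists d', ok d' /\ forall x, B k x -> 0 < d'.1.1 x).
    by exists d.
  exists (fun=> 0, fun y => 0 : E y, fun=> 0); split => //; split => /=.
  - exact: sm_cst.
  - exact: (sm_cst (total_space E)).
  - exact: smooth_section0.
  - by move=> x; rewrite ltxx.
exists (fun k => (d k).1.1), (fun k => (d k).1.2), (fun k => (d k).2); split.
- by move=> k; case: (dP k) => -[].
- by move=> k; case: (dP k) => -[].
- by move=> k; case: (dP k) => -[].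
- by move=> k; case: (dP k) => -[_ _ _].
move=> x; have [lam [r F]] := frame_exists E x.
have [phi [sphi phix phiF]] := is_frame_near F.
have oU : dspace_open [set y | 0 < phi y] by move=> y phiy; exists phi.
have [k [Bx BU]] := BP _ _ oU phix.
exists k; have [_] := dP k; apply => //; exists (phi, lam, r); split; last by move=> y /BU.
by split=> //=; [case: F|exact: is_frame_section F].
Qed.

Lemma sum_trunc (V : nmodType) (f : nat -> V) m n : (forall k, (m <= k)%N -> f k = 0) ->
  (forall k, (n <= k)%N -> f k = 0) -> \sum_(k < m) f k = \sum_(k < n) f k.
Proof.
wlog mn : m n / (m <= n)%N => [H fm fn|fm _].
  by case: (leqP m n) => [/H|/ltnW/H] ->.
rewrite -!(big_mkord xpredT) /= (@big_cat_nat _ _ _ m 0 n)//=.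
by rewrite [X in _ + X]big_nat [X in _ + X]big1 ?addr0// => k /andP[/fm].
Qed.

(** At the first [k] with [phi k x] positive, every factor of the weight is positive. Conversely, if
    [phi j] exceeds [e] near [x], the factor of index [j] kills every later weight with 1 / (k+1) <=
    e. *)
Lemma locally_finite_weights (phi : nat -> X -> R) : (forall k, sm (phi k)) ->
  (forall x, exists k, 0 < phi k x) ->
  exists psi : nat -> X -> R,
    [/\ forall k, sm (psi k), forall k x, 0 <= psi k x,
        forall k x, psi k x != 0 -> 0 < phi k x, forall x, exists k, 0 < psi k x &
        forall x, exists K, dsnbhs x (fun y => forall k, (K <= k)%N -> psi k y = 0)].
Proof.
move=> sphi cov.
exists (fun k x => flat 0 (phi k x) * \prod_(j < k) flat 0 (k.+1%:R^-1 + - phi j x)); split.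
- move=> k; apply: sm_mul; first exact: sm_flat.
  have : forall s : seq 'I_k, sm (fun x => \prod_(j <- s) flat 0 (k.+1%:R^-1 + - phi j x)).
    elim=> [|j s IH].
      rewrite (_ : (fun x => _) = (fun=> 1)); first exact: sm_cst.
      by apply/funext => x; rewrite big_nil.
    rewrite (_ : (fun x => _) = (fun x => flat 0 (k.+1%:R^-1 + - phi j x) *
      \prod_(j <- s) flat 0 (k.+1%:R^-1 + - phi j x))).
      by apply: sm_mul => //; apply: sm_flat; apply: sm_add; [exact: sm_cst|exact: sm_opp].
    by apply/funext => x; rewrite big_cons.
  exact.
- by move=> k x; rewrite mulr_ge0 ?flat_ge0// prodr_ge0// => j _; exact: flat_ge0.
- move=> k x; case: (ltP 0 (phi k x)) => // /flat0_le0 ->.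
  by rewrite mul0r eqxx.
- move=> x; have ex := cov x; exists (ex_minn ex); case: ex_minnP => k phik kmin.
  rewrite mulr_gt0 ?flat0_gt0// prodr_gt0// => j _; apply: flat0_gt0.
  rewrite ltr_pwDl ?invr_gt0// oppr_ge0 leNgt; apply/negP => /kmin.
  by rewrite leqNgt ltn_ord.
- move=> x; have [j pj] := cov x; pose e := phi j x / 2.
  have e0 : 0 < e by rewrite divr_gt0.
  have [K0 K0P] : exists K0 : nat, e^-1 < K0%:R by exists (Num.bound e^-1); rewrite archi_boundP// invr_ge0 ltW.
  exists (maxn K0 j.+1).
  have ej : e < phi j x by rewrite ltr_pdivrMr// ltr_pMr// ltr1n.
  apply: filterS (dsnbhs_pos (sphi j) ej) => y py k.
  rewrite geq_max => /andP[K0k jk].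
  rewrite (bigD1 (Ordinal jk))//= [X in _ * (X * _)]flat0_le0 ?mul0r ?mulr0// subr_le0.
  apply: le_trans (ltW py); rewrite -[leRHS]invrK lef_pV2 ?posrE ?invr_gt0//.
  by apply: le_trans (ltW K0P) _; rewrite ler_nat (leq_trans K0k).
Qed.

Lemma frame_coef_lin x lam r (F : is_frame x lam r) (a : R) (e e' : E x) :
  r (in_total (a *: e + e')) = a * r (in_total e) + r (in_total e').
Proof.
rewrite {1}(is_frame_gen e F) {1}(is_frame_gen e' F) scalerA -scalerDl.
exact: (is_frame_coef _ F).
Qed.

(** The average, with weights [psi k x / Psi x], of the connections for which the frames [lam k] are
    parallel. *)
Lemma connection_exists : second_countable_dspace X -> exists nabla, @is_connection R X E nabla.
Proof.
move=> /frame_cover[phi [lam [r [sphi sr slam F cov]]]].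
have [psi [spsi psi0 psiphi psipos /choice[K KP]]] := locally_finite_weights sphi cov.
have PF k x : psi k x != 0 -> is_frame x (lam k) (r k) by move/psiphi/F.
pose Psi x := \sum_(k < K x) psi k x.
have Psi0 x : Psi x != 0.
  have [k pk] := psipos x.
  have kK : (k < K x)%N.
    rewrite ltnNge; apply/negP => /(dsnbhs_self (KP x)) p0; by rewrite p0 ltxx in pk.
  by rewrite gt_eqF// /Psi (bigD1 (Ordinal kK))//= ltr_pwDl// sumr_ge0.
have srmu k (mu : forall y, E y) : smooth_section mu -> sm (fun y => r k (in_total (mu y))).
  by move=> smu; exact: (smooth_section_E smu (sr k)).
pose D x (v : tangent x) (mu : forall y, E y) k : E x :=
  (psi k x * dd v (fun y => r k (in_total (mu y)))) *: lam k x.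
pose nab x (v : tangent x) (mu : forall y, E y) : E x :=
  (Psi x)^-1 *: \sum_(k < K x) D x v mu k.
exists nab; split.
- move=> x a v w mu smu; rewrite /nab scalerA mulrC -scalerA -scalerDr; congr (_ *: _).
  rewrite scaler_sumr -big_split; apply: eq_bigr => k _ /=.
  by rewrite /D dd_lin mulrDr scalerDl scalerA; congr (_ *: _ + _); ring.
- move=> x v mu nu smu snu; rewrite /nab -scalerDr; congr (_ *: _).
  rewrite -big_split; apply: eq_bigr => k _ /=; rewrite /D.
  have [->|/PF Fx] := eqVneq (psi k x) 0; first by rewrite !mul0r !scale0r addr0.
  rewrite -scalerDl -mulrDr -ddD; [|exact: srmu|exact: srmu].
  congr (_ *: _); congr (_ * _); apply: dd_near.
  + exact: srmu (smooth_sectionD smu snu).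
  + by apply: sm_add; exact: srmu.
  apply: filterS (is_frame_near Fx) => y Fy.
  by rewrite -[mu y in LHS]scale1r (frame_coef_lin Fy) mul1r.
- move=> x v h mu smu; set hv := (val h : X -> R).
  have sh : sm hv by exact: Cinf_sm.
  have -> : tan_fun v h *: mu x = (Psi x)^-1 *: \sum_(k < K x)
      (psi k x * (dd v hv * r k (in_total (mu x)))) *: lam k x.
    apply: (scalerI (Psi0 x)); rewrite [RHS]scalerA mulfV// scale1r scalerA mulrC -scalerA.
    rewrite ddE -/hv scalerA mulrC /Psi mulr_suml scaler_suml; apply: eq_bigr => k _.
    have [->|/PF Fx] := eqVneq (psi k x) 0; first by rewrite !mul0r !scale0r.
    by rewrite {1}(is_frame_gen (mu x) Fx) !scalerA; congr (_ *: _); ring.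
  rewrite /nab scalerA mulrC -scalerA -scalerDr; congr (_ *: _).
  rewrite scaler_sumr -big_split; apply: eq_bigr => k _ /=; rewrite /D.
  have [->|/PF Fx] := eqVneq (psi k x) 0; first by rewrite !mul0r !scale0r scaler0 addr0.
  rewrite scalerA -scalerDl; congr (_ *: _).
  have smk := srmu k _ smu.
  rewrite (_ : dd v _ = dd v (fun y => hv y * r k (in_total (mu y)))).
    by rewrite ddM//; ring.
  apply: dd_near; first exact: srmu (smooth_sectionZ smu sh).
    exact: sm_mul.
  apply: filterS (is_frame_near Fx) => y Fy.
  by rewrite -[_ *: _]addr0 -[0](scale0r (0 : E y)) addrC (frame_coef_lin Fy) mul0r add0r
    {1}(is_frame_gen (mu y) Fy) scalerA (is_frame_coef _ Fy).
- move=> V mu smu; apply: smooth_section_local => x.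
  pose S (y : X) : E y := \sum_(k < K x) D y (V y) mu k.
  have sS : smooth_section S.
    apply: smooth_section_sum => k; apply: smooth_sectionZ => //.
    by apply: sm_mul => //; apply: sm_vf; exact: srmu.
  have sP : sm (fun y => \sum_(k < K x) psi k y) by exact: sm_sum.
  have [h sh hP] := sm_div (sm_cst X 1) sP (Psi0 x).
  exists (fun y => h y *: S y); first exact: smooth_sectionZ.
  apply: filterS2 hP (KP x) => y -> Ky; have Ky' := dsnbhs_self (KP y).
  (* The truncation bound [K y] may jump with [y]; near [x] the terms beyond [K x] vanish too, so
     both truncations give the same sum. *)
  rewrite mul1r /nab /Psi /S (@sum_trunc _ (fun k => psi k y) (K y) (K x))//.
  rewrite (@sum_trunc _ (fun k => D y (V y) mu k) (K y) (K x))// => k kk.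
    by rewrite /D Ky'// mul0r scale0r.
  by rewrite /D Ky// mul0r scale0r.
Qed.

Variable nabla : forall x : X, tangent x -> (forall y, E y) -> E x.
Hypothesis conn : is_connection nabla.

Lemma conn_leibniz_dd x (v : tangent x) f lam : sm f -> smooth_section lam ->
  nabla v (fun y => f y *: lam y) = dd v f *: lam x + f x *: nabla v lam.
Proof.
move=> sf sl; have := conn_leibniz conn v (mkCinf sf) sl.
by rewrite /= (ddP v (f := f)).
Qed.

Lemma conn_local x (v : tangent x) mu nu : smooth_section mu -> smooth_section nu ->
  dsnbhs x (fun y => mu y = nu y) -> nabla v mu = nabla v nu.
Proof.
move=> smu snu /bump_exists[psi [spsi psi1 psi0 _]].
have H lam : smooth_section lam -> nabla v lam = nabla v (fun y => psi y *: lam y).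
  move=> sl; rewrite conn_leibniz_dd// (dsnbhs_self psi1) scale1r.
  by rewrite (dd_near v spsi (sm_cst X 1) psi1) dd_cst scale0r add0r.
rewrite H// [RHS]H//; congr nabla; apply/functional_extensionality_dep => y.
by case: (psi0 y) => /dsnbhs_self ->//; rewrite !scale0r.
Qed.

Lemma conn_frame x lam r : is_frame x lam r -> exists eta : tangent x -> R,
  (forall a v w, eta (a *: v + w) = a * eta v + eta w) /\
  forall (v : tangent x) mu u, smooth_section mu -> sm u -> dsnbhs x (fun y => mu y = u y *: lam y) ->
    nabla v mu = (dd v u + u x * eta v) *: lam x.
Proof.
move=> F; have sl := is_frame_section F.
exists (fun v => r (in_total (nabla v lam))); split.
  by move=> a v w; rewrite (conn_lin conn)// (frame_coef_lin F).
move=> v mu u smu su muE; have [_ sul _] := F.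
rewrite (conn_local v smu (sul u su) muE) conn_leibniz_dd//.
by rewrite {1}(is_frame_gen (nabla v lam) F) scalerA -scalerDl.
Qed.

(** [d_nabla] picks arbitrary extensions of [v] and [w]. For any of them the iterated derivatives of
    the [g i] cancel against the bracket, which leaves dtheta plus the wedge of [eta] with theta, an
    expression in [v] and [w] alone. *)
Lemma d_nabla_frame x lam r (theta : form1 E) n (f g : 'I_n -> X -> R) (eta : tangent x -> R)
    (v w : tangent x) :
  is_frame x lam r -> is_form1 theta -> lretract x -> local_form theta x lam f g ->
  (forall (v : tangent x) mu u, smooth_section mu -> sm u -> dsnbhs x (fun y => mu y = u y *: lam y) ->
    nabla v mu = (dd v u + u x * eta v) *: lam x) ->
  d_nabla nabla theta v w =
    (\sum_i (dd v (f i) * dd w (g i) - dd w (f i) * dd v (g i)) +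
     eta v * (\sum_i f i x * dd w (g i)) - eta w * (\sum_i f i x * dd v (g i))) *: lam x.
Proof.
move=> F [lt st] [k [T [C L]]] [sf sg fg] etaP.
have key (V W : vfield X) : V x = v -> W x = w ->
    nabla v (fun y => theta y (W y)) - nabla w (fun y => theta y (V y))
        - theta x (lie_bracket V W x) =
    (\sum_i (dd v (f i) * dd w (g i) - dd w (f i) * dd v (g i)) +
     eta v * (\sum_i f i x * dd w (g i)) - eta w * (\sum_i f i x * dd v (g i))) *: lam x.
  move=> Vx Wx; pose u (U : vfield X) y := \sum_i f i y * dd (U y) (g i).
  have sfU (U : vfield X) i : sm (fun y => f i y * dd (U y) (g i)).
    by apply: sm_mul => //; exact: sm_vf.
  have su U : sm (u U) by exact: sm_sum.
  have thU (U : vfield X) (z : tangent x) :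
      nabla z (fun y => theta y (U y)) = (dd z (u U) + u U x * eta z) *: lam x.
    apply: etaP => //; apply: filterS fg => y; exact.
  have ddu (U : vfield X) (z : tangent x) : dd z (u U) =
      \sum_i (f i x * dd z (fun y => dd (U y) (g i)) + dd (U x) (g i) * dd z (f i)).
    by rewrite /u dd_sum//; apply: eq_bigr => i _; rewrite ddM//; exact: sm_vf.
  rewrite !thU !ddu (dsnbhs_self fg (lie_bracket V W x)) -!scalerBl /u Vx Wx.
  under [X in _ - X]eq_bigr do rewrite dd_bracket// Vx Wx.
  congr (_ *: _); rewrite !mulr_suml !mulr_sumr -!big_split -!sumrN -!big_split /=.
  by apply: eq_bigr => i _; ring.
have [V Vx] := vfield_through v L; have [W Wx] := vfield_through w L.
rewrite /d_nabla; case: xgetP => [z _ [V' [W' [V'x W'x ->]]]|]; first exact: key.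
by move=> /(_ _ (ex_intro _ V (ex_intro _ W (And3 Vx Wx erefl)))).
Qed.

End Connections.

(** * The action of a line bundle groupoid *)

Section GroupoidMul.
Variable R : realType.
Variables (G M : diffspace R) (GG : lie_groupoid G M).
Local Notation s := (gsrc GG).
Local Notation t := (gtgt GG).
Local Notation u := (gunit GG).
Local Notation i := (ginv GG).

(* The product gh, with junk value g when s(g) <> t(h). *)
Definition gmd (g h : G) : G :=
  match pselect (s g = t h) with
  | left c => gmul GG (exist _ (g, h) c) | right _ => g end.

Lemma gmdE g h (c : s g = t h) : gmd g h = gmul GG (exist _ (g, h) c).
Proof. by rewrite /gmd; case: pselect => // c'; congr (gmul GG _); exact: sig_ext. Qed.

Lemma src_gmd g h : s g = t h -> s (gmd g h) = s h.
Proof. by move=> c; rewrite (gmdE c) src_mul. Qed.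

Lemma tgt_gmd g h : s g = t h -> t (gmd g h) = t g.
Proof. by move=> c; rewrite (gmdE c) tgt_mul. Qed.

Lemma gmdA g h k : s g = t h -> s h = t k -> gmd (gmd g h) k = gmd g (gmd h k).
Proof.
move=> c d.
have c' : s (gmd g h) = t k by rewrite src_gmd.
have d' : s g = t (gmd h k) by rewrite tgt_gmd.
rewrite (gmdE c') (gmdE d'); move: c' d'; rewrite (gmdE c) (gmdE d) => c' d'.
exact: mul_assoc.
Qed.

Lemma gmd1g g : gmd (u (t g)) g = g.
Proof. by have c := src_unit GG (t g); rewrite (gmdE c) mul_unitl. Qed.

Lemma gmdg1 g : gmd g (u (s g)) = g.
Proof. by have c := esym (tgt_unit GG (s g)); rewrite (gmdE c) mul_unitr. Qed.

Lemma gmdVg g : gmd (i g) g = u (s g).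
Proof. by have c := src_inv GG g; rewrite (gmdE c) mul_invl. Qed.

Lemma gmdgV g : gmd g (i g) = u (t g).
Proof. by have c := esym (tgt_inv GG g); rewrite (gmdE c) mul_invr. Qed.

Lemma gmdK g h : s g = t h -> gmd (gmd g h) (i h) = g.
Proof.
move=> c; rewrite gmdA ?tgt_inv// gmdgV -c; exact: gmdg1.
Qed.

Lemma gmdVK g h : s g = s h -> gmd (gmd g (i h)) h = g.
Proof.
move=> c; rewrite gmdA ?tgt_inv ?src_inv// gmdVg -c; exact: gmdg1.
Qed.

Lemma ginvK g : i (i g) = g.
Proof.
have c := src_inv GG g; have c' := src_inv GG (i g).
rewrite -[LHS]gmdg1 c' tgt_inv -gmdVg -gmdA// gmdVg c; exact: gmd1g.
Qed.

Lemma ginv_unit x : i (u x) = u x.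
Proof.
rewrite -[LHS]gmdg1 src_inv tgt_unit; transitivity (gmd (i (u x)) (u x)) => //.
by rewrite gmdVg src_unit.
Qed.

Lemma smooth_gmd X (a b : smap X G) : (forall x, s (a x) = t (b x)) ->
  smooth (fun x => gmd (a x) (b x)).
Proof.
move=> c; have sf : smooth (fun x => (exist _ (a x, b x) (c x) : fibprod s t)).
  by apply: smooth_sub => /=; exact: smooth_prod (smap_smooth a) (smap_smooth b).
have -> : (fun x => gmd (a x) (b x)) = (fun x => gmul GG (exist _ (a x, b x) (c x))).
  by apply/funext => x; exact: gmdE.
exact: (smooth_compf (smap_smooth (gmul GG)) sf).
Qed.

End GroupoidMul.

(** * Fibrewise invertibility of the structure maps and the action *)

Section LbgAction.
Variable R : realType.
Variable L : lbg R.
Local Notation GG := (lbg_base L).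
Local Notation T := (lbg_tot L).
Local Notation s := (gsrc GG).
Local Notation t := (gtgt GG).

Definition isz (X : diffspace R) (E : line_bundle X) (e : total_space E) : Prop := projT2 e = 0.

Lemma isz0 (X : diffspace R) (E : line_bundle X) x : isz (in_total (0 : E x)).
Proof. by []. Qed.

Lemma iszE (X : diffspace R) (E : line_bundle X) (e : total_space E) x :
  isz e -> projT1 e = x -> e = in_total (0 : E x).
Proof. by case: e => y v /= e0 <-; rewrite [v]e0. Qed.

Lemma isz_vb (X Y : diffspace R) (E : line_bundle X) (E' : line_bundle Y) (f : smap X Y)
  (F : vbmap E E' f) e : isz e -> isz (vb_total F e).
Proof. by rewrite /isz => /= ->; exact: linear0. Qed.

Lemma base_src e : projT1 (gsrc T e) = s (projT1 e).
Proof. by rewrite tot_src. Qed.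
Lemma base_tgt e : projT1 (gtgt T e) = t (projT1 e).
Proof. by rewrite tot_tgt. Qed.
Lemma base_unit z : projT1 (gunit T z) = gunit GG (projT1 z).
Proof. by rewrite tot_unit. Qed.
Lemma base_inv e : projT1 (ginv T e) = ginv GG (projT1 e).
Proof. by rewrite tot_inv. Qed.
Lemma isz_src e : isz e -> isz (gsrc T e).
Proof. by rewrite tot_src; exact: isz_vb. Qed.
Lemma isz_tgt e : isz e -> isz (gtgt T e).
Proof. by rewrite tot_tgt; exact: isz_vb. Qed.
Lemma isz_unit z : isz z -> isz (gunit T z).
Proof. by rewrite tot_unit; exact: isz_vb. Qed.
Lemma isz_inv e : isz e -> isz (ginv T e).
Proof. by rewrite tot_inv; exact: isz_vb. Qed.

Lemma base_gmd a b : gsrc T a = gtgt T b -> projT1 (gmd T a b) = gmd GG (projT1 a) (projT1 b).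
Proof.
case: a b => g a [h b] d.
have c : s g = t h.
  by have := congr1 (@projT1 _ _) d; rewrite base_src base_tgt.
have d'' : gsrc T (in_total (0 *: a + a)) = gtgt T (in_total (0 *: b + b)).
  by rewrite !scale0r !add0r.
have [e [_ [E _ _]]] := tot_mul c d d d''.
by rewrite (gmdE d) E (gmdE c).
Qed.

Lemma in_totalE (X : diffspace R) (E : line_bundle X) (e : total_space E) x :
  projT1 e = x -> exists l : E x, e = in_total l.
Proof. by case: e => y l /= <-; exists l. Qed.

(** The source map is a left inverse of [lunit], which is thus injective on fibres and, in rank one,
    bijective. So an element over a unit arrow is itself a unit, and its source determines it. *)
Lemma isz_unit_src e x : projT1 e = gunit GG x -> isz (gsrc T e) -> isz e.
Proof.
move=> /in_totalE[l ->].
have uinj v : lunit L x v = 0 -> v = 0.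
  move=> uv; have := src_unit T (in_total v); rewrite tot_unit tot_src /vb_total /= /vb_total_fun /=.
  rewrite uv linear0 => H; apply/esym; have : in_total v = in_total (0 : lbg_bun0 L x).
    by rewrite -H; apply: iszE => //=; exact: src_unit.
  by move/in_total_inj => ->.
have [w <-] := vbmap_bij uinj l.
have -> : in_total (lunit L x w) = gunit T (in_total w) by rewrite tot_unit.
by rewrite src_unit => w0; apply: isz_unit.
Qed.

(** The product of [e] with the zero over the inverse arrow lies over a unit and has zero source,
    hence is zero; multiplying back by the zero over [g] shows that [e] is zero. Fibrewise
    invertibility of source and target rests on this. *)
Lemma isz_of_src e : isz (gsrc T e) -> isz e.
Proof.
move=> se; pose g := projT1 e.
pose z := in_total (0 : lbg_bun L (ginv GG g)); pose z' := in_total (0 : lbg_bun L g).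
have zz' : z = ginv T z'.
  by apply/esym/iszE; [exact: isz_inv|rewrite base_inv].
have sz : gsrc T e = gtgt T z.
  rewrite (iszE (isz_tgt (isz0 _ _)) (base_tgt z)) tgt_inv; apply: iszE => //.
  exact: base_src.
have c' : gsrc T z = gtgt T z' by rewrite zz' src_inv.
have sz' : gsrc T e = gsrc T z'.
  by rewrite sz zz' tgt_inv.
have z1 : isz (gmd T e z).
  apply: (@isz_unit_src _ (t g)); last by rewrite src_gmd//; exact: isz_src.
  by rewrite base_gmd// gmdgV.
have -> : e = z'; last exact: isz0.
rewrite -[LHS](gmdg1 T) sz' -gmdVg -zz' -gmdA//.
rewrite (_ : gmd T e z = gunit T (gtgt T z')) ?gmd1g//.
have b1 : projT1 (gunit T (gtgt T z')) = gunit GG (t g) by rewrite base_unit base_tgt.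
have zu : isz (gunit T (gtgt T z')) by apply/isz_unit/isz_tgt/isz0.
rewrite (iszE zu b1); apply: iszE => //.
by rewrite base_gmd// gmdgV.
Qed.

Lemma isz_of_tgt e : isz (gtgt T e) -> isz e.
Proof.
rewrite -(src_inv T e) => /isz_of_src /isz_inv; by rewrite ginvK.
Qed.

Lemma lsrc_inj g (l : lbg_bun L g) : lsrc L g l = 0 -> l = 0.
Proof. by move=> l0; apply: (@isz_of_src (in_total l)); rewrite tot_src. Qed.

Lemma ltgt_inj g (l : lbg_bun L g) : ltgt L g l = 0 -> l = 0.
Proof. by move=> l0; apply: (@isz_of_tgt (in_total l)); rewrite tot_tgt. Qed.

Lemma tot_inj_src e e' : projT1 e = projT1 e' -> gsrc T e = gsrc T e' -> e = e'.
Proof.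
move=> ee'; have [l El] := in_totalE ee'; have [l' El'] := in_totalE (erefl (projT1 e')).
move: (projT1 e') l l' El El' => g l l' -> ->; rewrite !tot_src => /in_total_inj E.
by rewrite (vbmap_inj (@lsrc_inj g) (E : lsrc L g l = lsrc L g l')).
Qed.

(* The relation g.z = z'. *)
Definition act (g : lbg_arr L) (z z' : total_space (lbg_bun0 L)) : Prop :=
  exists e : total_space (lbg_bun L), [/\ projT1 e = g, gsrc T e = z & gtgt T e = z'].

Lemma act_fun g z z1 z2 : act g z z1 -> act g z z2 -> z1 = z2.
Proof.
move=> [e [eg es et]] [e' [eg' es' et']]; rewrite -et -et'; congr (gtgt T _).
by apply: tot_inj_src; rewrite ?eg ?es.
Qed.

Lemma act_total g z : projT1 z = s g -> exists z', act g z z'.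
Proof.
move=> /in_totalE[v ->]; have [l lv] := vbmap_bij (@lsrc_inj g) v.
by exists (gtgt T (in_total l)), (in_total l); split => //; rewrite tot_src /= -lv.
Qed.

Lemma act_src g z z' : act g z z' -> projT1 z = s g.
Proof. by case=> e [<- <- _]; rewrite base_src. Qed.

Lemma act_tgt g z z' : act g z z' -> projT1 z' = t g.
Proof. by case=> e [<- _ <-]; rewrite base_tgt. Qed.

Lemma act_gmd g h z z' z'' : act h z z' -> act g z' z'' -> act (gmd GG g h) z z''.
Proof.
move=> [e [eh es et]] [e' [eg' es' et']]; exists (gmd T e' e).
have c : gsrc T e' = gtgt T e by rewrite es' et.
by split; rewrite ?base_gmd ?src_gmd ?tgt_gmd ?eh ?eg'.
Qed.

Lemma act_inv g z z' : act g z z' -> act (ginv GG g) z' z.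
Proof.
by move=> [e [eg es et]]; exists (ginv T e); rewrite base_inv src_inv tgt_inv eg.
Qed.

Lemma act_unit z : act (gunit GG (projT1 z)) z z.
Proof. by exists (gunit T z); rewrite base_unit src_unit tgt_unit. Qed.

Definition tsc (X : diffspace R) (E : line_bundle X) (a : R) (z : total_space E) : total_space E :=
  in_total (a *: projT2 z).

Lemma tscE (X : diffspace R) (E : line_bundle X) (a : R) x (e : E x) :
  tsc a (in_total e) = in_total (a *: e).
Proof. by []. Qed.

Lemma vb_tsc (X Y : diffspace R) (E : line_bundle X) (E' : line_bundle Y) (f : smap X Y)
  (F : vbmap E E' f) a e : vb_total F (tsc a e) = tsc a (vb_total F e).
Proof. by rewrite /tsc /vb_total /= /vb_total_fun /= linearZ. Qed.

Lemma act_tsc g z z' a : act g z z' -> act g (tsc a z) (tsc a z').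
Proof.
move=> [e [eg es et]]; exists (tsc a e).
by rewrite !tot_src !tot_tgt !vb_tsc -tot_src -tot_tgt es et.
Qed.

Lemma act_coef g0 lam r lam' r' :
  @is_frame R _ (lbg_bun0 L) (s g0) lam r -> @is_frame R _ (lbg_bun0 L) (t g0) lam' r' ->
  exists2 c, sm c & dsnbhs g0 (fun g => c g != 0 /\
    act g (in_total (lam (s g))) (in_total (c g *: lam' (t g)))).
Proof.
move=> Fs Ft; have [Lam [rL FL]] := frame_exists (lbg_bun L) g0.
have [b1 sb1 b1P] := vbmap_coef (lsrc L) FL Fs.
have [b2 sb2 b2P] := vbmap_coef (ltgt L) FL Ft.
have nz F : (F = b1 \/ F = b2) -> F g0 != 0.
  have L0 := is_frame_neq0 FL.
  case=> ->; apply: contraNneq L0 => b0.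
    by apply/eqP/lsrc_inj; rewrite (dsnbhs_self b1P) b0 scale0r.
  by apply/eqP/ltgt_inj; rewrite (dsnbhs_self b2P) b0 scale0r.
have n1 := nz _ (or_introl erefl); have n2 := nz _ (or_intror erefl).
have [c sc cP] := sm_div sb2 sb1 n1; exists c => //.
have NN : dsnbhs g0 (fun g => b1 g != 0 /\ b2 g != 0).
  by apply: filterI; exact: dsnbhs_neq0.
apply: filterS3 (filterI b1P b2P) cP NN => g [h1 h2] -> [m1 m2].
split; first by rewrite mulf_neq0// invr_eq0.
exists (in_total ((b1 g)^-1 *: Lam g)); split => //.
  by rewrite tot_src /vb_total /= /vb_total_fun /= linearZ /= h1 scalerA mulVf// scale1r.
by rewrite tot_tgt /vb_total /= /vb_total_fun /= linearZ /= h2 scalerA mulrC.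
Qed.

(** The two pull-backs lie in one fibre of the bundle over arrows. They agree iff some element there
    has the two values of theta as its source and target, which is what [act] asserts; so closedness
    under the simplicial differential is invariance. *)
Lemma partial_form_act (theta : form1 (lbg_bun0 L)) g (v : tangent g) :
  partial_form theta v = 0 <->
  act g (in_total (theta (s g) (dmap s v))) (in_total (theta (t g) (dmap t v))).
Proof.
rewrite /partial_form /form_pull; split.
  move=> /eqP; rewrite subr_eq0 => /eqP E.
  exists (in_total (linv (lsrc L g) (theta (s g) (dmap s v)))); split => //.
    by rewrite tot_src /vb_total /= /vb_total_fun /= (linv_vbmap (@lsrc_inj g)).
  by rewrite E tot_tgt /vb_total /= /vb_total_fun /= (linv_vbmap (@ltgt_inj g)).
move=> [e [/in_totalE[l ->]]]; rewrite tot_src tot_tgt.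
move=> /in_total_inj <- /in_total_inj <-; apply/eqP; rewrite subr_eq0; apply/eqP.
transitivity l; [apply: (vbmap_inj (@lsrc_inj g))|symmetry; apply: (vbmap_inj (@ltgt_inj g))].
  by rewrite (linv_vbmap (@lsrc_inj g)).
by rewrite (linv_vbmap (@ltgt_inj g)).
Qed.

End LbgAction.

(** * The contact condition as a nondegeneracy condition *)

Section Duality.
Variable R : realType.

Lemma mulmx_solvable m n (S : 'M[R]_(m, n)) (chi : 'cV[R]_m) :
  (forall u : 'rV_m, u *m S = 0 -> u *m chi = 0) -> exists y : 'cV_n, S *m y = chi.
Proof.
move=> H; have /submxP[D DE] : (chi^T <= S^T)%MS.
  rewrite submxE; apply/eqP/trmx_inj; rewrite trmx_mul trmxK trmx0.
  apply/row_matrixP => i; rewrite row_mul row0; apply: H.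
  by rewrite -row_mul -{2}[S]trmxK -trmx_mul mulmx_coker trmx0 row0.
by exists D^T; rewrite -[LHS]trmxK trmx_mul trmxK -DE trmxK.
Qed.

Definition coordinates (V : lmodType R) n (kap : V -> 'rV[R]_n) :=
  [/\ linear kap, injective kap & forall z, exists v, kap v = z].

Lemma coordinates_basis (V : lmodType R) n (kap : V -> 'rV[R]_n) : coordinates kap ->
  exists e : 'I_n -> V, (forall i, kap (e i) = delta_mx 0 i) /\
    forall v, v = \sum_i kap v 0 i *: e i.
Proof.
move=> [lk ik /choice[g gK]]; exists (fun i => g (delta_mx 0 i)); split => // v.
apply: ik; rewrite (lin_sum lk) [LHS]matrix_sum_delta big_ord1.
by apply: eq_bigr => i _; rewrite (linZ lk) gK.
Qed.

Lemma bilinear_represent (V : lmodType R) n (kap : V -> 'rV[R]_n) (Om : V -> V -> R^o) (chi : V -> R^o) :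
  coordinates kap -> (forall v, linear (Om v)) -> (forall w, linear (Om^~ w)) -> linear chi ->
  (forall v, (forall w, Om v w = 0) -> chi v = 0) -> exists y, forall u, Om u y = chi u.
Proof.
move=> ck lr ll lc H; have [e [ke ve]] := coordinates_basis ck; have [lk ik sk] := ck.
pose S : 'M[R]_n := \matrix_(i, j) Om (e i) (e j).
have Ou (u : 'rV[R]_n) j : (u *m S) 0 j = Om (\sum_i u 0 i *: e i) (e j).
  rewrite mxE (lin_sum (ll (e j))); apply: eq_bigr => i _.
  by rewrite mxE (linZ (ll (e j))).
have cu (u : 'rV[R]_n) : u *m (\col_i chi (e i)) = (chi (\sum_i u 0 i *: e i))%:M.
  apply/rowP => j; rewrite !ord1 !mxE eqxx mulr1n (lin_sum lc); apply: eq_bigr => i _.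
  by rewrite mxE (linZ lc).
have [u uS|y yP] := @mulmx_solvable n n S (\col_i chi (e i)).
  rewrite cu H ?raddf0// => w; rewrite (ve w) (lin_sum (lr _)) big1// => j _.
  by rewrite (linZ (lr _)) -Ou uS mxE scaler0.
exists (\sum_j y j 0 *: e j) => u; rewrite (ve u).
rewrite (lin_sum lc) (lin_sum (ll _)); apply: eq_bigr => i _.
rewrite (linZ lc) (linZ (ll _)); congr (_ *: _).
have := congr1 (fun z : 'cV_n => z i 0) yP; rewrite !mxE => <-.
by rewrite (lin_sum (lr _)); apply: eq_bigr => j _; rewrite (linZ (lr _)) mxE mulrC.
Qed.

(** [A] comes without a dimension. A finite family whose images under [J] have maximal rank spans
    the whole image, which reduces the claim to a solvable matrix equation. *)
Lemma functional_extension (A : lmodType R) n (J : A -> 'rV[R]_n) (om : A -> R^o) :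
  linear J -> injective J -> linear om ->
  exists y : 'cV[R]_n, forall a, (J a *m y) 0 0 = om a.
Proof.
move=> lJ iJ lo.
pose P r := `[< exists m (a : 'I_m -> A), \rank (\matrix_i J (a i)) = r >].
have exP : exists r, P r.
  by exists (\rank (\matrix_(i < 0) J 0)); apply/asboolP; exists 0%N, (fun=> 0).
have ubP r : P r -> (r <= n)%N.
  by move/asboolP => [m [a <-]]; exact: rank_leq_col.
case: (ex_maxnP exP ubP) => r /asboolP[m [a ar]] rmax.
set B := \matrix_i J (a i) in ar.
have inB b : (J b <= B)%MS.
  pose a' (i : 'I_(m + 1)) : A := match fintype.split i with inl j => a j | inr _ => b end.
  have B'E : \matrix_i J (a' i) = col_mx B (J b).
    apply/row_matrixP => i; rewrite rowK /a'; case: (splitP i) => j ij.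
      rewrite (_ : i = lshift 1 j); last exact: val_inj.
      by rewrite rowKu rowK.
    rewrite (_ : i = rshift m j); last exact: val_inj.
    by rewrite rowKd ord1; apply/rowP => l; rewrite mxE.
  have : (\rank (col_mx B (J b)) <= \rank B)%N.
    by rewrite ar; apply: rmax; apply/asboolP; exists (m + 1)%N, a'; rewrite B'E.
  rewrite -addsmxE => rk; apply: submx_trans (addsmxSr B (J b)) _.
  by rewrite -(geq_leqif (mxrank_leqif_sup (addsmxSl B (J b)))).
have JB (u : 'rV[R]_m) : u *m B = J (\sum_i u 0 i *: a i).
  rewrite mulmx_sum_row (lin_sum lJ); apply: eq_bigr => i _.
  by rewrite rowK (linZ lJ).
have oB (u : 'rV[R]_m) : (u *m (\col_i om (a i))) 0 0 = om (\sum_i u 0 i *: a i).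
  rewrite mxE (lin_sum lo); apply: eq_bigr => i _; by rewrite mxE (linZ lo).
have [u uB|y yP] := @mulmx_solvable m n B (\col_i om (a i)).
  apply/rowP => j; rewrite ord1 oB mxE -(lin0 lo); congr om; apply: iJ.
  by rewrite -JB uB (lin0 lJ).
exists y => b; have /submxP[u ub] := inB b.
by rewrite ub -mulmxA yP oB; congr om; apply: iJ; rewrite -JB ub.
Qed.

Variables (T A : lmodType R) (n : nat) (kap : T -> 'rV[R]_n) (rho : A -> T)
  (th : T -> R^o) (cc : A -> R^o) (Om : T -> T -> R^o) (eta : T -> R^o).
Hypotheses (ck : coordinates kap) (lrho : linear rho) (lth : linear th) (lcc : linear cc)
  (lOm : forall v, linear (Om v)) (Omskew : forall v w, Om v w = - Om w v) (leta : linear eta)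
  (Omrho : forall a w, Om (rho a) w = cc a * th w).

Let lOml w : linear (Om^~ w).
Proof.
move=> a u v; rewrite Omskew (lOm w) opprD (Omskew u w) (Omskew v w).
by rewrite -scalerN.
Qed.

(** Pairing [(v, r)] with [(0, 1)] in the skew form on pairs gives the first condition, pairing with
    [(w, 0)] the second. *)
Definition nullvec v (r : R) := th v = 0 /\ forall w, Om v w + r * th w = 0.

Definition nondeg := (forall a, rho a = 0 -> cc a = 0 -> a = 0) /\
  (forall v r, nullvec v r -> exists a, v = rho a /\ r = - cc a).

Let F a : R := - cc a - eta (rho a).
Let D v w : R := Om v w + eta v * th w - eta w * th v.

(** This is [bilinear_represent] for the skew form on pairs and the functional (v, r) |-> chi v + r
    chi0. The signs come from moving the representing pair to the first argument. *)
Lemma nullvec_represent (chi : T -> R^o) (chi0 : R) : linear chi ->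
  (forall v r, nullvec v r -> chi v + r * chi0 = 0) ->
  exists v r, th v = - chi0 /\ forall w, Om v w + r * th w = chi w.
Proof.
move=> lc H.
pose kap' (z : T * R^o) : 'rV[R]_(n + 1) := row_mx (kap z.1) (const_mx z.2).
have [lk ik sk] := ck.
have ck' : coordinates kap'.
  split.
  - move=> a [u r] [v r']; apply/rowP => i; rewrite [RHS]mxE [X in _ = X + _]mxE.
    case: (splitP i) => j ij.
      rewrite (_ : i = lshift 1 j); last exact: val_inj.
      by rewrite !row_mxEl lk !mxE.
    rewrite (_ : i = rshift n j); last exact: val_inj.
    by rewrite !row_mxEr !mxE.
  - move=> [u r] [v r'] /eq_row_mx[/ik /= -> /rowP/(_ ord0)].
    by rewrite !mxE => ->.
  - move=> z; have [v vz] := sk (lsubmx z); exists (v, rsubmx z 0 0).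
    rewrite /kap' /= vz -[RHS]hsubmxK; congr row_mx; apply/rowP => i.
    by rewrite ord1 mxE.
pose Om' (z z' : T * R^o) : R^o := Om z.1 z'.1 + z.2 * th z'.1 - z'.2 * th z.1.
pose chi' (z : T * R^o) : R^o := chi z.1 + z.2 * chi0.
have [||||y yP] := bilinear_represent (Om := Om') (chi := chi') ck'.
- move=> [v r] a [w q] [w' q']; rewrite /Om' /= lOm lth.
  by rewrite -!/(_ *: _ : R^o) -![_ *: _ : R^o]/(_ * _); ring.
- move=> [v r] a [w q] [w' q']; rewrite /Om' /= lOml lth.
  by rewrite -![_ *: _ : R^o]/(_ * _); ring.
- move=> a [w q] [w' q']; rewrite /chi' /= lc.
  by rewrite -![_ *: _ : R^o]/(_ * _); ring.
- move=> [v r] vr; apply: H; split => /= [|w].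
    have := vr (0, 1); rewrite /Om' /= (lin0 (lOm v)) (lin0 lth) mulr0 !add0r mul1r.
    by move/eqP; rewrite oppr_eq0 => /eqP.
  by have := vr (w, 0); rewrite /Om' /= mul0r subr0.
exists (- y.1), (- y.2); split.
  have := yP (0, 1); rewrite /Om' /chi' /= (lin0 (lOml _)) (lin0 lth) (lin0 lc) mulr0 subr0 !add0r !mul1r.
  by rewrite (linN lth) => ->.
move=> w; have := yP (w, 0); rewrite /Om' /chi' /= !mul0r !addr0 => <-.
by rewrite Omskew (linN (lOm w)) opprK mulNr.
Qed.

(** Injectivity and surjectivity on cohomology in the three degrees, with the line identified with
    R; [F] and [D] are the components of the Morita curvature for the connection form [eta]. *)
Definition qis_scalar :=
  [/\ (forall a, rho a = 0 -> F a = 0 -> a = 0) /\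
      (forall r, (forall v, r * th v = 0) -> exists2 a, rho a = 0 & - F a = r),
      (forall v, th v = 0 -> (exists r, forall w, D v w = r * th w) -> exists a, v = rho a) /\
      (forall psi : T -> R^o, linear psi -> (forall a, psi (rho a) = 0) ->
        exists2 v, th v = 0 & exists r, forall w, D v w - psi w = r * th w) &
      (forall l, (exists2 psi : T -> R^o, linear psi & forall a, F a * l = psi (rho a)) ->
        exists v, l = th v) /\
      (forall om : A -> R^o, linear om -> exists l, exists2 psi : T -> R^o, linear psi &
        forall a, F a * l - om a = psi (rho a))].

(** If [th v = 0], then [(v, r)] is null iff [D v] equals [eta v - r] times [th]: the connection
    merely shifts the multiplier. Null pairs thus encode the middle cocycles whose image is exact,
    and the surjectivity statements follow by duality. *)
Lemma nondeg_qis : nondeg <-> qis_scalar.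
Proof.
split=> [[N1 N2]|[[H0i H0s] [H1i _] _]]; last first.
  split=> [a ra ca|v r [tv Ov]].
    by apply: H0i => //; rewrite /F ra ca (lin0 leta) oppr0 addr0.
  have [|a va] := H1i v tv.
    exists (eta v - r) => w; rewrite /D tv mulr0 subr0.
    by have /eqP := Ov w; rewrite addr_eq0 => /eqP ->; ring.
  (* If [th] is nonzero, [Omrho] forces [r = - cc a]. If [th = 0], every scalar is a cocycle in the
     lowest degree, and surjectivity there yields an element of the kernel of [rho] that corrects
     [cc a]. *)
  have [[w tw]|nw] := pselect (exists w, th w != 0).
    exists a; split => //; have := Ov w; rewrite va Omrho -mulrDl => /eqP.
    by rewrite mulf_eq0 (negPf tw) orbF addrC addr_eq0 => /eqP.
  have [w|a' ra' Fa'] := H0s (- cc a - r).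
    have [->|tw] := eqVneq (th w) 0; first by rewrite mulr0.
    by case: nw; exists w.
  exists (a + a'); rewrite (linD lrho) ra' addr0; split => //.
  move: Fa'; rewrite /F ra' (lin0 leta) subr0 opprK (linD lcc) => ->; ring.
split; split.
- move=> a ra /eqP; rewrite /F ra (lin0 leta) subr0 oppr_eq0 => /eqP; exact: N1.
- move=> r Hr; have [|a [ra ar]] := N2 0 r.
    split=> [|w]; first exact: lin0 lth.
    by rewrite (lin0 (lOml w)) add0r.
  exists (- a); first by rewrite (linN lrho) -ra oppr0.
  by rewrite /F (linN lrho) -ra oppr0 (lin0 leta) subr0 (linN lcc) ar opprK.
- move=> v tv [r Hr]; have [|a [-> _]] := N2 v (eta v - r); last by exists a.
  split=> // w; have := Hr w; rewrite /D tv mulr0 subr0 => E.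
  by rewrite mulrBl -E; ring.
- move=> psi lpsi prho; have [|v [r [tv vP]]] := @nullvec_represent psi 0 lpsi.
    by move=> v r /N2[a [-> _]]; rewrite prho mulr0 addr0.
  rewrite oppr0 in tv; exists v => //; exists (eta v - r) => w.
  by rewrite /D tv mulr0 subr0 -vP; ring.
- move=> l [psi lpsi psiP].
  (* By [psiP], the functional (v, r) |-> - (l eta v + psi v) + r l vanishes on all pairs
     [(rho a, - cc a)], hence on all null pairs. *)
  have [||v [r [tv _]]] := @nullvec_represent (fun w => - (l * eta w + psi w)) l.
  + move=> a u v; rewrite leta lpsi -![_ *: _ : R^o]/(_ * _); ring.
  + move=> v r /N2[a [-> ->]]; rewrite -psiP /F; ring.
  by exists (- v); rewrite (linN lth) tv opprK.
- move=> om lom.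
  have [lk ik sk] := ck.
  (* [J] is injective by the first half of [nondeg], so [om] is a functional of [(rho a, cc a)]. Its
     part in [cc a] is absorbed by [F a * l] with [l = - y2 0 0]; what is left factors through
     [rho]. *)
  pose J a : 'rV[R]_(n + 1) := row_mx (kap (rho a)) (const_mx (cc a)).
  have lJ : linear J.
    move=> a u v; apply/rowP => i; rewrite [RHS]mxE [X in _ = X + _]mxE.
    case: (splitP i) => j ij.
      rewrite (_ : i = lshift 1 j); last exact: val_inj.
      by rewrite !row_mxEl lrho lk !mxE.
    rewrite (_ : i = rshift n j); last exact: val_inj.
    by rewrite !row_mxEr !mxE lcc.
  have iJ : injective J.
    move=> a b /eq_row_mx[/ik rab /rowP/(_ ord0)]; rewrite !mxE => cab.
    apply/eqP; rewrite -subr_eq0; apply/eqP; apply: N1.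
      by rewrite (linB lrho) rab subrr.
    by rewrite (linB lcc) cab subrr.
  have [y yP] := functional_extension lJ iJ lom.
  pose y1 := usubmx y; pose y2 := dsubmx y.
  have JE a : om a = (kap (rho a) *m y1) 0 0 + cc a * y2 0 0.
    rewrite -yP /J -[y]vsubmxK mul_row_col mxE; congr (_ + _).
    by rewrite mxE big_ord1 mxE.
  exists (- y2 0 0), (fun v => y2 0 0 * eta v - (kap v *m y1) 0 0).
    move=> a u v; rewrite leta lk mulmxDl -scalemxAl.
    by rewrite [X in _ - X]mxE [X in _ - (X + _)]mxE -![_ *: _ : R^o]/(_ * _); ring.
  by move=> a; rewrite JE /F; ring.
Qed.

End Duality.

(** * The null-vector condition along a pair of submersions *)

Section Nondegeneracy.
Variable R : realType.
Implicit Types X Y Z : diffspace R.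

(* The values at v, w of the forms sum_i f_i dg_i and sum_i df_i /\ dg_i. *)
Definition fth X (x : X) n (f g : 'I_n -> X -> R) (v : tangent x) : R^o :=
  \sum_i f i x * dd v (g i).
Definition fOm X (x : X) n (f g : 'I_n -> X -> R) (v w : tangent x) : R^o :=
  \sum_i (dd v (f i) * dd w (g i) - dd w (f i) * dd v (g i)).

Lemma fth_lin X (x : X) n (f g : 'I_n -> X -> R) : linear (fth f g : tangent x -> R^o).
Proof.
move=> a v w; rewrite /fth scaler_sumr -big_split.
by apply: eq_bigr => i _; rewrite dd_lin -[a *: _]/(a * _) /=; ring.
Qed.

Lemma fOm_lin X (x : X) n (f g : 'I_n -> X -> R) (v : tangent x) : linear (fOm f g v).
Proof.
move=> a w w'; rewrite /fOm scaler_sumr -big_split.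
by apply: eq_bigr => i _; rewrite !dd_lin -[a *: _]/(a * _) /=; ring.
Qed.

Lemma fOm_skew X (x : X) n (f g : 'I_n -> X -> R) (v w : tangent x) :
  fOm f g v w = - fOm f g w v.
Proof. by rewrite /fOm -sumrN; apply: eq_bigr => i _; ring. Qed.

Lemma fOm_linl X (x : X) n (f g : 'I_n -> X -> R) (w : tangent x) : linear ((@fOm X x n f g)^~ w).
Proof.
move=> a u v; rewrite fOm_skew (fOm_lin f g w) opprD (fOm_skew f g u w) (fOm_skew f g v w).
by rewrite -scalerN.
Qed.

Lemma fth_dmap X Z (x : X) (q : smap X Z) n (f g : 'I_n -> Z -> R) (v : tangent x) :
  (forall i, sm (g i)) -> fth f g (dmap q v) = \sum_i f i (q x) * dd v (fun y => g i (q y)).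
Proof. by move=> sg; apply: eq_bigr => i _; rewrite dd_dmap. Qed.

(* Leibniz rule for q^*theta = k q'^*theta', by [form_derivative]. *)
Lemma related_derivative X Z Z' (x : X) (q : smap X Z) (q' : smap X Z') (k : X -> R)
    n (f g : 'I_n -> Z -> R) n' (f' g' : 'I_n' -> Z' -> R) :
  lretract x -> sm k -> (forall i, sm (f i)) -> (forall i, sm (g i)) ->
  (forall i, sm (f' i)) -> (forall i, sm (g' i)) ->
  dsnbhs x (fun y => forall v : tangent y,
    fth f g (dmap q v) = k y * fth f' g' (dmap q' v)) ->
  forall v w : tangent x,
    fOm f g (dmap q v) (dmap q w) = k x * fOm f' g' (dmap q' v) (dmap q' w) +
      dd v k * fth f' g' (dmap q' w) - dd w k * fth f' g' (dmap q' v).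
Proof.
move=> [m [E [C L]]] sk sf sg sf' sg' H v w.
pose F (i : 'I_n + 'I_n') y := match i with
  inl i => f i (q y) | inr j => - (k y * f' j (q' y)) end.
pose H' (i : 'I_n + 'I_n') y := match i with inl i => g i (q y) | inr j => g' j (q' y) end.
have sF i : sm (F i).
  case: i => i; first exact: (sm_smap q (sf i)).
  by apply: sm_opp; apply: sm_mul => //; exact: (sm_smap q' (sf' i)).
have sH i : sm (H' i).
  by case: i => i; [exact: (sm_smap q (sg i))|exact: (sm_smap q' (sg' i))].
have D := form_derivative L sF sH.
have {}D : \sum_i (dd v (F i) * dd w (H' i) - dd w (F i) * dd v (H' i)) = 0.
  apply: D; apply: filterS H => y Hy u; rewrite big_sumType /=.
  have := Hy u; rewrite !fth_dmap// => ->.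
  by rewrite mulr_sumr -big_split big1// => j _ /=; ring.
move: D; rewrite big_sumType /= => /eqP; rewrite addr_eq0 => /eqP D.
transitivity (\sum_i (dd v (F (inl i)) * dd w (H' (inl i)) - dd w (F (inl i)) * dd v (H' (inl i)))).
  by apply: eq_bigr => i _; rewrite !dd_dmap.
rewrite D /fOm /fth !mulr_sumr -!sumrN -!big_split; apply: eq_bigr => j _ /=.
have sfq : sm (fun y => f' j (q' y)) := sm_smap q' (sf' j).
rewrite !dd_dmap// !(ddN _ (sm_mul sk sfq)) !(ddM _ sk sfq); ring.
Qed.

Definition fnull Z (z : Z) n (f g : 'I_n -> Z -> R) (v : tangent z) (r : R) : Prop :=
  fth f g v = 0 /\ forall w : tangent z, fOm f g v w + r * fth f g w = 0.

Lemma fnull_tcast Z (z z' : Z) (e : z = z') n (f g : 'I_n -> Z -> R) (v : tangent z) r :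
  fnull f g (tcast e v) r <-> fnull f g v r.
Proof. by case: z' / e. Qed.

Lemma dmap_eq0 X Y (f : smap X Y) (x : X) (v : tangent x) :
  dmap f v = 0 <-> forall h, sm h -> dd v (fun y => h (f y)) = 0.
Proof.
split=> [fv h sh|H]; first by rewrite -dd_dmap// fv.
by apply: tangent_ext => h sh; rewrite dd_dmap// H.
Qed.

Lemma dmapB X Y (f : smap X Y) (x : X) (v w : tangent x) : dmap f (v - w) = dmap f v - dmap f w.
Proof. by apply/val_inj. Qed.

(* The local form of the contact condition for theta = (sum f_i dg_i) lam at the
   point q(p): the vectors tangent to the fibre of pi, together with the derivative
   of the cocycle k, parametrize the null vectors of the pull-back of theta. *)
Definition nondegenerate X Z Z' (q : smap X Z) (pi : smap X Z') (p : X) (k : X -> R)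
    n (f g : 'I_n -> Z -> R) : Prop :=
  (forall W : tangent p, dmap q W = 0 -> dmap pi W = 0 -> dd W k = 0 -> W = 0) /\
  (forall (V : tangent p) r, fnull f g (dmap q V) r ->
    exists W : tangent p, [/\ dmap pi W = 0, dmap q (V - W) = 0 & r = - dd W k / k p]).

Lemma nondegenerate_swap X Z Z' (q : smap X Z) (pi : smap X Z') (p : X) (k k' : X -> R)
    n (f g : 'I_n -> Z -> R) n' (f' g' : 'I_n' -> Z' -> R) :
  lretract p -> onto_at q p -> onto_at pi p -> sm k -> sm k' -> k p != 0 ->
  dsnbhs p (fun y => k y * k' y = 1) ->
  (forall i, sm (f i)) -> (forall i, sm (g i)) ->
  (forall i, sm (f' i)) -> (forall i, sm (g' i)) ->
  dsnbhs p (fun y => forall v : tangent y,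
    fth f g (dmap q v) = k y * fth f' g' (dmap pi v)) ->
  nondegenerate q pi p k f g -> nondegenerate pi q p k' f' g'.
Proof.
(* By the Leibniz rule, a vector null for the second form with multiplier [r'] is null for the first
   with [r' - dd V k / k p]. The splitting of [V] into a part [W] killed by [pi] and a part killed
   by [q] is symmetric: exchanging the legs exchanges [W] and [V - W]. *)
move=> Lp oq opi sk sk' k0 kk' sf sg sf' sg' H [N1 N2].
have D := related_derivative Lp sk sf sg sf' sg' H.
have ddk (v : tangent p) : dd v k' = - (k' p * dd v k) / k p.
  have := dd_near v (sm_mul sk sk') (sm_cst X 1) kk'; rewrite ddM// dd_cst => /eqP.
  rewrite addr_eq0 => /eqP E; apply: (mulfI k0); rewrite E.
  by field.
have k'p : k' p = (k p)^-1 by apply: (mulfI k0); rewrite (dsnbhs_self kk') mulfV.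
split=> [W pW qW|V r' [tV OV]].
  rewrite ddk => /eqP; rewrite mulf_eq0 invr_eq0 (negPf k0) orbF oppr_eq0 k'p mulf_eq0.
  by rewrite invr_eq0 (negPf k0) => /eqP; exact: N1.
have HV (v : tangent p) := dsnbhs_self H v.
pose r := r' - dd V k / k p.
have [|W [pW qVW rW]] := N2 V r.
  split=> [|w]; first by rewrite HV tV mulr0.
  have [w' <-] := oq w; rewrite D HV tV; have := OV (dmap pi w') => /eqP.
  by rewrite addr_eq0 => /eqP ->; rewrite /r; field.
exists (V - W); split => //.
  by rewrite opprB addrC subrK.
rewrite ddk ddBv k'p; move: rW; rewrite /r => /eqP; rewrite subr_eq => /eqP ->.
by field.
Qed.

(** The map [phi] lives on a fibre only, and so has no differential on tangent vectors of [X]. A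
    vector tangent to the fibre is represented by a curve inside it, a lift of the constant curve,
    and the image curve has a velocity. *)
Lemma fibre_curve X Y X' (pi : smap X Y) (p : X) (A' : set X') (p' : X')
    (phi : smap (dsub [set a | pi a = pi p]) (dsub A')) (v : tangent p) :
  lretract p -> is_manifold Y -> onto_at pi p ->
  (forall a, sval a = p -> sval (phi a) = p') -> dmap pi v = 0 ->
  exists (c : smap (realline R) (dsub [set a | pi a = pi p])) (w : tangent p'),
    [/\ sval (c 0) = p, vel (fun e => sval (c e)) v & vel (fun e => sval (phi (c e))) w].
Proof.
move=> Lp mY opi phip v0.
have c0 : vel (scst (realline R) (pi p)) (dmap pi v).
  by move=> h sh /=; rewrite v0; exact: is_derive_cst.
have [kap [c [_ _ cp cv cpi]]] := curve_lift Lp mY opi (erefl : scst (realline R) (pi p) 0 = pi p) c0.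
have sc : @smooth R (realline R) (dsub [set a | pi a = pi p])
    (fun e => exist _ (c e) (cpi e)) by apply: smooth_sub => /=; exact: smap_smooth.
have [|w cw] := @curve_tangent R X' (smap_comp (sincl A') (smap_comp phi (Smap sc))) p'.
  exact: phip.
by exists (Smap sc), w.
Qed.

(** [al] identifies two fibres over [Z] and multiplies the function by the constant [m]. Fibre
    vectors then correspond with the same image in [Z] and the same logarithmic derivative, which is
    all the condition involves. *)
Lemma nondegenerate_transfer X X' Z Y Y' (q : smap X Z) (pi : smap X Y) (p : X) (k : X -> R)
    (q' : smap X' Z) (pi' : smap X' Y') (p' : X') (k' : X' -> R) (m : R)
    n (f g : 'I_n -> Z -> R)
    (al : smap (dsub [set a | pi a = pi p]) (dsub [set a' | pi' a' = pi' p']))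
    (be : smap (dsub [set a' | pi' a' = pi' p']) (dsub [set a | pi a = pi p])) :
  lretract p -> lretract p' -> is_manifold Y -> is_manifold Y' ->
  onto_at pi p -> onto_at pi' p' -> onto_at q p ->
  sm k -> sm k' -> m != 0 -> k p != 0 ->
  cancel al be -> cancel be al -> (forall a, sval a = p -> sval (al a) = p') ->
  (forall a, q' (sval (al a)) = q (sval a)) ->
  dsnbhs p (fun y => forall e, k' (sval (al (exist _ y e))) = m * k y) ->
  nondegenerate q pi p k f g -> nondegenerate q' pi' p' k' f g.
Proof.
move=> Lp Lp' mY mY' opi opi' oq sk sk' m0 k0 alK beK alp qal kal [N1 N2].
pose A := [set a | pi a = pi p]; pose A' := [set a' | pi' a' = pi' p'].
have bep a : sval a = p' -> sval (be a) = p.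
  move=> ap'; have := alp (exist _ p erefl) erefl => E.
  have -> : a = al (exist _ p erefl) by apply: sig_ext; rewrite E.
  by rewrite alK.
(* The last clause serves injectivity: for [c] the image under [be] of a curve with velocity [W], it
   gives [W = 0] from [v = 0]. *)
have rel (c : smap (realline R) (dsub A)) (v : tangent p) (w : tangent p') :
    sval (c 0) = p -> vel (fun e => sval (c e)) v -> vel (fun e => sval (al (c e))) w ->
    [/\ dmap pi v = 0, dmap pi' w = 0, forall h, sm h -> dd w (fun y => h (q' y)) = dd v (fun y => h (q y)),
        dd w k' = m * dd v k & (v = 0 -> w = 0)].
  move=> c0 cv cw; split.
  - apply/dmap_eq0 => h sh; have [_ <-] := cv _ (sm_smap pi sh).
    rewrite (_ : (fun e => _) = fun=> h (pi p)); first exact: derive_cst.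
    by apply/funext => e; rewrite (svalP (c e)).
  - apply/dmap_eq0 => h sh; have [_ <-] := cw _ (sm_smap pi' sh).
    rewrite (_ : (fun e => _) = fun=> h (pi' p')); first exact: derive_cst.
    by apply/funext => e; rewrite (svalP (al (c e))).
  - move=> h sh; have [_ <-] := cw _ (sm_smap q' sh); have [_ <-] := cv _ (sm_smap q sh).
    rewrite (_ : (fun e => h (q' _)) = (fun e => h (q (sval (c e)))))//.
    by apply/funext => e; rewrite qal.
  - have [_ <-] := cw _ sk'; rewrite -ddZ//; have [_ <-] := cv _ (sm_mul (sm_cst X m) sk).
    apply: near_eq_derive; apply: dsnbhs_realline.
    have : dsnbhs (sval (c 0)) (fun y => forall e, k' (sval (al (exist _ y e))) = m * k y).
      by rewrite c0.
    move=> /(smooth_near (f := smap_comp (sincl A) c) (x := 0)); apply: filterS => e /=.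
    by move=> /(_ (svalP (c e))); rewrite sval_eta.
  - move=> v0; apply: (@vel0_dsub R _ _ A (smap_comp (sincl A') al) c).
      by move=> h sh; have := cv h sh; rewrite v0.
    exact: cw.
have alp' (a : dsub A) : sval a = p -> sval (al a) = p' by exact: alp.
have kp' : k' p' = m * k p.
  rewrite -(dsnbhs_self kal erefl); congr k'; apply/esym; exact: alp.
split.
  move=> W qW pW kW.
  have [c' [v [c0 c'W c'v]]] := @fibre_curve _ _ _ pi' p' A p be W Lp' mY' opi' bep pW.
  pose c := smap_comp be c'.
  have cc' : (fun e => sval (al (c e))) = (fun e => sval (c' e)).
    by apply/funext => e; rewrite /= beK.
  have [|//||pv _ qv kv] := rel c v W; first exact: bep.
    by rewrite cc'.
  apply; apply: N1 => //.
    by apply/dmap_eq0 => h sh; rewrite -qv//; move/dmap_eq0: qW; exact.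
  by move/eqP: kv; rewrite kW eq_sym mulf_eq0 (negPf m0) => /eqP.
move=> V' r nV'.
have qq' : q' p' = q p by rewrite -[p'](alp (exist _ p erefl))// qal.
have [V VV'] := oq (tcast qq' (dmap q' V')).
have [|W [pW qVW rW]] := N2 V r; first by rewrite VV'; exact/fnull_tcast.
have [c [w [c0 cW cw]]] := @fibre_curve _ _ _ pi p A' p' al W Lp mY opi alp pW.
have [_ pw qw kw _] := rel c W w c0 cW cw.
exists w; split => //; last by rewrite kw kp' rW; field; rewrite m0 k0.
apply/dmap_eq0 => h sh; rewrite ddBv qw// -[dd V' _]dd_dmap//.
rewrite -(dd_tcast qq') -VV' dd_dmap//.
by move/dmap_eq0: qVW => /(_ h sh); rewrite ddBv.
Qed.

End Nondegeneracy.

(** * Quasi-isomorphisms in a trivialization of the line *)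

Section QuasiIsoScalar.
Variable R : realType.

Lemma mkHomE (V W : lmodType R) (f : V -> W) : linear f -> val (mkHom f) = f.
Proof. by move=> lf; rewrite /mkHom insubdK//; exact/asboolP. Qed.

Lemma hom_linear (V W : lmodType R) (f : homspace V W) : linear (val f).
Proof. exact: (asboolW (valP f)). Qed.

Lemma mkHom_eq (V W : lmodType R) (f g : V -> W) : linear f -> linear g ->
  mkHom f = mkHom g <-> forall v, f v = g v.
Proof.
move=> lf lg; split=> [fg v|fg]; last by congr mkHom; apply/funext.
by rewrite -(mkHomE lf) fg mkHomE.
Qed.

Lemma mkHom_eq0 (V W : lmodType R) (f : V -> W) : linear f ->
  mkHom f = 0 <-> forall v, f v = 0.
Proof.
move=> lf; split=> [f0 v|f0]; first by rewrite -(mkHomE lf) f0.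
by apply/val_inj; rewrite mkHomE//; apply/funext.
Qed.

Lemma linear_scale (V W : lmodType R) (psi : V -> R^o) (e : W) : linear psi ->
  linear (fun v => (psi v : R) *: e).
Proof. by move=> lp a u v; rewrite lp scalerDl -[a *: psi u]/(a * psi u) -scalerA. Qed.

Variables (T A E : lmodType R) (e : E) (co : E -> R) (rho : A -> T)
  (th : T -> R^o) (cc : A -> R^o) (Om : T -> T -> R^o) (eta : T -> R^o).
Hypotheses (e0 : e != 0) (coP : forall l, l = co l *: e)
  (lrho : linear rho) (lth : linear th) (lcc : linear cc)
  (lOm : forall v, linear (Om v)) (leta : linear eta).

Let F a : R := - cc a - eta (rho a).
Let D v w : R := Om v w + eta v * th w - eta w * th v.

Let lF : linear (F : A -> R^o).
Proof. by move=> a u v; rewrite /F lcc lrho leta -![_ *: _ : R^o]/(_ * _); ring. Qed.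

Let lD v : linear (D v : T -> R^o).
Proof. by move=> a u w; rewrite /D lOm lth leta -![_ *: _ : R^o]/(_ * _); ring. Qed.

Let scale_eq0 (a : R) : a *: e = 0 <-> a = 0.
Proof.
split=> [/eqP|->]; last exact: scale0r.
by rewrite scaler_eq0 (negPf e0) orbF => /eqP.
Qed.

Let lco (V : lmodType R) (psi : homspace V E) : linear (fun v => co (val psi v) : R^o).
Proof.
move=> a u v; apply: (scale_inj e0) => /=.
by rewrite -coP (hom_linear psi) scalerDl -[a *: co _]/(a * co _) -scalerA -!coP.
Qed.

Let lrt (r : R) : linear (fun v => r *: (th v *: e)).
Proof.
move=> a u v; rewrite lth -[a *: th u]/(a * th u) !scalerA -scalerDl.
by congr (_ *: _); ring.
Qed.

Let lFl (l : E) : linear (fun a => F a *: l).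
Proof. exact: (linear_scale _ lF). Qed.

Let lpr (psi : homspace T E) : linear (fun a => val psi (rho a)).
Proof. by move=> a u v; rewrite lrho (hom_linear psi). Qed.

Lemma quasi_iso_scalar :
  @quasi_iso R A T E R^o (homspace T E) (homspace A E) rho (fun v => th v *: e)
    (fun r => mkHom (fun v => (r : R) *: (th v *: e)))
    (fun psi => mkHom (fun a => val psi (rho a)))
    (fun a => - F a) (fun v => mkHom (fun w => D v w *: e))
    (fun l => mkHom (fun a => F a *: l)) <->
  qis_scalar rho th cc Om eta.
Proof.
have lDe v : linear (fun w => D v w *: e) by exact: (linear_scale _ (lD v)).
split.
- move=> [[H0i H0s] [H1i H1s] [H2i H2s]]; split; split.
  + move=> a ra Fa; have [||_ ->//] := H0i a => //; exists 0.
    by change (- F a = 0); rewrite /F Fa oppr0.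
  + move=> r Hr; have [|a ra [_ /eqP]] := H0s r.
      by apply/mkHom_eq0 => // v; rewrite scalerA Hr scale0r.
    by rewrite subr_eq0 => /eqP E'; exists a.
  + move=> v tv [r Hr]; apply: H1i; first by rewrite tv scale0r.
    by exists r; apply/mkHom_eq => // w; rewrite scalerA -Hr.
  + move=> psi lpsi prho; pose w := mkHom (fun v => psi v *: e) : homspace T E.
    have wE : val w = fun v => psi v *: e by apply: mkHomE; exact: linear_scale.
    have [|v tv [r /(congr1 val)]] := H1s w.
      by apply/mkHom_eq0 => // a; rewrite wE prho scale0r.
    rewrite mkHomE// => H; exists v; first exact/scale_eq0.
    exists r => z; have := congr1 (fun h => h z) H; rewrite /= -[LHS]/(val (mkHom _) z - val w z).
    by rewrite mkHomE// wE -scalerBl scalerA => /(scale_inj e0).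
  + move=> l [psi lpsi Hpsi]; have [||v vE] := H2i (l *: e) => //.
      exists (mkHom (fun v => psi v *: e)); apply/mkHom_eq => //.
      move=> a; rewrite mkHomE; last exact: linear_scale.
      by rewrite scalerA Hpsi.
    by exists v; apply: (scale_inj e0).
  + move=> om lom; have [|l _ [psi /(congr1 val) H]] := H2s (mkHom (fun a => om a *: e)) => //.
    exists (co l), (fun v => co (val psi v)); first exact: lco.
    move=> a; have := congr1 (fun h => h a) H; rewrite (mkHomE (lpr psi)).
    rewrite -[LHS]/(val (mkHom _) a - val (mkHom _) a) mkHomE// mkHomE; last exact: linear_scale.
    move=> E'; apply: (scale_inj e0); rewrite /= -coP -E' scalerBl; congr (_ - _).
    by rewrite -scalerA -coP.
- move=> [[H0i H0s] [H1i H1s] [H2i H2s]]; split; split.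
  + move=> a ra [_ Fa]; exists 0; apply: H0i => //.
    by apply/eqP; rewrite -oppr_eq0; apply/eqP.
  + move=> r /mkHom_eq0 Hr; have [v|a ra Fa] := H0s r.
      by apply/scale_eq0; rewrite -scalerA; exact: Hr.
    by exists a => //; exists 0; apply/eqP; rewrite subr_eq0; apply/eqP.
  + move=> v /scale_eq0 tv [r /mkHom_eq Hr]; apply: H1i => //; exists r => w.
    by apply: (scale_inj e0); rewrite /= -scalerA; exact: Hr.
  + move=> w /mkHom_eq0 wr; have [||v tv [r Hr]] := H1s (fun v => co (val w v)).
    * exact: lco.
    * by move=> a; apply/scale_eq0; rewrite -coP; exact: wr.
    exists v; first exact/scale_eq0.
    exists r; apply/val_inj/funext => z; rewrite (mkHomE (lrt r)).
    rewrite -[LHS]/(val (mkHom _) z - val w z) mkHomE//.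
    by rewrite [in LHS](coP (val w z)) -scalerBl Hr scalerA.
  + move=> l _ [psi /mkHom_eq Hpsi]; have [|v vE] := H2i (co l).
      exists (fun v => co (val psi v)); first exact: lco.
      by move=> a; apply: (scale_inj e0); rewrite /= -scalerA -!coP; exact: Hpsi.
    by exists v; rewrite -vE -coP.
  + move=> w _; have [|l [psi lpsi H]] := H2s (fun a => co (val w a)); first exact: lco.
    exists (l *: e) => //; exists (mkHom (fun v => psi v *: e)).
    apply/val_inj/funext => a; rewrite (mkHomE (lpr _)) mkHomE; last exact: linear_scale.
    rewrite -[LHS]/(val (mkHom _) a - val w a) mkHomE//.
    by rewrite [in LHS](coP (val w a)) scalerA -scalerBl H.
Qed.

End QuasiIsoScalar.

(** * The Morita curvature in a frame *)

Section ContactLocal.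
Variable R : realType.
Variable L : lbg R.
Local Notation G := (lbg_arr L).
Local Notation M := (lbg_ob L).
Local Notation LM := (lbg_bun0 L).
Local Notation GG := (lbg_base L).
Local Notation s := (gsrc GG).
Local Notation t := (gtgt GG).
Local Notation u := (gunit GG).

Lemma lbg_actP (g : G) (v : LM (s g)) : act g (in_total v) (in_total (lbg_act v)).
Proof.
exists (in_total (linv (lsrc L g) v)); split => //.
  by rewrite tot_src /vb_total /= /vb_total_fun /= (linv_vbmap (@lsrc_inj R L g)).
by rewrite tot_tgt.
Qed.

Definition unit_cocycle (x : M) (lam : forall y, LM y) (c : G -> R) : Prop :=
  sm c /\ dsnbhs (u x) (fun g => c g != 0 /\
    act g (in_total (lam (s g))) (in_total (c g *: lam (t g)))).

Lemma unit_cocycle_exists x lam r : is_frame x lam r -> exists c, unit_cocycle x lam c.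
Proof.
move=> F; have Fs : is_frame (s (u x)) lam r by rewrite src_unit.
have Ft : is_frame (t (u x)) lam r by rewrite tgt_unit.
by have [c sc cP] := act_coef Fs Ft; exists c.
Qed.

Variables (x : M) (lam : forall y, LM y) (r : total_space LM -> R) (c : G -> R).
Hypotheses (F : is_frame x lam r) (uc : unit_cocycle x lam c).

Lemma unit_cocycle1 : c (u x) = 1.
Proof.
have [_ /dsnbhs_self[_]] := uc; rewrite src_unit tgt_unit => A1.
have A2 := act_unit (in_total (lam x) : total_space LM).
have /in_total_inj := act_fun A1 A2; rewrite -[RHS]scale1r.
exact: (scale_inj (is_frame_neq0 F)).
Qed.

Lemma dd_anchor (a : algebroid GG x) h : sm h ->
  dd (anchor a) h = dd (val a : tangent (u x)) (fun g => h (t g)).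
Proof.
move=> sh; have -> : anchor a = tcast (tgt_unit GG x) (dmap t (val a : tangent (u x))) by [].
by rewrite dd_tcast dd_dmap.
Qed.

Lemma algebroid_src (a : algebroid GG x) : dmap s (val a : tangent (u x)) = 0.
Proof. exact: (asboolW (valP a)). Qed.

Lemma algebroid_of (v : tangent (u x)) : dmap s v = 0 -> exists a : algebroid GG x, val a = v.
Proof. by move=> v0; exists (exist _ v (asboolT v0)). Qed.

Lemma dd_val_lin h : linear (fun a : algebroid GG x => dd (val a : tangent (u x)) h : R^o).
Proof.
move=> b a a'; have E : val (b *: a + a') = b *: val a + val a' by rewrite linearP.
by rewrite E; exact: dd_lin.
Qed.

Lemma anchor_lin : linear (@anchor R G M GG x).
Proof.
move=> b a a'; apply: tangent_ext => h sh; rewrite [RHS]dd_lin.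
rewrite (dd_anchor (b *: a + a') sh) (dd_anchor a sh) (dd_anchor a' sh).
exact: dd_val_lin.
Qed.

Lemma lretract_manifold (X : diffspace R) (y : X) : is_manifold X -> lretract y.
Proof. by move=> /(manifold_lchart y)[k [E [C LC]]]; exact: lchart_lretract LC. Qed.

(** Near the unit, g^-1 acts on mu at t(g) with result w(t g) / c(g) times [lam x], and [c] is 1 at
    the unit; the formula is the derivative of this quotient. The set in [inf_action] is nonempty
    because the constant curve at [x] lifts along the source map with velocity [a]; testing with the
    coefficient functional pins down its element. *)
Lemma inf_action_val (a : algebroid GG x) (mu : forall y, LM y) (w : M -> R) :
  smooth_section mu -> sm w -> dsnbhs x (fun y => mu y = w y *: lam y) ->
  inf_action a mu = (dd (anchor a) w - w x * dd (val a : tangent (u x)) c) *: lam x.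
Proof.
move=> smu sw muw; set v := (val a : tangent (u x)); have [sc cP] := uc.
have c1 := unit_cocycle1.
have c0 : c (u x) != 0 by rewrite c1 oner_neq0.
have swt := sm_smap t sw.
have [h sh hP] := sm_div swt sc c0.
have -> : dd (anchor a) w - w x * dd v c = dd v h.
  rewrite dd_anchor//; have := dd_near v (sm_mul sc sh) swt.
  rewrite ddM// c1 mul1r (dsnbhs_self hP) tgt_unit c1 divr1 => <-.
    by rewrite addrK.
  apply: filterS2 hP (dsnbhs_neq0 sc c0) => g -> cg0.
  by rewrite mulrC divfK.
have key (g : smap (realline R) G) (cc : R -> LM x) : g 0 = u x ->
    (forall e, s (g e) = x) ->
    (forall e, in_total (lbg_act (mu (s (ginv GG (g e))))) = in_total (cc e)) ->
    nbhs (0 : R) (fun e => cc e = h (g e) *: lam x).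
  move=> g0 sg ccE; apply: dsnbhs_realline.
  have N1 : dsnbhs (u x) (fun g => mu (t g) = w (t g) *: lam (t g)).
    by apply: (smooth_near (f := t) (A := fun y => mu y = w y *: lam y)); rewrite tgt_unit.
  have : dsnbhs (g 0) (fun g => [/\ c g != 0 /\
      act g (in_total (lam (s g))) (in_total (c g *: lam (t g))),
      h g = w (t g) / c g & mu (t g) = w (t g) *: lam (t g)]).
    by rewrite g0; apply: filterS3 cP hP N1 => y; split.
  move=> /smooth_near; apply: filterS => e /= [[cg0 A1] hE mE].
  have := act_tsc (w (t (g e)) / c (g e)) (act_inv A1); rewrite !tscE scalerA divfK// -mE -hE.
  have E1 : in_total (mu (s (ginv GG (g e)))) = in_total (mu (t (g e))) by rewrite src_inv.
  rewrite -E1 => A2; have A3 := lbg_actP (mu (s (ginv GG (g e)))).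
  have := act_fun A3 A2; rewrite ccE (sg e); exact: in_total_inj.
have der (g : smap (realline R) G) (cc : R -> LM x) (phi : {linear LM x -> R^o}) : g 0 = u x ->
    (forall e, s (g e) = x) -> vel g v ->
    (forall e, in_total (lbg_act (mu (s (ginv GG (g e))))) = in_total (cc e)) ->
    is_derive (0 : R) (1 : R) ((phi : LM x -> R) \o cc) (phi (dd v h *: lam x)).
  move=> g0 sg gv ccE; have K := key g cc g0 sg ccE.
  have D := is_deriveZ (phi (lam x) : R) (gv h sh).
  rewrite linearZ /= -[dd v h *: _]/(dd v h * _) mulrC; apply: near_eq_is_derive D.
  apply: filterS K => e /= ->; rewrite linearZ /= -[h (g e) *: _]/(h (g e) * _) mulrC.
  by [].
have lr : linear (fun l : LM x => r (in_total l) : R^o).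
  by move=> b l l'; rewrite (frame_coef_lin F).
rewrite /inf_action; case: xgetP => [z _ [g [cc [g0 sg gv ccE D]]]|].
  have gv' : vel g v.
    move=> f sf; have := gv (insubd (0 : Cinf G) f); rewrite val_insubd//.
  have [_ D1] := D (lin_map lr); have [_ D2] := der g cc (lin_map lr) g0 sg gv' ccE.
  rewrite (is_frame_gen z F) [RHS](is_frame_gen _ F); congr (_ *: _).
  by rewrite -[LHS]/(lin_map lr z) -D1 -[RHS]/(lin_map lr (dd v h *: lam x)) -D2.
have vs : vel (scst (realline R) (s (u x))) (dmap s v).
  by move=> f sf /=; rewrite algebroid_src; exact: is_derive_cst.
have os : onto_at s (u x) := (src_submersion GG).2 (u x).
have [kap [g [_ _ g0 gv sg]]] := curve_lift (lretract_manifold (u x) (arr_manifold GG))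
    (ob_manifold GG) os (erefl : scst (realline R) (s (u x)) 0 = s (u x)) vs.
have sgx e : s (g e) = x by rewrite sg /= src_unit.
have /choice[cc ccP] e : exists l : LM x,
    in_total (lbg_act (mu (s (ginv GG (g e))))) = in_total l.
  by apply: in_totalE; rewrite /= tgt_inv.
move=> /(_ (dd v h *: lam x)) []; exists g, cc; split => //.
  by move=> f; rewrite ddE; apply: gv; exact: Cinf_sm.
by move=> phi; exact: (der g cc phi g0 sgx gv ccP).
Qed.

Lemma F_nabla_val nabla (a : algebroid GG x) (eta : tangent x -> R) :
  (forall (v : tangent x) mu w, smooth_section mu -> sm w -> dsnbhs x (fun y => mu y = w y *: lam y) ->
    nabla x v mu = (dd v w + w x * eta v) *: lam x) ->
  F_nabla nabla a = - dd (val a : tangent (u x)) c - eta (anchor a).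
Proof.
move=> etaP; set K := _ - _.
have K1 mu : smooth_section mu -> inf_action a mu - nabla x (anchor a) mu = K *: mu x.
  move=> smu; have [w sw muw] := smooth_section_frame F smu.
  rewrite (inf_action_val a smu sw muw) (etaP _ _ _ smu sw muw) (dsnbhs_self muw).
  by rewrite -scalerBl scalerA; congr (_ *: _); rewrite /K; ring.
rewrite /F_nabla; case: xgetP => [k _ kP|/(_ K)]; last by case.
have sl := is_frame_section F; apply: (scale_inj (is_frame_neq0 F)) => /=.
by rewrite -kP// K1.
Qed.

Variables (theta : form1 LM) (n : nat) (f g : 'I_n -> M -> R).
Hypotheses (th1 : is_form1 theta) (dth : forall g (v : tangent g), partial_form theta v = 0)
  (lf : local_form theta x lam f g).

Lemma theta_fth (v : tangent x) : theta v = fth f g v *: lam x.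
Proof. by have [_ _ /dsnbhs_self] := lf; exact. Qed.

Lemma cocycle_form : dsnbhs (u x) (fun h => forall v : tangent h,
  fth f g (dmap t v) = c h * fth f g (dmap s v)).
Proof.
have [sf sg fg] := lf; have [sc cP] := uc.
have N1 : dsnbhs (u x) (fun h => forall v : tangent (t h), theta v = fth f g v *: lam (t h)).
  apply: (smooth_near (f := t) (A := fun y => forall v : tangent y, theta v = fth f g v *: lam y)).
  by rewrite tgt_unit.
have N2 : dsnbhs (u x) (fun h => forall v : tangent (s h), theta v = fth f g v *: lam (s h)).
  apply: (smooth_near (f := s) (A := fun y => forall v : tangent y, theta v = fth f g v *: lam y)).
  by rewrite src_unit.
have N3 : dsnbhs (u x) (fun h => lam (t h) != 0).
  have : dsnbhs (t (u x)) (fun y => lam y != 0).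
    by rewrite tgt_unit; apply: filterS (is_frame_near F) => y; exact: is_frame_neq0.
  exact: smooth_near.
apply: filterS3 (filterI N1 N2) cP N3 => h [h1 h2] [c0 A1] l0 v.
have := iffLR (partial_form_act theta v) (dth v); rewrite h1 h2 => A2.
have := act_tsc (fth f g (dmap s v)) A1; rewrite !tscE => A3.
have /in_total_inj := act_fun A2 A3; rewrite scalerA => /(scale_inj l0) ->.
by rewrite mulrC.
Qed.

(** Differentiate the relation that t-pull-back equals [c] times s-pull-back, and evaluate on [a]
    and on the image of [w] under the unit map: the source kills [a], while source and target both
    send the other vector back to [w]. This is the hypothesis [Omrho] of the duality argument. *)
Lemma dtheta_anchor (a : algebroid GG x) (w : tangent x) :
  fOm f g (anchor a) w = dd (val a : tangent (u x)) c * fth f g w.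
Proof.
have [sf sg _] := lf; have [sc _] := uc.
have D := related_derivative (lretract_manifold (u x) (arr_manifold GG)) sc sf sg sf sg cocycle_form.
have := D (val a : tangent (u x)) (dmap u w).
rewrite algebroid_src (lin0 (fOm_linl f g _)) (lin0 (fth_lin f g)) !mulr0 subr0 add0r.
have tw h : sm h -> dd (dmap t (dmap u w)) h = dd w h.
  move=> sh; rewrite !dd_dmap//; last exact: (sm_smap t sh).
  by congr dd; apply/funext => y; rewrite tgt_unit.
have sw h : sm h -> dd (dmap s (dmap u w)) h = dd w h.
  move=> sh; rewrite !dd_dmap//; last exact: (sm_smap s sh).
  by congr dd; apply/funext => y; rewrite src_unit.
have -> : fth f g (dmap s (dmap u w)) = fth f g w.
  by apply: eq_bigr => i _; rewrite sw// src_unit.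
have va h : sm h -> dd (dmap t (val a : tangent (u x))) h = dd (anchor a) h.
  by move=> sh; rewrite dd_anchor// dd_dmap.
by move=> <-; apply: eq_bigr => i _; rewrite !tw// !va.
Qed.

(** For every connection the quasi-isomorphism condition amounts to the same [nondeg], so the
    existential over connections only asks that one exists. Since the target map is a submersion,
    tangent vectors at [x] can be replaced by tangent vectors of the arrows at the unit. *)
Lemma contact_nondegenerate :
  (exists2 nabla, @is_connection R M LM nabla & @morita_curvature_qis R L theta nabla x) <->
  nondegenerate t s (u x) c f g.
Proof.
have [m [E [C LC]]] := manifold_lchart x (ob_manifold GG).
have ck : coordinates (coord_vec C : tangent x -> 'rV[R]_m).
  split.
  - by move=> a v w; apply/rowP => i; rewrite !mxE.
  - by move=> v w; have [L' _] := LC; exact: lret_coord_inj L'.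
  - by move=> z; exact: lchart_coord LC.
pose cc (a : algebroid GG x) : R^o := dd (val a : tangent (u x)) c.
have lcc : linear cc := dd_val_lin c.
have lL : lretract x := lchart_lretract LC.
have qisE nabla : is_connection nabla ->
    morita_curvature_qis theta nabla x <->
    nondeg (@anchor R G M GG x) (fth f g) cc (fOm f g).
  move=> conn; have [eta [le etaP]] := conn_frame conn F.
  have -> : nondeg (@anchor R G M GG x) (fth f g) cc (fOm f g) <->
      qis_scalar (@anchor R G M GG x) (fth f g) cc (fOm f g) eta.
    apply: (nondeg_qis ck anchor_lin (fth_lin f g) lcc (fOm_lin f g) (fOm_skew f g) le).
    exact: dtheta_anchor.
  have <- := quasi_iso_scalar (is_frame_neq0 F) (fun l => is_frame_gen l F) anchor_lin
    (fth_lin f g) lcc (fOm_lin f g) le.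
  rewrite /morita_curvature_qis.
  have -> : @theta x = fun v => fth f g v *: lam x by apply/funext => v; exact: theta_fth.
  have -> : F_nabla nabla (x := x) = fun a => - cc a - eta (anchor a).
    by apply/funext => a; exact: F_nabla_val.
  have -> : d_nabla nabla theta (x := x) = fun v w => (fOm f g v w + eta v * fth f g w - eta w * fth f g v) *: lam x.
    by apply/funext => v; apply/funext => w; exact: (d_nabla_frame _ _ F th1 lL lf etaP).
  by [].
have ndE : nondeg (@anchor R G M GG x) (fth f g) cc (fOm f g) <-> nondegenerate t s (u x) c f g.
  have anE (a : algebroid GG x) v : dmap t (v : tangent (u x)) = dmap t (val a : tangent (u x)) ->
      tcast (tgt_unit GG x) (dmap t v) = anchor a by move=> ->.
  have tc0 (v : tangent (t (u x))) : tcast (tgt_unit GG x) v = 0 -> v = 0.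
    by move=> v0; apply: tangent_ext => h sh; rewrite -(dd_tcast (tgt_unit GG x)) v0.
  split=> -[N1 N2]; split.
  - move=> W tW sW cW; have [a aW] := algebroid_of sW.
    have -> : W = val (0 : algebroid GG x); last by [].
    rewrite -aW; congr val; apply: N1; last by rewrite /cc aW.
    apply: tangent_ext => h sh; rewrite dd_anchor// aW.
    by move/dmap_eq0: tW => ->.
  - move=> V q nV; have [a [va qa]] := N2 _ _ (iffRL (fnull_tcast (tgt_unit GG x) f g _ _) nV).
    exists (val a); split; first exact: algebroid_src.
      by rewrite dmapB; apply: tc0; apply: tangent_ext => h sh;
        rewrite dd_tcast ddBv -!(dd_tcast (tgt_unit GG x)) va (anE a)// subrr.
    by rewrite unit_cocycle1 divr1.
  - move=> a ra ca; apply/val_inj; apply: N1 => //; last exact: algebroid_src.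
    by apply: tc0.
  - move=> v q nv; have [_ /(_ (u x)) ot] := tgt_submersion GG.
    have [V VE] := ot (tcast (esym (tgt_unit GG x)) v).
    have vE : v = tcast (tgt_unit GG x) (dmap t V).
      by apply: tangent_ext => h sh; rewrite dd_tcast VE dd_tcast.
    have [|W [sW tVW qW]] := N2 V q; first by rewrite VE; exact/fnull_tcast.
    have [a aW] := algebroid_of sW; exists a; split; last by rewrite qW unit_cocycle1 divr1 /cc aW.
    rewrite vE; apply: anE; rewrite aW; apply/eqP; rewrite -subr_eq0 -dmapB.
    exact/eqP.
split=> [[nabla conn /(qisE _ conn)/ndE]//|/ndE N].
have sc : second_countable_dspace M by have [k []] := ob_manifold GG.
have [nabla conn] := connection_exists LM sc.
by exists nabla => //; exact/(qisE _ conn).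
Qed.

End ContactLocal.

(** * The bibundle of a Morita map *)

Section TransferIff.
Variable R : realType.
Implicit Types X Y Z : diffspace R.

Lemma dsub_near X (A : set X) (a : dsub A) (B : set (dsub A)) : dsnbhs a B ->
  dsnbhs (sval a) (fun y => forall Ay, B (exist _ y Ay)).
Proof.
move=> [phi [sphi phia phiB]]; have [g sg gP] := sm_subtype a sphi.
have ga : 0 < g (sval a) by rewrite -(dsnbhs_self gP (svalP a)) sval_eta.
by apply: filterS2 gP (dsnbhs_pos sg ga) => y Hy gy Ay; apply: phiB; rewrite Hy.
Qed.

Lemma nondegenerate_transfer_iff X X' Z Y Y' (q : smap X Z) (pi : smap X Y) (p : X) (k : X -> R)
    (q' : smap X' Z) (pi' : smap X' Y') (p' : X') (k' : X' -> R) (m : R)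
    n (f g : 'I_n -> Z -> R)
    (al : smap (dsub [set a | pi a = pi p]) (dsub [set a' | pi' a' = pi' p']))
    (be : smap (dsub [set a' | pi' a' = pi' p']) (dsub [set a | pi a = pi p])) :
  lretract p -> lretract p' -> is_manifold Y -> is_manifold Y' ->
  onto_at pi p -> onto_at pi' p' -> onto_at q p -> onto_at q' p' ->
  sm k -> sm k' -> m != 0 -> k p != 0 ->
  cancel al be -> cancel be al -> (forall a, sval a = p -> sval (al a) = p') ->
  (forall a, q' (sval (al a)) = q (sval a)) ->
  dsnbhs p (fun y => forall e, k' (sval (al (exist _ y e))) = m * k y) ->
  nondegenerate q pi p k f g <-> nondegenerate q' pi' p' k' f g.
Proof.
move=> Lp Lp' mY mY' opi opi' oq oq' sk sk' m0 k0 alK beK alp qal kal; split.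
  exact: (nondegenerate_transfer Lp Lp' mY mY' opi opi' oq sk sk' m0 k0 alK beK alp qal kal).
pose p0 : dsub [set a' | pi' a' = pi' p'] := exist _ p' erefl.
have bep a : sval a = p' -> sval (be a) = p.
  move=> ap'; have E := alp (exist _ p erefl) erefl.
  have -> : a = al (exist _ p erefl) by apply: sig_ext; rewrite E.
  by rewrite alK.
have kp' : k' p' = m * k p.
  rewrite -(dsnbhs_self kal erefl); congr k'; apply/esym; exact: alp.
apply: (@nondegenerate_transfer _ _ _ _ _ _ q' pi' p' k' q pi p k m^-1 _ _ _ be al) => //.
- by rewrite invr_eq0.
- by rewrite kp' mulf_neq0.
- by move=> a; rewrite -qal beK.
have : dsnbhs (sval (be p0)) (fun y => forall e, k' (sval (al (exist _ y e))) = m * k y).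
  by rewrite bep.
move=> /(smooth_near (f := smap_comp (sincl _) be))/dsub_near; apply: filterS => y H e.
have := H e (svalP (be (exist _ y e))); rewrite sval_eta beK /= => ->.
by rewrite mulKf.
Qed.

End TransferIff.

Section MoritaBibundle.
Variable R : realType.
Variables (L' L : lbg R) (Phi : vb_morita L' L).
Local Notation G := (lbg_arr L).
Local Notation M := (lbg_ob L).
Local Notation H := (lbg_arr L').
Local Notation N := (lbg_ob L').
Local Notation GG := (lbg_base L).
Local Notation HH := (lbg_base L').
Local Notation TG := (lbg_tot L).
Local Notation TH := (lbg_tot L').
Local Notation f := (vm_arr Phi).
Local Notation f0 := (vm_ob Phi).
Local Notation F0 := (vm_bun0 Phi).
Local Notation FT := (vb_total (vm_bun Phi)).
Local Notation FT0 := (vb_total (vm_bun0 Phi)).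
Local Notation s := (gsrc GG).
Local Notation t := (gtgt GG).

(** [vb_morita] asks for a Morita map of total spaces. Facts about the base groupoids are obtained
    by inserting zero vectors and projecting the result. *)
Definition zsec (X : diffspace R) (E : line_bundle X) : smap X (total_space E) :=
  Smap (@smooth_section0 R X E).

Lemma ff_inverse : exists k : smap (pullback_arrows TG FT0) (total_space (lbg_bun L')),
  [/\ forall e, k (ff_map (vm_tot_mor Phi) e) = e,
      forall q, gtgt TH (k q) = (sval q).1.1, forall q, gsrc TH (k q) = (sval q).1.2 &
      forall q, FT (k q) = (sval q).2].
Proof.
have [[_ [k [sk kK Kk]]] _] := vm_morita Phi.
exists (Smap sk); split=> [e|q|q|q] /=; first exact: kK.
- by have := congr1 (@proj1_sig _ _) (Kk q) => /= <-.
- by have := congr1 (@proj1_sig _ _) (Kk q) => /= <-.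
- by have := congr1 (@proj1_sig _ _) (Kk q) => /= <-.
Qed.

(** If [F0 y v = 0], the triple of [v], 0 and the zero over a unit arrow lies in the pulled-back
    arrows. The element of L' corresponding to it has zero source, hence zero target, and that
    target is [v]. *)
Lemma F0_inj y v : F0 y v = 0 -> v = 0.
Proof.
move=> Fv; have [k [_ kt ks _]] := ff_inverse.
pose e := zsec (lbg_bun L) (gunit GG (f0 y)).
have ez : isz e by exact: isz0.
have ct : gtgt TG e = FT0 (in_total v).
  rewrite [RHS](_ : _ = in_total (0 : lbg_bun0 L (f0 y))); last by rewrite -Fv.
  by apply: iszE; [exact: isz_tgt|rewrite base_tgt tgt_unit].
have cs : gsrc TG e = FT0 (in_total (0 : lbg_bun0 L' y)).
  rewrite [RHS](iszE (isz_vb F0 (isz0 _ _)) erefl).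
  by apply: iszE; [exact: isz_src|rewrite base_src src_unit].
pose q : pullback_arrows TG FT0 :=
  exist _ ((in_total v, in_total (0 : lbg_bun0 L' y)), e) (conj ct cs).
have : isz (gsrc TH (k q)) by rewrite ks; exact: isz0.
by move=> /isz_of_src /isz_tgt; rewrite kt.
Qed.

Definition bibundle : diffspace R := fibprod s f0.
Local Notation P := bibundle.

Definition arrow_of : smap P G := smap_comp (sfst G N) (sincl _).
Definition right_leg : smap P N := smap_comp (ssnd G N) (sincl _).
Definition left_leg : smap P M := smap_comp t arrow_of.
Local Notation pg := arrow_of.
Local Notation p1 := left_leg.
Local Notation p2 := right_leg.

Definition mkP (g : G) (y : N) (c : s g = f0 y) : P := exist _ (g, y) c.

Lemma bibundle_cond (p : P) : s (pg p) = f0 (p2 p).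
Proof. exact: (svalP p). Qed.

Lemma bibundle_ext (p q : P) : pg p = pg q -> p2 p = p2 q -> p = q.
Proof.
by case: p q => -[g y] c [[g' y'] c'] E1 E2; apply: sig_ext; congr (_, _).
Qed.

Lemma smooth_mkP X (a : smap X G) (b : smap X N) (c : forall x, s (a x) = f0 (b x)) :
  smooth (fun x => mkP (c x)).
Proof. by apply: smooth_sub => /=; exact: smooth_prod (smap_smooth a) (smap_smooth b). Qed.

Lemma left_leg_surj x : exists p : P, p1 p = x.
Proof.
have [_ [/(_ (zsec _ x))[q qx] _]] := vm_morita Phi.
have c : s (projT1 (sval q).1) = f0 (projT1 (sval q).2).
  by have := congr1 (@projT1 _ _) (svalP q); rewrite base_src.
exists (mkP c); have := congr1 (@projT1 _ _) qx; rewrite /= => <-.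
by rewrite base_tgt.
Qed.

Lemma right_leg_surj y : exists p : P, p2 p = y.
Proof. by exists (mkP (src_unit GG (f0 y))). Qed.

(** The vector is pushed to the zero section of the line bundle, lifted by the submersion attached
    to the total spaces, and projected back to the bibundle. *)
Lemma left_leg_onto (p : P) : onto_at p1 p.
Proof.
move=> w; have [_ [_ sub]] := vm_morita Phi.
pose e := zsec (lbg_bun L) (pg p); pose z := zsec (lbg_bun0 L') (p2 p).
have c0 : gsrc TG e = FT0 z.
  rewrite [RHS](iszE (isz_vb F0 (isz0 _ _)) erefl).
  by apply: iszE; [apply: isz_src; exact: isz0|rewrite base_src; exact: bibundle_cond].
pose tp : fibprod (gsrc TG) FT0 := exist _ (e, z) c0.
have te : zsec (lbg_bun0 L) (p1 p) = ess_map TG FT0 tp.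
  by apply/esym; apply: iszE; [apply: isz_tgt; exact: isz0|rewrite /= base_tgt].
have [V VE] := sub tp (tcast te (dmap (zsec _) w)).
have cQ (q : fibprod (gsrc TG) FT0) : s (sproj _ (sval q).1) = f0 (sproj _ (sval q).2).
  by have := congr1 (@projT1 _ _) (svalP q); rewrite base_src.
pose Q := Smap (smooth_mkP (a := smap_comp (sproj _) (smap_comp (sfst _ _) (sincl _)))
  (b := smap_comp (sproj _) (smap_comp (ssnd _ _) (sincl _))) cQ).
have Qp : Q tp = p by exact: bibundle_ext.
exists (tcast Qp (dmap Q V)); apply: tangent_ext => h sh.
have shp := sm_smap p1 sh; have shs := sm_smap (sproj (lbg_bun0 L)) sh.
rewrite dd_dmap// dd_tcast dd_dmap//.
transitivity (dd V (fun q => (fun z => h (sproj (lbg_bun0 L) z)) (ess_map TG FT0 q))).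
  by congr dd; apply/funext => q /=; rewrite base_tgt.
by rewrite -(dd_dmap (ess_map TG FT0) V shs) VE dd_tcast dd_dmap.
Qed.

Lemma bibundle_lretract (p : P) : lretract p.
Proof.
apply: lretract_fibprod; last exact: (src_submersion GG).2.
- exact: lretract_manifold (arr_manifold GG).
- exact: lretract_manifold (ob_manifold HH).
- exact: ob_manifold GG.
Qed.

(** Compatible vectors on the two factors come from one vector of the fibre product: a curve with
    velocity [w] is mapped by [f0], then lifted along the source submersion with velocity [v]. *)
Lemma bibundle_curve (p : P) (v : tangent (pg p)) (w : tangent (p2 p)) :
  (forall h, sm h -> dd v (fun g => h (s g)) = dd w (fun y => h (f0 y))) ->
  exists V : tangent p, (forall h, sm h -> dd V (fun q => h (pg q)) = dd v h) /\
    (forall h, sm h -> dd V (fun q => h (p2 q)) = dd w h).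
Proof.
move=> vw; have [k [E [C LC]]] := lretract_manifold (p2 p) (ob_manifold HH).
have [b b0 bw] := lret_curve w LC.
have c0 : (smap_comp f0 b) 0 = s (pg p) by rewrite /= b0 bibundle_cond.
have cv : vel (smap_comp f0 b) (dmap s v).
  by move=> h sh; rewrite dd_dmap// vw//; exact: bw (sm_smap f0 sh).
have [kap [a [k0 kid a0 av sa]]] := curve_lift (lretract_manifold (pg p) (arr_manifold GG))
  (ob_manifold GG) ((src_submersion GG).2 (pg p)) c0 cv.
pose cP := Smap (smooth_mkP (a := a) (b := smap_comp b kap) sa).
have [|V cV] := @curve_tangent R P cP p.
  by apply: bibundle_ext => //=; rewrite k0 b0.
exists V; split=> h sh.
  by have [_ <-] := cV _ (sm_smap pg sh); have [_ <-] := av h sh.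
have [_ <-] := cV _ (sm_smap p2 sh); have [_ <-] := bw h sh.
by apply: near_eq_derive; apply: filterS kid => e /= ->.
Qed.

Lemma right_leg_onto (p : P) : onto_at p2 p.
Proof.
move=> w; have [v vE] := (src_submersion GG).2 (pg p) (tcast (esym (bibundle_cond p)) (dmap f0 w)).
have [|V [_ Vw]] := @bibundle_curve p v w.
  by move=> h sh; rewrite -dd_dmap// vE dd_tcast dd_dmap.
by exists V; apply: tangent_ext => h sh; rewrite dd_dmap// Vw.
Qed.

Lemma base_ff : exists K : smap (pullback_arrows GG f0) H,
  [/\ forall q, gtgt HH (K q) = (sval q).1.1, forall q, gsrc HH (K q) = (sval q).1.2,
      forall q, f (K q) = (sval q).2 &
      forall h h', gtgt HH h = gtgt HH h' -> gsrc HH h = gsrc HH h' -> f h = f h' -> h = h'].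
Proof.
have [k [kK kt ks kf]] := ff_inverse.
pose z (q : pullback_arrows GG f0) := ((zsec (lbg_bun0 L') (sval q).1.1,
  zsec (lbg_bun0 L') (sval q).1.2), zsec (lbg_bun L) (sval q).2).
have cz (q : pullback_arrows GG f0) :
    gtgt TG (z q).2 = FT0 (z q).1.1 /\ gsrc TG (z q).2 = FT0 (z q).1.2.
  have [ct cs] := svalP q; split.
    rewrite [RHS](iszE (isz_vb F0 (isz0 _ _)) erefl); apply: iszE; last by rewrite base_tgt; exact: ct.
    by apply: isz_tgt; exact: isz0.
  rewrite [RHS](iszE (isz_vb F0 (isz0 _ _)) erefl); apply: iszE; last by rewrite base_src; exact: cs.
  by apply: isz_src; exact: isz0.
have sz : smooth (fun q => exist _ (z q) (cz q) : pullback_arrows TG FT0).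
  apply: smooth_sub => /=.
  pose i1 : smap (pullback_arrows GG f0) (dprod (dprod N N) G) := sincl _.
  exact: (smap_smooth (spair (spair
    (smap_comp (zsec _) (smap_comp (sfst N N) (smap_comp (sfst _ _) i1)))
    (smap_comp (zsec _) (smap_comp (ssnd N N) (smap_comp (sfst _ _) i1))))
    (smap_comp (zsec _) (smap_comp (ssnd _ _) i1)))).
exists (smap_comp (sproj _) (smap_comp k (Smap sz))); split.
- by move=> q; rewrite /= -base_tgt kt.
- by move=> q; rewrite /= -base_src ks.
- by move=> q; have := congr1 (@projT1 _ _) (kf (exist _ (z q) (cz q))).
move=> h h' et es ef.
suff : zsec (lbg_bun L') h = zsec (lbg_bun L') h' by move=> /(congr1 (@projT1 _ _)).
rewrite -[LHS]kK -[RHS]kK; congr (k _); apply: sig_ext.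
pose zf3 h1 := (gtgt TH (zsec (lbg_bun L') h1), gsrc TH (zsec (lbg_bun L') h1), FT (zsec _ h1)).
change (zf3 h = zf3 h').
have zt (h1 : H) : gtgt TH (zsec _ h1) = in_total (0 : lbg_bun0 L' (gtgt HH h1)).
  by apply: iszE; [apply: isz_tgt; exact: isz0|rewrite base_tgt].
have zs (h1 : H) : gsrc TH (zsec _ h1) = in_total (0 : lbg_bun0 L' (gsrc HH h1)).
  by apply: iszE; [apply: isz_src; exact: isz0|rewrite base_src].
have zf (h1 : H) : FT (zsec _ h1) = in_total (0 : lbg_bun L (f h1)).
  by apply: iszE => //; apply: isz_vb; exact: isz0.
by rewrite /zf3 !zt !zs !zf et es ef.
Qed.

Lemma act_morphism h z z' : act h z z' -> act (f h) (FT0 z) (FT0 z').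
Proof.
move=> [e [eh es et]]; exists (FT e); split; first by rewrite -eh.
  by rewrite (mor_src (vm_tot_mor Phi)) es.
by rewrite (mor_tgt (vm_tot_mor Phi)) et.
Qed.

Lemma bibundle_coef (p : P) lam r lam' r' :
  @is_frame R _ (lbg_bun0 L) (p1 p) lam r -> @is_frame R _ (lbg_bun0 L') (p2 p) lam' r' ->
  exists2 k, sm k & dsnbhs p (fun q => k q != 0 /\
    act (pg q) (FT0 (in_total (lam' (p2 q)))) (in_total (k q *: lam (p1 q)))).
Proof.
move=> F F'; have [lams [rs Fs]] := frame_exists (lbg_bun0 L) (s (pg p)).
have [c sc cP] := act_coef Fs (F : is_frame (t (pg p)) lam r).
have Fs' : is_frame (f0 (p2 p)) lams rs by rewrite -bibundle_cond.
have [b sb bP] := vbmap_coef F0 F' Fs'.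
have b0 : b (p2 p) != 0.
  apply: contraNneq (is_frame_neq0 F') => b0; apply/eqP/F0_inj.
  by rewrite (dsnbhs_self bP) b0 scale0r.
exists (fun q => b (p2 q) * c (pg q)).
  by apply: sm_mul; [exact: sm_smap sb|exact: sm_smap sc].
apply: filterS3 (smooth_near (f := pg) cP) (smooth_near (f := p2) bP)
  (smooth_near (f := p2) (dsnbhs_neq0 sb b0)) => q [c0 A1] bE bn0.
split; first exact: mulf_neq0.
rewrite /vb_total /= /vb_total_fun /= [F0 _ _]bE -scalerA -tscE -[in_total (b _ *: _)]tscE.
have -> : in_total (lams (f0 (p2 q))) = in_total (lams (s (pg q))) by rewrite bibundle_cond.
exact: act_tsc.
Qed.

End MoritaBibundle.

(** * The contact condition at the two ends of the bibundle *)

Section ContactTransfer.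
Variable R : realType.

Lemma dsub_map_subproof (X Y : diffspace R) (A : set Y) (a : smap X Y) (h : forall x, A (a x)) :
  @smooth R X (dsub A) (fun x => exist _ (a x) (h x)).
Proof. by apply: smooth_sub => /=; exact: smap_smooth. Qed.

Definition dsub_map (X Y : diffspace R) (A : set Y) (a : smap X Y) (h : forall x, A (a x)) :
  smap X (dsub A) := Smap (dsub_map_subproof h).

Variables (L' L : lbg R) (Phi : vb_morita L' L).
Local Notation G := (lbg_arr L).
Local Notation M := (lbg_ob L).
Local Notation H := (lbg_arr L').
Local Notation N := (lbg_ob L').
Local Notation GG := (lbg_base L).
Local Notation HH := (lbg_base L').
Local Notation f := (vm_arr Phi).
Local Notation f0 := (vm_ob Phi).
Local Notation FT0 := (vb_total (vm_bun0 Phi)).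
Local Notation s := (gsrc GG).
Local Notation t := (gtgt GG).
Local Notation u := (gunit GG).
Local Notation P := (bibundle Phi).
Local Notation pg := (arrow_of Phi).
Local Notation p1 := (left_leg Phi).
Local Notation p2 := (right_leg Phi).

(** The pull-backs to the bibundle along the two legs agree through the action. Stated as a
    relation, it applies alike to a pulled-back form and to a descended one. *)
Definition related (theta : form1 (lbg_bun0 L)) (theta' : form1 (lbg_bun0 L')) : Prop :=
  forall (p : P) (W : tangent p),
    act (pg p) (FT0 (in_total (theta' (p2 p) (dmap p2 W)))) (in_total (theta (p1 p) (dmap p1 W))).

Definition is_coef (p : P) (lam : forall y, lbg_bun0 L y) (lam' : forall y, lbg_bun0 L' y)
    (k : P -> R) : Prop :=
  sm k /\ dsnbhs p (fun q => k q != 0 /\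
    act (pg q) (FT0 (in_total (lam' (p2 q)))) (in_total (k q *: lam (p1 q)))).

Lemma related_fth theta theta' (p : P) lam r lam' k n (a b : 'I_n -> M -> R)
    n' (a' b' : 'I_n' -> N -> R) :
  related theta theta' -> is_frame (p1 p) lam r -> is_coef p lam lam' k ->
  local_form theta (p1 p) lam a b -> local_form theta' (p2 p) lam' a' b' ->
  dsnbhs p (fun q => forall v : tangent q,
    fth a b (dmap p1 v) = k q * fth a' b' (dmap p2 v)).
Proof.
move=> rel F [sk kP] [_ _ lf] [_ _ lf'].
have N1 := smooth_near (f := p1) (x := p) lf.
have N2 := smooth_near (f := p2) (x := p) lf'.
have N3 := smooth_near (f := p1) (x := p) (is_frame_near F).
apply: filterS3 (filterI N1 N2) kP N3 => q [h1 h2] [k0 A1] F1 v.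
have := rel q v; rewrite h1 h2 => A2.
have := act_tsc (fth a' b' (dmap p2 v)) A1; rewrite -vb_tsc !tscE => A3.
have /in_total_inj := act_fun A2 A3; rewrite scalerA => /(scale_inj (is_frame_neq0 F1)) E.
by apply: (etrans E); exact: mulrC.
Qed.

(** Multiplying the arrow of [p] on the left by [g] identifies the source fibre through the unit at
    [x] with the right-leg fibre through [p], and takes [k] to [k p] times [c g] near the unit. *)
Lemma left_transfer (p : P) lam r lam' k c n (a b : 'I_n -> M -> R) :
  is_frame (p1 p) lam r -> is_coef p lam lam' k -> unit_cocycle (p1 p) lam c ->
  nondegenerate t s (u (p1 p)) c a b <-> nondegenerate p1 p2 p k a b.
Proof.
move=> F [sk kP] uc; have [sc cP] := uc; set x := p1 p in F uc cP *.
pose A := [set g | s g = s (u x)]; pose A' := [set q : P | p2 q = p2 p].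
have cA (g : dsub A) : s (sval g) = t (pg p) by rewrite (svalP g) src_unit.
have cA' (q : dsub A') : s (pg (sval q)) = s (pg p).
  by rewrite !bibundle_cond (svalP q).
have cA'' (q : dsub A') : s (pg (sval q)) = t (ginv GG (pg p)) by rewrite tgt_inv.
have c1 (g : dsub A) : s (gmd GG (sval g) (pg p)) = f0 (p2 p).
  by rewrite src_gmd// bibundle_cond.
pose mul1 := Smap (@smooth_gmd R _ _ GG _ (sincl A) (scst _ (pg p)) cA).
pose al0 := Smap (@smooth_mkP _ _ _ Phi _ mul1 (scst _ (p2 p)) c1).
pose al : smap (dsub A) (dsub A') := @dsub_map _ _ A' al0 (fun=> erefl).
pose be0 := Smap (@smooth_gmd R _ _ GG _ (smap_comp pg (sincl A')) (scst _ (ginv GG (pg p))) cA'').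
have beA (q : dsub A') : A (be0 q).
  change (s (gmd GG (pg (sval q)) (ginv GG (pg p))) = s (u x)).
  by rewrite src_gmd ?src_inv ?src_unit//; exact: cA''.
pose be : smap (dsub A') (dsub A) := dsub_map beA.
have k0 : k p != 0 by have [] := dsnbhs_self kP.
have c1u := unit_cocycle1 F uc.
apply: (@nondegenerate_transfer_iff _ _ _ _ _ _ t s (u x) c p1 p2 p k (k p) _ _ _ al be) => //.
- exact: lretract_manifold (arr_manifold GG).
- exact: bibundle_lretract.
- exact: ob_manifold GG.
- exact: ob_manifold HH.
- exact: (src_submersion GG).2.
- exact: right_leg_onto.
- exact: (tgt_submersion GG).2.
- exact: left_leg_onto.
- by rewrite c1u oner_neq0.
- by move=> g; apply: sig_ext; exact: (gmdK (cA g)).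
- by move=> q; apply: sig_ext; apply: bibundle_ext; [exact: (gmdVK (cA' q))|exact: esym (svalP q)].
- move=> g gE; apply: bibundle_ext => //=; rewrite gE; exact: gmd1g.
- by move=> g; exact: (tgt_gmd (cA g)).
have alu : sval (al (exist _ (u x) erefl)) = p.
  by apply: bibundle_ext => //=; exact: gmd1g.
have := @smooth_near _ _ _ (smap_comp (sincl A') al) (exist _ (u x) erefl) _.
rewrite [smap_comp _ _ _]alu => /(_ _ kP) /dsub_near /= N1.
have N2 : dsnbhs (u x) (fun g => lam (t g) != 0).
  have : dsnbhs (t (u x)) (fun y => lam y != 0).
    by rewrite tgt_unit; apply: filterS (is_frame_near F) => y; exact: is_frame_neq0.
  exact: smooth_near.
apply: filterS3 N1 cP N2 => g H1 [c0 A1] l0 e.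
have [_ A2] := H1 e; have [_ A3] := dsnbhs_self kP.
have sg : s g = x by rewrite [s g]e src_unit.
rewrite sg in A1; have := act_gmd A3 (act_tsc (k p) A1); rewrite tscE scalerA => A4.
have E : t (gmd GG g (sval p).1) = t g by exact: tgt_gmd.
rewrite E in A2; have /in_total_inj := act_fun A2 A4; exact: scale_inj.
Qed.

(** Acting by inverses of arrows of H identifies the source fibre through the unit at [y] with the
    left-leg fibre through [p]. For the way back, the quotient of the arrows of [q] and [p] is an
    arrow of G between points in the image of [f0], which full faithfulness turns into an arrow of
    H. Along this, [k'] becomes [c'] divided by [k p]. *)
Lemma right_transfer (p : P) lam lam' r' k k' c' n (a b : 'I_n -> N -> R) :
  @is_frame R _ (lbg_bun0 L') (p2 p) lam' r' -> lam (p1 p) != 0 ->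
  is_coef p lam lam' k -> sm k' -> dsnbhs p (fun q => k q * k' q = 1) ->
  @unit_cocycle R L' (p2 p) lam' c' ->
  nondegenerate (gtgt HH) (gsrc HH) (gunit HH (p2 p)) c' a b <-> nondegenerate p2 p1 p k' a b.
Proof.
move=> F' l0 [sk kP] sk' kk' uc; have [sc cP] := uc; set y := p2 p in F' uc cP *.
have [K [Kt Ks Kf Kinj]] := base_ff Phi.
pose A := [set h | gsrc HH h = gsrc HH (gunit HH y)]; pose A' := [set q : P | p1 q = p1 p].
have mb := vm_base_mor Phi.
have sA (h : dsub A) : gsrc HH (sval h) = y by rewrite (svalP h) src_unit.
have cA (h : dsub A) : s (pg p) = t (ginv GG (f (sval h))).
  by rewrite tgt_inv (mor_src mb) sA bibundle_cond.
have c1 (h : dsub A) : s (gmd GG (pg p) (ginv GG (f (sval h)))) = f0 (gtgt HH (sval h)).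
  by rewrite src_gmd// src_inv (mor_tgt mb).
pose mul1 := Smap (@smooth_gmd R _ _ GG _ (scst _ (pg p))
  (smap_comp (ginv GG) (smap_comp f (sincl A))) cA).
pose al0 := Smap (@smooth_mkP _ _ _ Phi _ mul1 (smap_comp (gtgt HH) (sincl A)) c1).
have alA h : A' (al0 h) by exact: (tgt_gmd (cA h)).
pose al : smap (dsub A) (dsub A') := @dsub_map _ _ A' al0 alA.
have cA' (q : dsub A') : t (pg (sval q)) = t (pg p) by exact: (svalP q).
have cA'' (q : dsub A') : s (ginv GG (pg (sval q))) = t (pg p) by rewrite src_inv.
pose div := Smap (@smooth_gmd R _ _ GG _ (smap_comp (ginv GG) (smap_comp pg (sincl A')))
  (scst _ (pg p)) cA'').
have dt (q : dsub A') : t (div q) = f0 (p2 (sval q)).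
  by rewrite [LHS](tgt_gmd (cA'' q)) tgt_inv bibundle_cond.
have ds (q : dsub A') : s (div q) = f0 y.
  by rewrite [LHS](src_gmd (cA'' q)) [LHS]bibundle_cond.
pose be0 := smap_comp K (@dsub_map _ (dprod (dprod N N) G)
  [set q | t q.2 = f0 q.1.1 /\ s q.2 = f0 q.1.2]
  (spair (spair (smap_comp p2 (sincl A')) (scst _ y)) div) (fun q => conj (dt q) (ds q))).
have beA q : A (be0 q) by rewrite /A /= Ks src_unit.
pose be : smap (dsub A') (dsub A) := dsub_map beA.
have k0 : k p != 0 by have [] := dsnbhs_self kP.
have c1u := unit_cocycle1 F' uc.
have fal (h : dsub A) : gmd GG (ginv GG (gmd GG (pg p) (ginv GG (f (sval h))))) (pg p) = f (sval h).
  have c := cA h; set g := pg p in c *; set i := ginv GG _ in c *.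
  have ci : s (ginv GG (gmd GG g i)) = t g by rewrite src_inv tgt_gmd.
  have gE : g = gmd GG (gmd GG g i) (f (sval h)).
    by rewrite gmdVK// /g (mor_src mb) sA bibundle_cond.
  rewrite {2}gE -gmdA; first by rewrite gmdVg src_gmd// src_inv gmd1g.
    by rewrite src_inv.
  by rewrite src_gmd// src_inv.
apply: (@nondegenerate_transfer_iff _ _ _ _ _ _ (gtgt HH) (gsrc HH) (gunit HH y) c' p2 p1 p k'
  (k p)^-1 _ _ _ al be) => //.
- exact: lretract_manifold (arr_manifold HH).
- exact: bibundle_lretract.
- exact: ob_manifold HH.
- exact: ob_manifold GG.
- exact: (src_submersion HH).2.
- exact: left_leg_onto.
- exact: (tgt_submersion HH).2.
- exact: right_leg_onto.
- by rewrite invr_eq0.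
- by rewrite c1u oner_neq0.
- move=> h; apply: sig_ext; apply: Kinj; first exact: Kt.
    by rewrite [LHS]Ks /= sA.
  by rewrite [LHS]Kf; exact: fal.
- move=> q; apply: sig_ext; apply: bibundle_ext; last exact: Kt.
  rewrite /= Kf /= -[LHS]/(gmd GG (pg p) (ginv GG (div q))).
  have E : gmd GG (pg (sval q)) (div q) = pg p.
    rewrite -[div q]/(gmd GG (ginv GG (pg (sval q))) (pg p)) -gmdA ?tgt_inv//.
    by rewrite gmdgV cA' gmd1g.
  rewrite -{1}E gmdK//; rewrite -[div q]/(gmd GG (ginv GG (pg (sval q))) (pg p)).
  by rewrite tgt_gmd// tgt_inv.
- move=> h hE; apply: bibundle_ext => /=; rewrite hE ?tgt_unit//.
  rewrite (mor_unit mb) ginv_unit /y -bibundle_cond; exact: gmdg1.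
have alu : sval (al (exist _ (gunit HH y) erefl)) = p.
  apply: bibundle_ext; last exact: tgt_unit.
  rewrite /= (mor_unit mb) ginv_unit /y -bibundle_cond; exact: gmdg1.
have := @smooth_near _ _ _ (smap_comp (sincl A') al) (exist _ (gunit HH y) erefl) _.
rewrite [smap_comp _ _ _]alu => /(_ _ (filterI kP kk')) /dsub_near N1.
apply: filterS2 N1 cP => h H1 [c0 A1] e.
have [[kn A2] kk1] := H1 e; have [_ A3] := dsnbhs_self kP.
set q := (X in k X) in kn A2 kk1.
have sh : gsrc HH h = y by rewrite [gsrc HH h]e src_unit.
rewrite sh in A1; have A4 := act_gmd (act_inv (act_morphism Phi A1)) A3.
have := act_tsc (c' h) A2; rewrite -vb_tsc !tscE scalerA => A5.
have E : t (pg q) = t (pg p) by exact: (tgt_gmd (cA (exist _ h e))).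
have {}A5 : act (gmd GG (pg p) (ginv GG (f h))) (FT0 (in_total (c' h *: lam' (gtgt HH h))))
    (in_total ((c' h * k q) *: lam (p1 p))).
  by move: A5; rewrite -[p1 q]/(t (pg q)) E.
have /in_total_inj/(scale_inj l0) E2 := act_fun A4 A5.
apply: (mulfI kn); rewrite [LHS]kk1 E2; field.
by rewrite kn -[c' h]/(c' h) c0.
Qed.

Lemma contact_transfer (p : P) theta theta' : is_form1 theta -> is_form1 theta' ->
  (forall g (v : tangent g), partial_form theta v = 0) ->
  (forall h (v : tangent h), partial_form theta' v = 0) -> related theta theta' ->
  (exists2 nabla, @is_connection R M (lbg_bun0 L) nabla & @morita_curvature_qis R L theta nabla (p1 p)) <->
  (exists2 nabla, @is_connection R N (lbg_bun0 L') nabla & @morita_curvature_qis R L' theta' nabla (p2 p)).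
Proof.
move=> th1 th1' dth dth' rel.
have [lam [r F]] := frame_exists (lbg_bun0 L) (p1 p).
have [lam' [r' F']] := frame_exists (lbg_bun0 L') (p2 p).
have [c uc] := unit_cocycle_exists F; have [c' uc'] := unit_cocycle_exists F'.
have [k sk kP] := bibundle_coef F F'.
have lM := lretract_manifold (p1 p) (ob_manifold GG).
have lN := lretract_manifold (p2 p) (ob_manifold HH).
have [n [a [b lf]]] := local_form_exists th1 lM F.
have [n' [a' [b' lf']]] := local_form_exists th1' lN F'.
have k0 : k p != 0 by have [] := dsnbhs_self kP.
have [k' sk' k'P] := sm_div (sm_cst P 1) sk k0.
have kk' : dsnbhs p (fun q => k q * k' q = 1).
  by apply: filterS2 kP k'P => q [kq _] ->; rewrite mul1r mulfV.
have k'k : dsnbhs p (fun q => k' q * k q = 1).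
  by apply: filterS kk' => q; rewrite mulrC.
have k'0 : k' p != 0.
  by apply/eqP => E; have /eqP := dsnbhs_self kk'; rewrite E mulr0 eq_sym oner_eq0.
have ck : is_coef p lam lam' k by split.
have N1 := related_fth rel F ck lf lf'.
have N2 : dsnbhs p (fun q => forall v : tangent q,
    fth a' b' (dmap p2 v) = k' q * fth a b (dmap p1 v)).
  by apply: filterS2 N1 k'k => q H1 kq v; rewrite H1 mulrA kq mul1r.
rewrite (contact_nondegenerate F uc th1 dth lf) (contact_nondegenerate F' uc' th1' dth' lf').
rewrite (left_transfer a b F ck uc).
rewrite (right_transfer a' b' F' (is_frame_neq0 F) ck sk' kk' uc').
have [sa sb _] := lf; have [sa' sb' _] := lf'.
split; apply: nondegenerate_swap => //; try exact: bibundle_lretract;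
  try exact: left_leg_onto; exact: right_leg_onto.
Qed.

Lemma contact0_related theta theta' : is_form1 theta -> is_form1 theta' ->
  (forall g (v : tangent g), partial_form theta v = 0) ->
  (forall h (v : tangent h), partial_form theta' v = 0) -> related theta theta' ->
  contact0 theta <-> contact0 theta'.
Proof.
move=> th1 th1' dth dth' rel; split=> -[_ _ H]; split => // x.
  have [p <-] := right_leg_surj Phi x.
  exact: (iffLR (contact_transfer p th1 th1' dth dth' rel) (H (p1 p))).
have [p <-] := left_leg_surj Phi x.
exact: (iffRL (contact_transfer p th1 th1' dth dth' rel) (H (p2 p))).
Qed.

End ContactTransfer.

(** * Pull-back and descent of forms *)

Section Descent.
Variable R : realType.

Lemma form_total_eq (X : diffspace R) (E : line_bundle X) (theta : form1 E) (x x' : X)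
    (v : tangent x) (v' : tangent x') : x = x' -> (forall h, sm h -> dd v h = dd v' h) ->
  in_total (theta x v) = in_total (theta x' v').
Proof. by move=> e; case: x' / e v' => v' H; rewrite (tangent_ext H). Qed.

Variables (L' L : lbg R) (Phi : vb_morita L' L).
Local Notation G := (lbg_arr L).
Local Notation M := (lbg_ob L).
Local Notation H := (lbg_arr L').
Local Notation N := (lbg_ob L').
Local Notation LM := (lbg_bun0 L).
Local Notation LN := (lbg_bun0 L').
Local Notation GG := (lbg_base L).
Local Notation HH := (lbg_base L').
Local Notation f := (vm_arr Phi).
Local Notation f0 := (vm_ob Phi).
Local Notation F0 := (vm_bun0 Phi).
Local Notation FT0 := (vb_total (vm_bun0 Phi)).
Local Notation s := (gsrc GG).
Local Notation t := (gtgt GG).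
Local Notation u := (gunit GG).
Local Notation P := (bibundle Phi).
Local Notation pg := (arrow_of Phi).
Local Notation p1 := (left_leg Phi).
Local Notation p2 := (right_leg Phi).

Lemma form_pullE (theta : form1 LM) y (w : tangent y) :
  F0 y (form_pull F0 theta w) = theta (f0 y) (dmap f0 w).
Proof. exact: (linv_vbmap (@F0_inj R L' L Phi y)). Qed.

Lemma FT0_form_pull (theta : form1 LM) y (w : tangent y) :
  FT0 (in_total (form_pull F0 theta w)) = in_total (theta (f0 y) (dmap f0 w)).
Proof. by rewrite /vb_total /= /vb_total_fun /= form_pullE. Qed.

Lemma form_pull_related (theta : form1 LM) :
  (forall g (v : tangent g), partial_form theta v = 0) -> related Phi theta (form_pull F0 theta).
Proof.
move=> dth p W; rewrite FT0_form_pull.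
have := iffLR (partial_form_act theta (dmap pg W)) (dth _ _).
have -> : in_total (theta (s (pg p)) (dmap s (dmap pg W))) =
    in_total (theta (f0 (p2 p)) (dmap f0 (dmap p2 W))).
  apply: form_total_eq => [|h sh]; first exact: bibundle_cond.
  rewrite !dd_dmap//; [|exact: (sm_smap f0 sh)|exact: (sm_smap s sh)].
  by congr dd; apply/funext => q; rewrite bibundle_cond.
have -> // : in_total (theta (t (pg p)) (dmap t (dmap pg W))) = in_total (theta (p1 p) (dmap p1 W)).
by apply: form_total_eq => // h sh; rewrite !dd_dmap//; exact: (sm_smap t sh).
Qed.

Lemma form_pull_form1 (theta : form1 LM) : is_form1 theta -> is_form1 (form_pull F0 theta).
Proof.
move=> th1; have [lt _] := th1; apply: local_form_is_form1.
  move=> y a v w; apply: (vbmap_inj (@F0_inj R L' L Phi y)).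
  by rewrite linearP !form_pullE dmapL lt.
move=> y; have [lam' [r' F']] := frame_exists LN y; have [lam [r F]] := frame_exists LM (f0 y).
exists lam', r'; split => //.
have [b sb bP] := vbmap_coef F0 F' F.
have b0 : b y != 0.
  apply: contraNneq (is_frame_neq0 F') => b0; apply/eqP/(@F0_inj R L' L Phi).
  by rewrite (dsnbhs_self bP) b0 scale0r.
have [n [a [g [sa sg lf]]]] := local_form_exists th1 (lretract_manifold (f0 y) (ob_manifold GG)) F.
have [c sc cP] := sm_div (sm_cst N 1) sb b0.
exists n, (fun i z => c z * a i (f0 z)), (fun i z => g i (f0 z)); split.
- by move=> i; apply: sm_mul => //; exact: sm_smap (sa i).
- by move=> i; exact: sm_smap (sg i).
apply: filterS3 (filterI bP (dsnbhs_neq0 sb b0)) cP (smooth_near (f := f0) lf) => z [bz bz0] cz H1 v.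
apply: (vbmap_inj (@F0_inj R L' L Phi z)).
rewrite linearZ /= [F0 z (lam' z)]bz form_pullE H1 scalerA; congr (_ *: _).
rewrite mulr_suml; apply: eq_bigr => i _; rewrite dd_dmap// cz; field.
exact: bz0.
Qed.

(** A morphism carries the action of [h] to that of [f h], where invariance of theta is known;
    fibrewise injectivity brings the equality back to L'. *)
Lemma form_pull_partial (theta : form1 LM) :
  (forall g (v : tangent g), partial_form theta v = 0) ->
  forall h (v : tangent h), partial_form (form_pull F0 theta) v = 0.
Proof.
move=> dth h v; apply/partial_form_act; set z := in_total _.
have mb := vm_base_mor Phi.
have [z1 A1] : exists z1, act h z z1 by exact: act_total.
have A2 := act_morphism Phi A1; rewrite FT0_form_pull in A2.
have A3 := iffLR (partial_form_act theta (dmap f v)) (dth _ _).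
have E1 : in_total (theta (f0 (gsrc HH h)) (dmap f0 (dmap (gsrc HH) v))) =
    in_total (theta (s (f h)) (dmap s (dmap f v))).
  apply: form_total_eq => [|q sq]; first by rewrite (mor_src mb).
  rewrite !dd_dmap//; first by congr dd; apply/funext => k; rewrite (mor_src mb).
    exact: (sm_smap s sq).
  exact: (sm_smap f0 sq).
have E2 : in_total (theta (f0 (gtgt HH h)) (dmap f0 (dmap (gtgt HH) v))) =
    in_total (theta (t (f h)) (dmap t (dmap f v))).
  apply: form_total_eq => [|q sq]; first by rewrite (mor_tgt mb).
  rewrite !dd_dmap//; first by congr dd; apply/funext => k; rewrite (mor_tgt mb).
    exact: (sm_smap t sq).
  exact: (sm_smap f0 sq).
rewrite E1 in A2; have := act_fun A2 A3; rewrite -E2.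
have [l z1l] := in_totalE (act_tgt A1); rewrite z1l => /in_total_inj El.
suff <- : l = form_pull F0 theta (dmap (gtgt HH) v) by rewrite -z1l.
by apply: (vbmap_inj (@F0_inj R L' L Phi _)); rewrite form_pullE -El.
Qed.

Lemma related_inj (theta1 theta2 : form1 LM) theta' :
  related Phi theta1 theta' -> related Phi theta2 theta' -> theta1 = theta2.
Proof.
move=> r1 r2; apply/functional_extensionality_dep => x; apply/funext => v.
have [p px] := left_leg_surj Phi x; case: x / px v => v.
have [W <-] := left_leg_onto v.
by have /in_total_inj := act_fun (r1 p W) (r2 p W).
Qed.

Variable theta' : form1 LN.
Hypotheses (th1 : is_form1 theta') (dth : forall h (v : tangent h), partial_form theta' v = 0).

Arguments theta' : clear implicits.

(* Two lifts of a tangent vector of M are joined by a curve of arrows of H. *)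
Lemma descent_unique (p q : P) (V : tangent p) (W : tangent q) z1 z2 : p1 p = p1 q ->
  (forall h, sm h -> dd V (fun x => h (p1 x)) = dd W (fun x => h (p1 x))) ->
  act (pg p) (FT0 (in_total (theta' (p2 p) (dmap p2 V)))) z1 ->
  act (pg q) (FT0 (in_total (theta' (p2 q) (dmap p2 W)))) z2 -> z1 = z2.
Proof.
move=> pq VW A1 A2; have [k [E [C LC]]] := bibundle_lretract p.
have [c c0 cV] := lret_curve V LC.
have d0 : (smap_comp p1 c) 0 = p1 q by rewrite /= c0.
have dW : vel (smap_comp p1 c) (dmap p1 W).
  by move=> h sh; rewrite dd_dmap// -VW//; exact: cV (sm_smap p1 sh).
have [kap [b [k0 kid b0 bW bc]]] := curve_lift (bibundle_lretract q) (ob_manifold GG)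
  (@left_leg_onto _ _ _ Phi q) d0 dW.
pose a := smap_comp c kap.
have aV : vel a V by apply: (vel_near cV); apply: filterS kid => e /= ->.
have ab e : t (pg (b e)) = t (pg (a e)) := bc e.
have cond e : s (ginv GG (pg (a e))) = t (pg (b e)) by rewrite src_inv ab.
(* The quotient of the arrows of [a e] and [b e] is an arrow of G between points in the image of
   [f0]; by full faithfulness it comes from an arrow of H from [p2 (b e)] to [p2 (a e)]. *)
pose d := Smap (smooth_gmd (a := smap_comp (ginv GG) (smap_comp pg a)) (b := smap_comp pg b) cond).
have dt e : t (d e) = f0 (p2 (a e)).
  by rewrite [LHS](tgt_gmd (cond e)) tgt_inv bibundle_cond.
have ds e : s (d e) = f0 (p2 (b e)).
  by rewrite [LHS](src_gmd (cond e)) bibundle_cond.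
have [K [Kt Ks Kf _]] := base_ff Phi.
pose g := smap_comp K (@dsub_map R _ (dprod (dprod N N) G)
  [set q | t q.2 = f0 q.1.1 /\ s q.2 = f0 q.1.2]
  (spair (spair (smap_comp p2 a) (smap_comp p2 b)) d) (fun e => conj (dt e) (ds e))).
have gt e : gtgt HH (g e) = p2 (a e) by exact: Kt.
have gs e : gsrc HH (g e) = p2 (b e) by exact: Ks.
have gf e : f (g e) = d e by exact: Kf.
have a0 : a 0 = p by rewrite /= k0.
have [X gX] := curve_tangent (erefl (g 0)).
have := iffLR (partial_form_act theta' X) (dth X).
have -> : in_total (theta' (gsrc HH (g 0)) (dmap (gsrc HH) X)) = in_total (theta' (p2 q) (dmap p2 W)).
  apply: form_total_eq => [|h sh]; first by rewrite gs b0.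
  rewrite !dd_dmap//; have [_ <-] := gX _ (sm_smap (gsrc HH) sh).
  have [_ <-] := bW _ (sm_smap p2 sh).
  by rewrite (_ : (fun e => h (gsrc HH (g e))) = (fun e => h (p2 (b e))))//; apply/funext => e; rewrite gs.
have -> : in_total (theta' (gtgt HH (g 0)) (dmap (gtgt HH) X)) = in_total (theta' (p2 p) (dmap p2 V)).
  apply: form_total_eq => [|h sh]; first by rewrite gt a0.
  rewrite !dd_dmap//; have [_ <-] := gX _ (sm_smap (gtgt HH) sh).
  have [_ <-] := aV _ (sm_smap p2 sh).
  by rewrite (_ : (fun e => h (gtgt HH (g e))) = (fun e => h (p2 (a e))))//; apply/funext => e; rewrite gt.
move=> /(act_morphism Phi); rewrite gf => A3.
have := act_gmd A3 A1.
have -> : gmd GG (pg p) (d 0) = pg q.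
  have -> : d 0 = gmd GG (ginv GG (pg p)) (pg q) by rewrite -a0 -b0.
  rewrite -gmdA; [|by rewrite tgt_inv|by rewrite src_inv; exact: pq].
  by rewrite gmdgV; rewrite -[t (pg p)]/(p1 p) pq; exact: gmd1g.
by move=> A4; exact: act_fun A4 A2.
Qed.

(** The left leg is a surjective submersion, so every tangent vector of M has a lift and the default
    value is never taken; by [descent_unique] the value does not depend on the lift. *)
Definition descent : form1 LM := fun x v => xget 0 [set z | exists (p : P) (V : tangent p),
  [/\ p1 p = x, forall h, sm h -> dd V (fun q => h (p1 q)) = dd v h &
      act (pg p) (FT0 (in_total (theta' (p2 p) (dmap p2 V)))) (in_total z)]].

Arguments descent : clear implicits.

Lemma descent_related : related Phi descent theta'.
Proof.
move=> p V; have [z1 A1] : exists z1,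
    act (pg p) (FT0 (in_total (theta' (p2 p) (dmap p2 V)))) z1.
  by apply: act_total; rewrite bibundle_cond.
have [z zE] := in_totalE (act_tgt A1); rewrite zE in A1.
rewrite /descent; case: xgetP => [z' _ [q [W [pq WV A2]]]|].
  have <- := descent_unique (esym pq) _ A1 A2; first exact: A1.
  by move=> h sh; rewrite WV// dd_dmap.
move=> /(_ z) []; exists p, V; split => // h sh.
by rewrite dd_dmap.
Qed.

Lemma act_lin g x y (v v' : LM x) (w w' : LM y) (a : R) :
  act g (in_total v) (in_total w) -> act g (in_total v') (in_total w') ->
  act g (in_total (a *: v + v')) (in_total (a *: w + w')).
Proof.
move=> A1 A2; have /= xs := act_src A1; have /= yt := act_tgt A1.
move: xs yt v v' w w' A1 A2 => -> -> v v' w w'.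
move=> [e [/in_totalE[l ->]]]; rewrite tot_src tot_tgt => /in_total_inj <- /in_total_inj <-.
move=> [e' [/in_totalE[l' ->]]]; rewrite tot_src tot_tgt => /in_total_inj <- /in_total_inj <-.
exists (in_total (a *: l + l')); split => //.
  by rewrite tot_src /vb_total /= /vb_total_fun /= linearP.
by rewrite tot_tgt /vb_total /= /vb_total_fun /= linearP.
Qed.

Lemma descent_lin x : linear (descent x).
Proof.
move=> a v w; have [p px] := left_leg_surj Phi x; case: x / px v w => v w.
have [V <-] := left_leg_onto v; have [W <-] := left_leg_onto w; rewrite -dmapL.
have := act_lin a (descent_related V) (descent_related W) => A1.
have A2 := descent_related (a *: V + W).
apply: in_total_inj; apply: (act_fun A2); move: A1; congr act.
have [lt _] := th1.
by rewrite dmapL lt /vb_total /= /vb_total_fun /= linearP.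
Qed.

(** Along a local section [sig] of the left leg the descended form is [k (sig y)] times the
    pull-back of [theta'] by the right leg, which exhibits a local form with smooth coefficients. *)
Lemma descent_form1 : is_form1 descent.
Proof.
apply: local_form_is_form1; first exact: descent_lin.
move=> x; have [p px] := left_leg_surj Phi x; case: x / px.
have [lam [r F]] := frame_exists LM (p1 p); have [lam' [r' F']] := frame_exists LN (p2 p).
exists lam, r; split => //; have [k sk kP] := bibundle_coef F F'.
have [n [a [b [sa sb lf]]]] := local_form_exists th1 (lretract_manifold (p2 p) (ob_manifold HH)) F'.
have [sig [sp sP]] := submersion_section (bibundle_lretract p) (ob_manifold GG)
  (@left_leg_onto _ _ _ Phi p).
exists n, (fun i y => k (sig y) * a i (p2 (sig y))), (fun i y => b i (p2 (sig y))); split.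
- move=> i; apply: sm_mul; first exact: sm_smap sk.
  exact: (sm_smap (smap_comp p2 sig) (sa i)).
- by move=> i; exact: (sm_smap (smap_comp p2 sig) (sb i)).
have N1 : dsnbhs (p1 p) (fun y => k (sig y) != 0 /\
    act (pg (sig y)) (FT0 (in_total (lam' (p2 (sig y))))) (in_total (k (sig y) *: lam (p1 (sig y))))).
  apply: (smooth_near (f := sig) (A := fun q => k q != 0 /\
    act (pg q) (FT0 (in_total (lam' (p2 q)))) (in_total (k q *: lam (p1 q))))).
  by rewrite sp.
have N2 : dsnbhs (p1 p) (fun y => forall v : tangent (p2 (sig y)),
    theta' (p2 (sig y)) v = (\sum_i a i (p2 (sig y)) * dd v (b i)) *: lam' (p2 (sig y))).
  apply: (smooth_near (f := smap_comp p2 sig) (A := fun y => forall v : tangent y,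
    theta' y v = (\sum_i a i y * dd v (b i)) *: lam' y)).
  by rewrite /= sp.
apply: filterS3 N1 N2 (dsnbhs_join sP) => y [k0 A1] tE Sy v.
have ys := dsnbhs_self Sy.
have A2 := descent_related (dmap sig v).
have E : in_total (descent (p1 (sig y)) (dmap p1 (dmap sig v))) = in_total (descent y v).
  apply: form_total_eq => // h sh; rewrite !dd_dmap//; last exact: (sm_smap p1 sh).
  apply: dd_near => //; first exact: (sm_smap (smap_comp p1 sig) sh).
  by apply: filterS Sy => z ->.
rewrite E tE in A2.
have A3 := act_tsc (\sum_i a i (p2 (sig y)) * dd (dmap p2 (dmap sig v)) (b i)) A1.
rewrite -vb_tsc !tscE ys in A3; have /in_total_inj -> := act_fun A2 A3.
rewrite scalerA mulr_suml; congr (_ *: _); apply: eq_bigr => i _.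
by rewrite !dd_dmap//; [ring|exact: (sm_smap p2 (sb i))].
Qed.

(** A curve of arrows with velocity [v] is multiplied with a lift of its sources to the bibundle.
    The product lies over the targets and has the same right leg, so [theta'] contributes the same
    vector at both ends. *)
Lemma descent_partial g (v : tangent g) : partial_form descent v = 0.
Proof.
apply/partial_form_act; have [p ps] := left_leg_surj Phi (s g).
have [W WE] := left_leg_onto (tcast (esym ps) (dmap s v)).
have [k [E [C LC]]] := lretract_manifold g (arr_manifold GG).
have [c c0 cv] := lret_curve v LC.
have d0 : (smap_comp s c) 0 = p1 p by rewrite /= c0.
have dW : vel (smap_comp s c) (dmap p1 W).
  by move=> h sh; rewrite WE dd_tcast dd_dmap//; exact: cv (sm_smap s sh).
have [kap [b [k0 kid b0 bW bc]]] := curve_lift (bibundle_lretract p) (ob_manifold GG)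
  (@left_leg_onto _ _ _ Phi p) d0 dW.
have cond e : s (c (kap e)) = t (pg (b e)) := esym (bc e).
pose m := Smap (smooth_gmd (a := smap_comp c kap) (b := smap_comp pg b) cond).
have condP e : s (m e) = f0 (p2 (b e)) by rewrite [LHS](src_gmd (cond e)) bibundle_cond.
pose q := Smap (smooth_mkP (a := m) (b := smap_comp p2 b) condP).
have [V qV] := curve_tangent (erefl (q 0)).
have A1 := descent_related V; have A2 := descent_related W.
have E1 : in_total (descent (p1 p) (dmap p1 W)) = in_total (descent (s g) (dmap s v)).
  by apply: form_total_eq => // h sh; rewrite WE dd_tcast.
have E2 : in_total (descent (p1 (q 0)) (dmap p1 V)) = in_total (descent (t g) (dmap t v)).
  apply: form_total_eq => [|h sh].
    by rewrite [LHS](tgt_gmd (cond 0)) /= k0 c0.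
  rewrite !dd_dmap//; have [_ <-] := qV _ (sm_smap p1 sh); have [_ <-] := cv _ (sm_smap t sh).
  apply: near_eq_derive; apply: filterS kid => e ke.
  by rewrite -[p1 (q e)]/(t (m e)) [t (m e)](tgt_gmd (cond e)) /= ke.
have E3 : in_total (theta' (p2 (q 0)) (dmap p2 V)) = in_total (theta' (p2 p) (dmap p2 W)).
  apply: form_total_eq => [|h sh]; first by rewrite /= b0.
  rewrite !dd_dmap//; have [_ <-] := qV _ (sm_smap p2 sh).
  by have [_ <-] := bW _ (sm_smap p2 sh).
have E4 : pg (q 0) = gmd GG g (pg p) by rewrite -[LHS]/(gmd GG (c (kap 0)) (pg (b 0))) k0 c0 b0.
rewrite E2 E3 E4 in A1; rewrite E1 in A2.
have [z A3] : exists z, act g (in_total (descent (s g) (dmap s v))) z by exact: act_total.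
by rewrite -(act_fun (act_gmd A2 A3) A1).
Qed.

(** The relation is read at the point of the bibundle formed by the unit arrow at [f0 y] and [y]
    itself, where the arrow acts trivially. *)
Lemma form_pull_descent : form_pull F0 descent = theta'.
Proof.
apply/functional_extensionality_dep => y; apply/funext => w.
apply: (vbmap_inj (@F0_inj R L' L Phi y)); rewrite form_pullE.
pose p := mkP (src_unit GG (f0 y)) : P.
have ddu h : sm h -> dd (dmap u (dmap f0 w)) h = dd w (fun z => h (u (f0 z))).
  by move=> sh; rewrite !dd_dmap//; exact: (sm_smap u sh).
have [|V [V1 V2]] := @bibundle_curve _ _ _ Phi p (dmap u (dmap f0 w)) w.
  move=> h sh; apply: (etrans (ddu _ (sm_smap s sh))).
  by congr dd; apply/funext => z /=; rewrite src_unit.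
have A1 := descent_related V.
have E1 : in_total (descent (p1 p) (dmap p1 V)) = in_total (descent (f0 y) (dmap f0 w)).
  apply: form_total_eq => [|h sh]; first exact: tgt_unit.
  rewrite !dd_dmap//; apply: (etrans (V1 _ (sm_smap t sh))).
  apply: (etrans (ddu _ (sm_smap t sh))).
  by congr dd; apply/funext => z /=; rewrite tgt_unit.
have E2 : in_total (theta' (p2 p) (dmap p2 V)) = in_total (theta' y w).
  by apply: form_total_eq => // h sh; rewrite dd_dmap//; exact: V2.
rewrite E1 E2 in A1.
have A2 := act_unit (FT0 (in_total (theta' y w))).
exact: in_total_inj (esym (act_fun A2 A1)).
Qed.

End Descent.

Theorem theorem4p17 (R : realType) (L' L : lbg R) (F : vb_morita L' L) :
  set_bij (@contact0 R L) (@contact0 R L') (form_pull (vm_bun0 F)).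
Proof.
split=> [theta|theta1 theta2|theta'].
- move=> cth; have [th1 dth _] := cth.
  have [H _] := contact0_related th1 (form_pull_form1 F th1) dth (form_pull_partial F dth)
    (form_pull_related (Phi := F) dth).
  exact: H.
- rewrite !inE => -[_ d1 _] [_ d2 _] E; apply: related_inj (form_pull_related (Phi := F) d1) _.
  by rewrite E; exact: form_pull_related.
- move=> cth; have [th1 dth _] := cth; have E := form_pull_descent F dth; exists (descent F theta'); last exact: E.
  have [_ H] := contact0_related (descent_form1 F th1 dth) th1 (descent_partial F dth) dth
    (descent_related (Phi := F) dth).
  exact: H.
Qed.
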